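(* Let $T$ be a locally countable acyclic mcp Borel graph on a standard probability space $(X,\mu)$ with associated Radon--Nikodym cocycle $\rho$. Let $X_T^\mu$ be the vertex Radon--Nikodym core of $T$ and let $T_\infty:=T|_{X_T^\mu}$ be the induced subgraph. Then: (a) (Minimality) $X_T^\mu$ is essentially contained in each $T$-convex Borel $E_T$-complete section $Y\subseteq X$, i.e., $X_T^\mu\setminus Y$ is $\mu$-null. (b) (Geometry) Almost every $T_\infty$-component is either a bi-infinite line or a leafless tree with no isolated ends. (c) (Idempotence) After discarding a null set, $X_{T_\infty}^{\mu_\infty}=X_T^\mu$, where $\mu_\infty:=\mu|_{X_T^\mu}$ and $X_{T_\infty}^{\mu_\infty}$ is the vertex Radon--Nikodym core of $T_\infty$ with respect to $\mu_\infty$. (d) (Nullness of the core) $X_T^\mu$ is null if and only if $T$ is essentially at most one-ended.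
   Context: Cocycle. A countable Borel equivalence relation $E$ on $X$ is mcp (measure-class-preserving) with respect to a finite (or $\sigma$-finite) Borel measure $\mu$ if the $E$-saturation of every null set is null. Its Radon--Nikodym cocycle is the (unique up to null sets) Borel $\rho:E\to(0,\infty)$ with $\rho(z,y)\rho(y,x)=\rho(z,x)$ and, writing $\rho^x(y):=\rho(y,x)$, $\int_X\sum_{y\in[x]_E}h(x,y)\,d\mu(x)=\int_X\sum_{y\in[x]_E}h(y,x)\rho^x(y)\,d\mu(x)$ for all Borel $h:E\to[0,\infty]$; it is unchanged by rescaling $\mu$. A set $D\subseteq[x]_E$ is $\rho$-finite or $\rho$-infinite according to whether $\sum_{y\in D}\rho^x(y)$ is finite or infinite (independent of $x$ in the class). Graphs. A graph is an irreflexive symmetric set of pairs of vertices; locally countable means each vertex has countably many neighbors. $E_T$ is the connectedness equivalence relation of $T$; $T$ is mcp if $E_T$ is, and the Radon--Nikodym cocycle associated to $T$ is that of $E_T$. An $E_T$-complete section is a set meeting every $E_T$-class. A set $Y$ of vertices is $T$-convex if it contains the geodesic path between any two of its points lying in the same component. A geodesic ray is an injective infinite path; ends are classes of rays modulo having a common tail. A half-space of $T$ is a $T$-connected set $U$ of vertices with exactly one edge joining $U$ to its complement. The sets $\partial_TU$ of ends represented by rays in $U$, for half-spaces $U$ contained in a component $C$, generate the topology on the set of ends of $C$; an end is isolated if it is an isolated point of this space. A leaf is a vertex of degree $1$. Core. The vertex Radon--Nikodym core $X_T^\mu$ of $T$ (with respect to $\mu$) is the set of all $x\in X$ such that every half-space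 of $T$ containing $x$ is $\rho$-infinite. It is $T$-convex. $T$ is essentially at most one-ended if there is a $T$-convex Borel $E_T$-complete section $Y$ such that every component of $T|_Y$ has at most one end. ''After discarding a null set'' means: for the restriction to the complement of some $E_T$-invariant Borel $\mu$-null set.
   Formalization: In (d), ''essentially at most one-ended'' is required only after discarding an invariant Borel null set, and the implication from it to nullness of the core assumes that almost every vertex has a neighbour (isolated vertices lie vacuously in the core); (d) is false otherwise. *)

(* Defs.v *)
From HB Require Import structures.
From mathcomp Require Import all_boot all_order all_algebra.
From mathcomp Require Import all_classical all_reals all_analysis.
From mathcomp Require Import measurable_realfun.

Set Implicit Arguments.
Unset Strict Implicit.
Unset Printing Implicit Defensive.

Import Order.TTheory GRing.Theory Num.Theory.
Import numFieldNormedType.Exports.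

Local Open Scope classical_set_scope.
Local Open Scope ring_scope.
Local Open Scope ereal_scope.

(* X is Borel isomorphic to a Polish space. *)
Definition standard_borel (R : realType) d (X : measurableType d) : Prop :=
  exists (P : completePseudoMetricType R) (f : X -> P),
    [/\ hausdorff_space P, @second_countable P, bijective f &
        forall A : set X, measurable A <-> <<s @open P >> (f @` A)].

Record graph (X : Type) := Graph {
  vertices : set X;
  edges : set (X * X);
  edges_sub : edges `<=` vertices `*` vertices;
  edges_irr : forall x, ~ edges (x, x);
  edges_sym : forall x y, edges (x, y) -> edges (y, x) }.

Section induced_graph.
Context (X : Type) (T : graph X) (Y : set X).

Let V := vertices T `&` Y.
Let F := edges T `&` Y `*` Y.

Let F_sub : F `<=` V `*` V.
Proof. by move=> e [Te [Y1 Y2]]; have [V1 V2] := edges_sub Te. Qed.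

Let F_irr x : ~ F (x, x).
Proof. by case=> Te _; exact: edges_irr Te. Qed.

Let F_sym x y : F (x, y) -> F (y, x).
Proof. by case=> Te [Y1 Y2]; split; first exact: edges_sym. Qed.

Definition induced_graph : graph X := Graph F_sub F_irr F_sym.

End induced_graph.

Section graph_theory.
Context (X : choiceType).
Implicit Types (T : graph X) (U C Y : set X) (x y : X) (r : nat -> X).

Definition adj T : rel X := fun x y => (x, y) \in edges T.

Definition locally_countable T : Prop :=
  forall x, countable [set y | edges T (x, y)].

Definition acyclic T : Prop :=
  forall s : seq X, (2 < size s)%N -> ~ ucycle (adj T) s.

Definition linked T x y : Prop := exists2 s, path (adj T) x s & last x s = y.

(* The relation E_T, on the vertex set of T. *)
Definition conn_rel T : set (X * X) :=
  [set p | [/\ vertices T p.1, vertices T p.2 & linked T p.1 p.2]].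

Definition component T x : set X := [set y | conn_rel T (x, y)].

Definition complete_section T Y : Prop :=
  forall x, vertices T x -> exists2 y, Y y & conn_rel T (x, y).

Definition geodesic T x (s : seq X) : Prop :=
  path (adj T) x s /\
  forall s', path (adj T) x s' -> last x s' = last x s -> (size s <= size s')%N.

Definition graph_convex T Y : Prop :=
  forall x s, Y x -> Y (last x s) -> geodesic T x s ->
  forall z, z \in s -> Y z.

Definition graph_connected T U : Prop :=
  forall x y, U x -> U y -> linked (induced_graph T U) x y.

Definition half_space T U : Prop :=
  [/\ U `<=` vertices T, graph_connected T U &
      exists! e : X * X, [/\ edges T e, U e.1 & ~ U e.2]].

Definition ray T r : Prop := injective r /\ forall n, edges T (r n, r n.+1).

Definition cotail r r' : Prop := exists m n, forall k, r (m + k)%N = r' (n + k)%N.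

Definition end_of T r : set (nat -> X) := [set r' | ray T r' /\ cotail r r'].

(* The ends represented by rays in U: this is the boundary of U for a
   half-space U, and the set of ends of U for a component U. *)
Definition ends_in T U : set (set (nat -> X)) :=
  [set xi | exists r, [/\ ray T r, range r `<=` U & xi = end_of T r]].

(* The ends of all components at once. The boundary of a half-space outside a
   component C contains no end of C, so the subspace topology on
   ends_in T C is generated by the boundaries of the half-spaces inside C. *)
Definition end_space T : Type := set (nat -> X).

HB.instance Definition _ T := Choice.on (end_space T).
HB.instance Definition _ T :=
  isSubBaseTopological.Build (end_space T) (half_space T) (ends_in T).

Definition no_isolated_end T C : Prop :=
  isolated (ends_in T C : set (end_space T)) = set0.

Definition leaf T x : Prop := exists! y, edges T (x, y).

Definition bi_infinite_line T C : Prop :=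
  exists f : int -> X, [/\ injective f, range f = C &
    forall i j : int, edges T (f i, f j) <-> `|i - j|%N = 1%N].

Definition at_most_one_ended T : Prop :=
  forall x, vertices T x ->
  forall xi eta, ends_in T (component T x) xi -> ends_in T (component T x) eta ->
  xi = eta.

End graph_theory.

Section measured_graphs.
Context d (X : measurableType d) (R : realType).
Variable mu : {measure set X -> \bar R}.
Implicit Types (T : graph X) (rho : X * X -> R).

Definition countable_borel_equivalence (V : set X) (E : set (X * X)) : Prop :=
  [/\ measurable E, E `<=` V `*` V & forall x, countable [set y | E (x, y)]] /\
  [/\ forall x, V x -> E (x, x),
      forall x y, E (x, y) -> E (y, x) &
      forall x y z, E (x, y) -> E (y, z) -> E (x, z)].

(* Below, a graph T carries the restriction of mu to the vertices of T. *)

Definition mcp T : Prop :=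
  countable_borel_equivalence (vertices T) (conn_rel T) /\
  forall N : set X, N `<=` vertices T -> mu.-negligible N ->
    mu.-negligible [set x | exists2 y, N y & conn_rel T (x, y)].

(* rho (y, x) is the weight of y relative to x. *)
Definition rn_cocycle T rho : Prop :=
  [/\ measurable_fun (conn_rel T) rho,
      forall p, conn_rel T p -> (0 < rho p)%R,
      forall x y z, conn_rel T (x, y) -> conn_rel T (y, z) ->
        (rho (z, y) * rho (y, x))%R = rho (z, x) &
      forall h : X * X -> \bar R,
        measurable_fun (conn_rel T) h -> (forall p, conn_rel T p -> 0 <= h p) ->
        \int[mu]_(x in vertices T) (\esum_(y in component T x) h (x, y)) =
        \int[mu]_(x in vertices T)
          (\esum_(y in component T x) (h (y, x) * (rho (y, x))%:E))].

(* An isolated vertex belongs to no half-space, hence to the core. *)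
Definition vertex_core T rho : set X :=
  [set x | vertices T x /\ forall U, half_space T U -> U x ->
    \esum_(y in U) (rho (y, x))%:E = +oo].

Definition invariant_null T (N : set X) : Prop :=
  [/\ measurable N, mu N = 0 &
      forall x y, conn_rel T (x, y) -> N x -> N y].

(* Required only off an invariant null set: a nonhyperfinite T living on a null
   set, which mu does not see, may have no Borel section as below everywhere. *)
Definition ess_at_most_one_ended T : Prop :=
  exists2 N, invariant_null T N &
  let T' := induced_graph T (~` N) in
  exists Y : set X,
    [/\ measurable Y, Y `<=` vertices T', graph_convex T' Y,
        complete_section T' Y & at_most_one_ended (induced_graph T' Y)].

End measured_graphs.

(* Main.v *)
Require Import Defs.
From mathcomp Require Import all_boot all_order all_algebra.
From mathcomp Require Import all_classical all_reals all_analysis.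
From mathcomp Require Import measurable_realfun.
From mathcomp Require Import lra zify.

Set Implicit Arguments.
Unset Strict Implicit.
Unset Printing Implicit Defensive.

Local Open Scope classical_set_scope.

Import Order.TTheory GRing.Theory Num.Theory.

(** The idea is to move mass along the equivalence relation E_T and to use that a
probability measure is finite.

Half-spaces. Removing an edge (a, b) of a tree leaves the half-space of the points
behind a, here side T a b, and every half-space is of this form (half_spaceP). Convexity
is a condition on the edges that separate two points (graph_convexP). The core consists
of the points that lie in no half-space of finite weight; it is convex (core_convex).

Mass transport. If each point sends its mass to at most one point of its class, in a
Borel way, then almost every point receives finite mass (functional_fibre_finite). Applied
to the projection onto a convex Borel set Y, this says that the pieces of the tree which
hang from Y are finite almost everywhere (nearest_fibre_finite). A point of the core
outside Y would lie in such a piece, which gives minimality (core_sub_convex). With Y the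
core itself, the half-space behind a leaf of the core would be such a piece
(core_two_neighbours). Likewise, a half-space of the core that never ramifies and starts
next to a ramification point could send all its mass to its starting point, which
excludes isolated ends unless the component is a line (core_no_isolated_branch,
isolated_unramified).

Components that miss the core. If the component is finite, its heaviest points are finite in
number and a Borel linear order selects one of them. If it is infinite, each x has exactly one
neighbour y such that the half-space behind x, seen from y, is finite; T is thus the graph
of a function x -> y, and backward orbits have finite mass. The mass of the past of x of
age at least k tends to 0 as k grows. For e > 0 call z late if after some number k of steps
it is at a point x whose past of age at least k has mass at most e. In total, each x
receives at most e from late points, so these have measure at most e (late_measure). The
forward orbits of the points that are not late, for the least e = 1/(n+1) for which there are any in
the component, form a forward invariant set without backward rays, hence a convex set with one
end (coreless_section).

Conclusion. If the core is null, the last paragraph gives a section with at most one end.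
Conversely such a section contains almost all of the core; but the core has no leaves, so
a point of the core with an edge starts two rays in different directions. The same
contradiction, for the core of the core, shows that the latter meets almost every
component of the core, and then minimality shows that it is almost everything. Cocycles on the core
agree almost everywhere by mass transport along a single Borel function (rn_cocycle_le).

Measurability. All the sets above are defined by quantifiers over a class, and the core
has to be Borel, not merely measurable for the completion of the measure. This rests
on the Lusin-Novikov theorem: a Borel relation with countable sections is covered by
countably many Borel functions (lusin_novikov). It is proved here from Lusin separation of
Souslin sets: if the relation were not covered, uncovered pieces could be split
indefinitely over a common x, and a Cantor set would appear in one section. *)

(** * Souslin sets and Lusin separation *)

Definition pair_code (i j : nat) : nat := pickle (i, j).
Definition code_fst (k : nat) : nat := (odflt (0, 0)%N (unpickle k)).1.
Definition code_snd (k : nat) : nat := (odflt (0, 0)%N (unpickle k)).2.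

Lemma code_fstK i j : code_fst (pair_code i j) = i.
Proof. by rewrite /code_fst /pair_code pickleK. Qed.

Lemma code_sndK i j : code_snd (pair_code i j) = j.
Proof. by rewrite /code_snd /pair_code pickleK. Qed.

Lemma bound_below (f : nat -> nat) n : exists N, forall k, (k < n)%N -> (f k < N)%N.
Proof.
elim: n => [|n [N HN]]; first by exists 0%N.
exists (maxn N (f n).+1) => k; rewrite ltnS leq_eqVlt => /predU1P[->|/HN kN].
  by rewrite leq_max ltnSn orbT.
by rewrite leq_max kN.
Qed.

Lemma eq_mkseqP (T : Type) (f g : nat -> T) n :
  mkseq f n = mkseq g n <-> (forall k, (k < n)%N -> f k = g k).
Proof.
split=> [fg k kn|fg].
  by rewrite -(nth_mkseq (f 0%N) f kn) fg nth_mkseq.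
by rewrite /mkseq; apply/eq_in_map => k; rewrite mem_iota => /fg.
Qed.

Lemma eq_mkseq_le (T : Type) (f g : nat -> T) m n : (m <= n)%N ->
  mkseq f n = mkseq g n -> mkseq f m = mkseq g m.
Proof.
move=> mn /eq_mkseqP fg; apply/eq_mkseqP => k km; apply: fg.
exact: leq_trans km mn.
Qed.

Lemma mkseq_nth (T : Type) (x0 : T) (f : nat -> T) m n : (m <= n)%N ->
  mkseq (nth x0 (mkseq f n)) m = mkseq f m.
Proof.
move=> mn; apply/eq_mkseqP => k km; rewrite nth_mkseq //.
exact: leq_trans km mn.
Qed.

Section souslin_sets.
Variables (W : Type) (c : W -> nat -> nat).

(** Projections of trees: the analytic sets, read through the coding c. *)
Definition souslin (A : set W) := exists T : seq nat -> seq nat -> Prop,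
  forall x, A x <-> exists a, forall n, T (mkseq (c x) n) (mkseq a n).

(** The witness codes the index sequence in row 0 and, in row n+1, a witness for
the membership in the set with the n-th index. *)
Lemma souslin_op (F : seq nat -> set W) : (forall s, souslin (F s)) ->
  souslin [set x | exists a, forall n, F (mkseq a n) x].
Proof.
move=> /choice[T HT].
pose sub w n m := mkseq (fun k => nth 0%N w (pair_code n k)) m.
exists (fun u w => forall n m, (m <= size u)%N ->
  (forall k, (k < n)%N -> (pair_code 0 k < size w)%N) ->
  (forall k, (k < m)%N -> (pair_code n.+1 k < size w)%N) ->
  T (sub w 0%N n) (mkseq (nth 0%N u) m) (sub w n.+1 m)) => x; split.
- move=> [g /= Hg].
  have /choice[b Hb] : forall n, exists b, forall m,
      T (mkseq g n) (mkseq (c x) m) (mkseq b m).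
    by move=> n; apply/HT.
  pose a k := if code_fst k is i.+1 then b i (code_snd k) else g (code_snd k).
  exists a => N n m; rewrite !size_mkseq => mN w0 wn.
  rewrite (mkseq_nth _ _ mN).
  have -> : sub (mkseq a N) 0%N n = mkseq g n.
    apply/eq_mkseqP => k kn.
    by rewrite nth_mkseq ?w0// /a code_fstK code_sndK.
  have -> : sub (mkseq a N) n.+1 m = mkseq (b n) m.
    apply/eq_mkseqP => k kn.
    by rewrite nth_mkseq ?wn// /a code_fstK code_sndK.
  exact: Hb.
- move=> [a Ha]; exists (fun k => a (pair_code 0 k)) => n.
  apply/HT; exists (fun k => a (pair_code n.+1 k)) => m.
  have [N1 H1] := bound_below (fun k => pair_code 0 k) n.
  have [N2 H2] := bound_below (fun k => pair_code n.+1 k) m.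
  pose N := maxn m (maxn N1 N2).
  have mN : (m <= N)%N by rewrite leq_maxl.
  have N1N : (N1 <= N)%N by rewrite /N !leq_max leqnn orbT.
  have N2N : (N2 <= N)%N by rewrite /N !leq_max leqnn !orbT.
  have := Ha N n m; rewrite !size_mkseq => /(_ mN).
  have h1 k : (k < n)%N -> (pair_code 0 k < N)%N.
    by move=> /H1 h; exact: leq_trans h N1N.
  have h2 k : (k < m)%N -> (pair_code n.+1 k < N)%N.
    by move=> /H2 h; exact: leq_trans h N2N.
  move=> /(_ h1 h2); rewrite (mkseq_nth _ _ mN).
  have -> : sub (mkseq a N) 0%N n = mkseq (fun k => a (pair_code 0 k)) n.
    by apply/eq_mkseqP => k kn; rewrite nth_mkseq ?h1.
  suff -> : sub (mkseq a N) n.+1 m = mkseq (fun k => a (pair_code n.+1 k)) m by [].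
  by apply/eq_mkseqP => k kn; rewrite nth_mkseq ?h2.
Qed.

Lemma souslin_bigcap (F : nat -> set W) : (forall n, souslin (F n)) ->
  souslin (\bigcap_n F n).
Proof.
move=> FS; have := @souslin_op (fun s => F (size s)) (fun s => FS _).
congr souslin; apply/seteqP; split=> x /=.
  by move=> [a Ha] n _; have := Ha n; rewrite size_mkseq.
by move=> Fx; exists id => n; exact: Fx.
Qed.

Lemma souslin_bigcup (F : nat -> set W) : (forall n, souslin (F n)) ->
  souslin (\bigcup_n F n).
Proof.
move=> FS.
have SF s : souslin (if s is n :: _ then F n else setT).
  case: s => [|n s]; last exact: FS.
  by exists (fun _ _ => True) => x; split => // _; exists id.
have := souslin_op SF.
congr souslin; apply/seteqP; split=> x /=.
  by move=> [a /(_ 1%N)] /= ?; exists (a 0%N).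
by move=> [n _ Fx]; exists (fun=> n); case.
Qed.

Lemma souslin_coord n k : souslin [set x | c x n = k].
Proof.
exists (fun u _ => (n < size u)%N -> nth 0%N u n = k) => x; split=> /=.
  by move=> <-; exists id => m; rewrite size_mkseq => nm; rewrite nth_mkseq.
by move=> [a /(_ n.+1)]; rewrite size_mkseq nth_mkseq //; exact.
Qed.

(** The sets that are Souslin together with their complement form a
sigma-algebra. *)
Lemma souslin_gen (G : set (set W)) :
  (forall A, G A -> souslin A /\ souslin (~` A)) ->
  forall A, <<s G >> A -> souslin A.
Proof.
move=> HG.
pose D := [set A : set W | souslin A /\ souslin (~` A)].
have DS : sigma_algebra setT D.
  split.
  - rewrite /D /=; split.
      by exists (fun _ _ => False) => x; split=> [[]|[a /(_ 0%N)]] //.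
    by exists (fun _ _ => True) => x; split=> _; [exists id|case].
  - by move=> A [A1 A2]; rewrite /D /= setTD setCK.
  - move=> F FD; split; first by apply: souslin_bigcup => n; have [] := FD n.
    by rewrite setC_bigcup; apply: souslin_bigcap => n; have [] := FD n.
move=> A GA.
suff : D A by case.
by apply: (GA D); split.
Qed.

End souslin_sets.

(** A code identifies a measurable space with a closed subset of the Baire
space; the topology of a standard Borel space enters only through it. *)
Record borel_code d (X : measurableType d) (c : X -> nat -> nat) : Prop := BorelCode {
  code_inj : forall x y, (forall n, c x n = c y n) -> x = y;
  code_closed : forall a, (forall n, exists x, mkseq (c x) n = mkseq a n) ->
    exists x, forall n, c x n = a n;
  code_measurable : forall n k, measurable [set x | c x n = k];
  code_generates : forall A : set X, measurable A ->
    <<s [set B | exists n k, B = [set x | c x n = k]] >> A }.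

Lemma bigcup_countType_measurable d (X : measurableType d) (I : countType)
    (F : I -> set X) : (forall i, measurable (F i)) -> measurable (\bigcup_i F i).
Proof. by move=> Fm; apply: countable_bigcupT_measurable => //; exact: countableP. Qed.

Lemma bigcap_countType_measurable d (X : measurableType d) (I : countType)
    (F : I -> set X) : (forall i, measurable (F i)) -> measurable (\bigcap_i F i).
Proof.
move=> Fm; rewrite -[X in measurable X]setCK setC_bigcap; apply: measurableC.
by apply: bigcup_countType_measurable => i; exact: measurableC.
Qed.

Section measurable_souslin.
Context d (X : measurableType d) (c : X -> nat -> nat).
Hypothesis cX : borel_code c.

Lemma measurable_souslin (A : set X) : measurable A -> souslin c A.
Proof.
move=> /(code_generates cX); apply: souslin_gen => B [n [k ->]].
split; first exact: souslin_coord.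
have -> : ~` [set x | c x n = k] =
    \bigcup_j (if j == k then set0 else [set x | c x n = j]).
  apply/seteqP; split=> x /=.
    by move=> /eqP/negbTE cxk; exists (c x n) => //; rewrite cxk.
  by move=> [j _]; case: eqP => //= jk cxj cxk; apply: jk; rewrite -cxj.
apply: souslin_bigcup => j; case: eqP => _; last exact: souslin_coord.
by exists (fun _ _ => False) => x; split=> [[]|[a /(_ 0%N)]] //.
Qed.

Lemma code_prefix_measurable (s : seq nat) n :
  measurable [set x | mkseq (c x) n = s].
Proof.
have [ns|/eqP ns] := eqVneq (size s) n; last first.
  rewrite (_ : [set _ | _] = set0)// -subset0 => x /= cs.
  by apply: ns; rewrite -cs size_mkseq.
rewrite (_ : [set _ | _] = \bigcap_(k in `I_n) [set x | c x k = nth 0%N s k]).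
  by apply: bigcap_measurableType => k _; exact: (code_measurable cX).
apply/seteqP; split=> x /=.
  by move=> <- k /= kn; rewrite nth_mkseq.
move=> H; apply: (@eq_from_nth _ 0%N); rewrite size_mkseq ?ns// => k kn.
by rewrite nth_mkseq//; exact: H.
Qed.

Lemma code_pred_measurable (P : seq nat -> Prop) n :
  measurable [set x | P (mkseq (c x) n)].
Proof.
rewrite (_ : [set _ | _] = \bigcup_(s in [set s | P s]) [set x | mkseq (c x) n = s]).
  rewrite bigcup_mkcond; apply: countable_bigcupT_measurable; first exact: countableP.
  by move=> s; case: ifP => // _; exact: code_prefix_measurable.
apply/seteqP; split=> x /=; first by move=> ?; exists (mkseq (c x) n).
by move=> [s /= Ps ->].
Qed.

(** A countable conjunction of conditions that are measurable in x and look
at finitely many values of the witness a defines a Souslin set. *)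
Lemma souslin_local (I : countType) (P : I -> (nat -> nat) -> set X) (K : I -> nat) :
  (forall i a b, mkseq a (K i) = mkseq b (K i) -> P i a `<=` P i b) ->
  (forall i a, measurable (P i a)) ->
  souslin c [set x | exists a, forall i, P i a x].
Proof.
move=> Ploc Pm.
pose F s : set X := \bigcap_(i in [set i | (K i <= size s)%N]) P i (nth 0%N s).
have FS s : souslin c (F s).
  apply: measurable_souslin; rewrite /F bigcap_mkcond.
  by apply: bigcap_countType_measurable => i; case: ifP.
have := souslin_op FS; congr souslin; apply/seteqP; split=> x /= [a Ha];
  exists a.
- move=> i; have := Ha (K i) i; rewrite /= size_mkseq leqnn => /(_ isT).
  by apply: Ploc; rewrite mkseq_nth.
- move=> n i /=; rewrite size_mkseq => Kn; apply: Ploc (Ha i).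
  by rewrite mkseq_nth.
Qed.

(** Two inseparable trees have inseparable immediate subtrees over a common
prefix; the branch that they determine lies in both sets. *)
Lemma souslin_separation (A B : set X) : souslin c A -> souslin c B ->
  A `&` B = set0 -> exists2 M, measurable M & A `<=` M /\ M `&` B = set0.
Proof.
move=> [S HS] [T HT] AB0; apply: contrapT => nsep.
pose part (S : seq nat -> seq nat -> Prop) (u v : seq nat) : set X :=
  [set x | mkseq (c x) (size u) = u /\ exists a, mkseq a (size v) = v /\
           forall n, S (mkseq (c x) n) (mkseq a n)].
pose sep (A B : set X) := exists2 M, measurable M & A `<=` M /\ M `&` B = set0.
(* If all pairs from two countable covers can be separated, so can the unions. *)
have sepU (P Q : nat -> set X) : (forall i j, sep (P i) (Q j)) ->
    sep (\bigcup_i P i) (\bigcup_j Q j).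
  move=> H.
  have /choice[M HM] : forall ij : nat * nat, exists M, measurable M /\
      P ij.1 `<=` M /\ M `&` Q ij.2 = set0.
    by move=> ij; have [M] := H ij.1 ij.2; exists M.
  exists (\bigcup_i \bigcap_j M (i, j)).
    apply: bigcupT_measurable => i; apply: bigcapT_measurable => j.
    by have [] := HM (i, j).
  split=> [x [i _ Pix]|].
    by exists i => // j _; have [_ [PM _]] := HM (i, j); exact: PM.
  rewrite -subset0 => x [[i _ Mx] [j _ Qx]].
  by have [_ [_ <-]] := HM (i, j); split; [exact: Mx|].
have step u v w : ~ sep (part S u v) (part T u w) ->
    exists k, ~ sep (part S (rcons u k.1.1) (rcons v k.1.2))
                    (part T (rcons u k.1.1) (rcons w k.2)).
  move=> nuvw; apply: contrapT => /forallNP H; apply: nuvw.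
  have partE R p q : part R p q `<=`
      \bigcup_i part R (rcons p (code_fst i)) (rcons q (code_snd i)).
    move=> x [cx [a [aq ax]]].
    exists (pair_code (c x (size p)) (a (size q))) => //.
    rewrite code_fstK code_sndK; split.
      by rewrite size_rcons mkseqS cx.
    by exists a; split=> //; rewrite size_rcons mkseqS aq.
  suff [M mM [SM TM]] : sep
     (\bigcup_i part S (rcons u (code_fst i)) (rcons v (code_snd i)))
     (\bigcup_i part T (rcons u (code_fst i)) (rcons w (code_snd i))).
    exists M => //; split; first by move=> x /partE; exact: SM.
    by rewrite -subset0 => x [Mx /partE Tx]; rewrite -TM.
  apply: sepU => i j.
  have [ij|ij] := eqVneq (code_fst i) (code_fst j).
    by rewrite /= -ij; apply: contrapT; exact: (H ((code_fst i, code_snd i), code_snd j)).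
  exists [set x | mkseq (c x) (size u).+1 = rcons u (code_fst i)].
    exact: code_prefix_measurable.
  split=> [x [+ _]|]; first by rewrite size_rcons.
  rewrite -subset0 => x [/= cxu [+ _]]; rewrite size_rcons cxu => /rcons_inj[].
  by move/eqP; rewrite (negbTE ij).
pose bad (t : seq nat * seq nat * seq nat) := ~ sep (part S t.1.1 t.1.2) (part T t.1.1 t.2).
have /choice[f Hf] : forall t, exists k : nat * nat * nat, bad t ->
    bad (rcons t.1.1 k.1.1, rcons t.1.2 k.1.2, rcons t.2 k.2).
  move=> [[u v] w]; have [/step[k Hk]|?] := pselect (bad (u, v, w)).
    by exists k.
  by exists (0, 0, 0)%N.
pose next t := (rcons t.1.1 (f t).1.1, rcons t.1.2 (f t).1.2, rcons t.2 (f t).2).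
pose st n := iter n next ([::], [::], [::]).
have badst n : bad (st n).
  elim: n => [|n IH]; last exact: Hf.
  apply: contra_not nsep => -[M mM [SM TM]]; exists M => //.
  have pA : A `<=` part S [::] [::].
    by move=> x /HS[a Ha]; split => //; exists a.
  have pB : B `<=` part T [::] [::].
    by move=> x /HT[a Ha]; split => //; exists a.
  split; first by move=> x /pA/SM.
  by rewrite -subset0 => x [Mx /pB Tx]; rewrite -TM.
pose a n := (f (st n)).1.1; pose b n := (f (st n)).1.2; pose e n := (f (st n)).2.
have stE n : st n = (mkseq a n, mkseq b n, mkseq e n).
  by elim: n => // n IH; rewrite !mkseqS /st iterS -/(st n) /next IH /= /a /b /e IH.
have ex n : exists x y, part S (mkseq a n) (mkseq b n) x /\
    part T (mkseq a n) (mkseq e n) y.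
  apply: contrapT => /forallNP H; have := badst n; rewrite stE; apply => /=.
  have [[x Sx]|/forallNP nS] := pselect (exists x, part S (mkseq a n) (mkseq b n) x).
    exists setT => //; split => //; rewrite -subset0 => y [_ Ty].
    by have /forallNP/(_ y) := H x; apply.
  by exists set0 => //; split; [move=> x /nS|rewrite set0I].
have pref R p q n x : part R (mkseq p n) (mkseq q n) x ->
    mkseq (c x) n = mkseq p n /\ R (mkseq p n) (mkseq q n).
  rewrite /part /= !size_mkseq => -[cx [g [gq gR]]]; split=> //.
  by have := gR n; rewrite cx gq.
have [x cx] : exists x, forall n, c x n = a n.
  apply: (code_closed cX) => n; have [x [_ [/pref[+ _] _]]] := ex n.
  by exists x.
have cxa n : mkseq (c x) n = mkseq a n by apply/eq_mkseqP.
suff : (A `&` B) x by rewrite AB0.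
split.
  apply/HS; exists b => n; rewrite cxa.
  by have [y [z [/pref[_ Sn] _]]] := ex n.
apply/HT; exists e => n; rewrite cxa.
by have [y [z [_ /pref[_ Tn]]]] := ex n.
Qed.

End measurable_souslin.

Local Open Scope ring_scope.

(** * Coding standard Borel spaces *)

Section standard_borel_code.
Context (R : realType) d (X : measurableType d).

Local Definition small (P : pseudoMetricType R) n (U : set P) :=
  forall y z, U y -> U z -> ball y (2^-1 ^+ n : R) z.

(** The odd indices carry the whole space, so that each code has infinitely many
nonzero entries and pins down its point to any precision. *)
Lemma countable_base (P : pseudoMetricType R) : @second_countable P ->
  exists O : nat -> set P, [/\ forall i, open (O i),
    forall n, O (n.*2.+1) = setT &
    forall x (e : R), 0 < e -> exists j, O j x /\ O j `<=` ball x e].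
Proof.
move=> [B /countable_injP[g gB] [Bo Bb]].
pose O i : set P := if odd i then setT else \bigcup_(U in [set U | B U /\ g U = i./2]) U.
exists O; split.
- move=> i; rewrite /O; case: ifP => _; first exact: openT.
  by apply: bigcup_open => U [/Bo].
- by move=> n; rewrite /O /= odd_double.
- move=> x e e0; have [U [BU Ux] Ue] := Bb x _ (nbhsx_ballx x e e0).
  exists (g U).*2; rewrite /O odd_double doubleK; split; first by exists U.
  move=> y [V [BV gVU] Vy].
  have VU : V = U by apply: gB => //; exact/mem_set.
  by apply: Ue; rewrite -VU.
Qed.

Lemma closure_ball_sub (P : pseudoMetricType R) (x : P) (r : R) : 0 < r ->
  closure (ball x (r / 2)) `<=` ball x r.
Proof.
move=> r0 y /(_ (ball y (r / 2))) [|z [xz yz]].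
  by apply: nbhsx_ballx; rewrite divr_gt0.
by rewrite (splitr r); apply: (@ball_triangle _ _ z) => //; exact: ball_sym.
Qed.

(** Basic open sets O_j are recorded through the least k such that x lies in
O_k, O_k is small and its closure lies in O_j. In this way a limit of codes is the code
of a point: smallness gives a Cauchy sequence, and the closures keep the limit
inside the open sets that the code announces. *)
Lemma standard_borel_code : standard_borel R X ->
  exists c : X -> nat -> nat, borel_code c.
Proof.
move=> [P [f [hP scP bf mE]]].
have [] := countable_base scP; move=> O [Oo OT Ob].
have [finj [fV fK Kf]] : injective f /\ exists2 g, cancel f g & cancel g f.
  by split; [exact: bij_inj|case: bf => g; exists g].
pose rel i j := closure (O j) `<=` O i /\ small i (O j).
pose good i x j := O j (f x) /\ rel i j.
pose spec i x k := if k is j.+1 then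
    [/\ O i (f x), good i x j & forall j', (j' < j)%N -> ~ good i x j'] else ~ O i (f x).
have goodex i x : O i (f x) -> exists j, good i x j.
  move=> Ox; have /nbhs_ballP[e /= e0 eO] : nbhs (f x) (O i).
    by apply: open_nbhs_nbhs.
  (* Half of e keeps closures inside the e-ball, half of 2^-i bounds the diameter. *)
  pose r := Num.min (e / 2) (2^-1 ^+ i / 2) : R.
  have r0 : 0 < r by rewrite lt_min !divr_gt0// exprn_gt0.
  have [j [Oj jb]] := Ob (f x) _ r0; exists j; split=> //; split.
    move=> y /(closure_subset jb) /= cy; apply: eO.
    apply: (closure_ball_sub e0); apply: closure_subset cy.
    by apply: le_ball; rewrite ge_min lexx.
  move=> y z /jb /= ry /jb /= rz.
  rewrite (splitr (2^-1 ^+ i)); apply: (@ball_triangle _ _ (f x)).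
    by apply: ball_sym; apply: le_ball ry; rewrite ge_min lexx orbT.
  by apply: le_ball rz; rewrite ge_min lexx orbT.
have specU i x k k' : spec i x k -> spec i x k' -> k = k'.
  case: k k' => [|j] [|j'] //=; [by move=> ? []|by case|].
  move=> [_ gj mj] [_ gj' mj'].
  by case: (ltngtP j j') => [/mj'|/mj|->].
have /choice[c0 Hc0] : forall xi : X * nat, exists k, spec xi.2 xi.1 k.
  move=> [x i] /=; have [Ox|nOx] := pselect (O i (f x)); last by exists 0%N.
  have ex : exists j, `[< good i x j >].
    by have [j gj] := goodex i x Ox; exists j; exact/asboolP.
  exists (ex_minn ex).+1; case: ex_minnP => j /asboolP gj jmin; split=> // j' jj' /asboolP/jmin.
  by rewrite leqNgt jj'.
pose c x i := c0 (x, i); have Hc x i : spec i x (c x i) := Hc0 (x, i).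
have c0E i x : (c x i != 0)%N <-> O i (f x).
  by have := Hc x i; case: (c x i) => [|j] /=; [split|case].
have Om i : measurable [set x | O i (f x)].
  apply/mE; suff -> : f @` [set x | O i (f x)] = O i by apply: sub_gen_smallest; exact: Oo.
  by apply/seteqP; split=> [_ [x Ox <-]//|y Oy]; exists (fV y); rewrite /= Kf.
exists c; split.
- move=> x y cxy; apply: finj; apply/eqP/negPn/negP => xy.
  move: hP; rewrite open_hausdorff => /(_ _ _ xy)[[A B] /= [/set_mem Ax /set_mem By]].
  move=> [Ao Bo /eqP AB0].
  have /nbhs_ballP[e /= e0 eA] : nbhs (f x) A by exact: open_nbhs_nbhs.
  have [j [Ojx jb]] := Ob (f x) _ e0.
  have /c0E : O j (f x) by [].
  rewrite cxy => /c0E/jb/eA Ay.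
  by have : (A `&` B) (f y) by []; rewrite AB0.
- move=> a /choice[s Hs].
  have sE n i : (i < n)%N -> c (s n) i = a i by move/eq_mkseqP: (Hs n); exact.
  pose F : set_system P := (f \o s) @ \oo.
  have evA i j : a i = j.+1 -> forall n, (i < n)%N -> O i (f (s n)) /\ good i (s n) j.
    by move=> aij n /sE ni; have := Hc (s n) i; rewrite ni aij => -[].
  pose l := lim F; have Fl : F --> l.
    apply: cauchy_cvg; apply: cauchy_exP => e e0.
    have [n ne] : exists n, 2^-1 ^+ n < e :> R.
      have h2 : `|2^-1 : R| < 1.
        by rewrite ger0_norm ?invr_ge0// invf_lt1// ltr1n.
      have /cvgrPdist_lt h := cvg_expr h2.
      have [n _ /(_ n (leqnn n))] := h e e0.
      by rewrite /= sub0r normrN ger0_norm ?exprn_ge0 ?invr_ge0//; exists n.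
    pose i := n.*2.+1.
    have : a i != 0%N.
      by rewrite -(sE i.+1)//; apply/c0E; rewrite /i OT.
    case aiE : (a i) => [//|j] _.
    have [_ [Ojs [_ smj]]] := evA _ _ aiE i.+1 (ltnSn i).
    exists (f (s i.+1)); exists i.+1 => // m /= im.
    have [_ [Ojm _]] := evA _ _ aiE m im.
    apply: le_ball (smj _ _ Ojs Ojm); apply: le_trans (ltW ne).
    by rewrite ler_wiXn2l// ?invf_le1// ?ler1n// /i -addnn; lia.
  have clos i j : a i = j.+1 -> O i l.
    move=> aij; have [_ [_ [clj _]]] := evA _ _ aij i.+1 (ltnSn i); apply: clj.
    move=> V /Fl [N _ HN]; exists (f (s (maxn N i.+1))); split.
      by have [_ []] := evA _ _ aij (maxn N i.+1) (leq_maxr _ _).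
    by apply: HN; rewrite /= leq_maxl.
  have ev i : O i l -> exists2 n, (i < n)%N & O i (f (s n)).
    move=> Oil; have /Fl[N _ HN] : nbhs l (O i) by exact: open_nbhs_nbhs.
    by exists (maxn N i.+1); [rewrite leq_maxr|apply: HN; rewrite /= leq_maxl].
  have Oa i : O i l <-> a i <> 0%N.
    split; first by move=> /ev[n /sE <- /c0E/eqP].
    by case aiE : (a i) => [|j] // _; exact: clos aiE.
  exists (fV l) => i; apply: specU (Hc _ i) _; rewrite /spec /good Kf.
  case aiE : (a i) => [|j]; first by move/Oa; rewrite aiE.
  have [_ [Ojs relij]] := evA _ _ aiE i.+1 (ltnSn i).
  have Oj : O j l.
    apply/Oa => aj0.
    have [_ [+ _]] := evA _ _ aiE (maxn i j).+1 (leq_maxl _ _).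
    by move=> /c0E; rewrite sE ?aj0// ltnS leq_maxr.
  split=> //; first exact: clos aiE.
  move=> j' j'j [Oj'l relj']; move: (Oj'l) => /Oa.
  case aj'E : (a j') => [//|k] _.
  pose n := (maxn i j').+1.
  have := Hc (s n) i; rewrite sE ?ltnS ?leq_maxl// aiE => -[_ _ /(_ _ j'j)]; apply.
  by split=> //; have [] := evA _ _ aj'E n (leq_maxr _ _).
- move=> n [|k].
    rewrite (_ : [set _ | _] = ~` [set x | O n (f x)]); first exact: measurableC.
    by apply/seteqP; split=> x /= h; [move/c0E; rewrite h|apply/eqP/negPn/negP => /c0E].
  rewrite (_ : [set _ | _] = [set x | O n (f x)] `&`
      (\bigcap_(j in `I_k) ~` (if `[< rel n j >] then [set x | O j (f x)] else set0)) `&`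
      (if `[< rel n k >] then [set x | O k (f x)] else set0)).
    apply: measurableI; last by case: ifP.
    apply: measurableI => //; apply: bigcap_measurableType => j _.
    by apply: measurableC; case: ifP.
  apply/seteqP; split=> x /=.
    move=> cx; have := Hc x n; rewrite cx => -[Ox [Okx rk] mk]; split; last by case: asboolP.
    by split=> // j /mk; case: asboolP => // ? gj ?; apply: gj.
  move=> [[Ox H] Hk]; apply: specU (Hc x n) _; move: Hk; case: asboolP => // rk Okx.
  by split=> // j /H; case: asboolP => [?|nr _ []//] nOj [].
- move=> A mA.
  pose G := [set B | exists n k, B = [set x | c x n = k]].
  pose D := [set B | <<s G >> (f @^-1` B)].
  have DS : sigma_algebra setT D.
    split; first by rewrite /D /= preimage_set0; exact: sigma_algebra0.
      by move=> B; rewrite /D /= setTD preimage_setC; exact: sigma_algebraC.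
    by move=> B BD; rewrite /D /= preimage_bigcup; exact: sigma_algebra_bigcup.
  have -> : A = f @^-1` (f @` A).
    by apply/seteqP; split=> x /=; [exists x|case=> y Ay /finj <-].
  have := (mE A).1 mA; move=> /(_ D); apply; split=> // U Uo; rewrite /D /=.
  have -> : f @^-1` U = \bigcup_i
      (if `[< O i `<=` U >] then \bigcup_k [set x | c x i = k.+1] else set0).
    apply/seteqP; split=> x /=.
      move=> Ux; have /nbhs_ballP[e /= e0 eU] : nbhs (f x) U by exact: open_nbhs_nbhs.
      have [j [Ojx jb]] := Ob (f x) _ e0; exists j => //.
      case: asboolP => [_|]; last by case; apply: subset_trans eU.
      by move: Ojx => /c0E; case cj: (c x j) => [//|k] _; exists k.
    move=> [i _]; case: asboolP => // OiU [k _ /= ck]; apply: OiU; apply/c0E.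
    by rewrite ck.
  apply: sigma_algebra_bigcup => i; case: ifP => _; last exact: sigma_algebra0.
  by apply: sigma_algebra_bigcup => k; apply: sub_gen_smallest; exists i, k.+1.
Qed.

End standard_borel_code.

(** * The Lusin-Novikov theorem *)

Section measurable_predicates.
Context d (W : measurableType d).
Implicit Types P Q : W -> Prop.

Definition mpred P := measurable [set w | P w].

Lemma mpred_ext P Q : (forall w, P w <-> Q w) -> mpred P -> mpred Q.
Proof.
by move=> PQ; congr measurable; apply/seteqP; split=> w /=; apply PQ.
Qed.

Lemma mpred_cst (p : Prop) : mpred (fun=> p).
Proof.
have [hp|hp] := pselect p.
  by apply: mpred_ext measurableT => w; split.
by apply: mpred_ext measurable0 => w; split.
Qed.

Lemma mpred_and P Q : mpred P -> mpred Q -> mpred (fun w => P w /\ Q w).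
Proof. exact: measurableI. Qed.

Lemma mpred_or P Q : mpred P -> mpred Q -> mpred (fun w => P w \/ Q w).
Proof. exact: measurableU. Qed.

Lemma mpred_not P : mpred P -> mpred (fun w => ~ P w).
Proof. exact: measurableC. Qed.

Lemma mpred_imp P Q : mpred P -> mpred Q -> mpred (fun w => P w -> Q w).
Proof.
move=> mP mQ; apply: mpred_ext (mpred_or (mpred_not mP) mQ) => w.
split=> [[//|//]|PQ].
by have [/PQ|] := pselect (P w); [right|left].
Qed.

Lemma mpred_forall (I : countType) (P : I -> W -> Prop) :
  (forall i, mpred (P i)) -> mpred (fun w => forall i, P i w).
Proof.
move=> /bigcap_countType_measurable; apply: mpred_ext => w.
by split=> [H i|H i _]; exact: H.
Qed.

Lemma mpred_exists (I : countType) (P : I -> W -> Prop) :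
  (forall i, mpred (P i)) -> mpred (fun w => exists i, P i w).
Proof.
move=> /bigcup_countType_measurable; apply: mpred_ext => w.
by split=> [[i _ Pi]|[i Pi]]; exists i.
Qed.

End measurable_predicates.

Lemma mpred_comp d d' (W : measurableType d) (X : measurableType d')
    (P : X -> Prop) (g : W -> X) :
  measurable_fun setT g -> mpred P -> mpred (fun w => P (g w)).
Proof. by move=> mg mP; have := mg measurableT _ mP; rewrite setTI. Qed.

Section lusin_novikov.
Context d (X : measurableType d) (c : X -> nat -> nat).
Hypothesis cX : borel_code c.

Lemma mpred_code d' (W : measurableType d') (g : W -> X) n (P : nat -> Prop) :
  measurable_fun setT g -> mpred (fun w => P (c (g w) n)).
Proof.
move=> mg; apply: (@mpred_comp _ _ _ _ (fun x => P (c x n))) => //.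
apply: mpred_ext (@mpred_exists _ _ nat (fun k x => c x n = k /\ P k) _).
  by move=> x; split=> [[k [<-]]//|?]; exists (c x n).
move=> k; apply: mpred_and; last exact: mpred_cst.
exact: code_measurable.
Qed.

Lemma measurable_code_fun d' (W : measurableType d') (g : W -> X) :
  (forall n k, mpred (fun w => c (g w) n = k)) -> measurable_fun setT g.
Proof.
move=> H _ A /(code_generates cX); rewrite setTI.
move=> /(_ [set B | measurable (g @^-1` B)]); apply; split; last first.
  by move=> B [n [k ->]]; exact: H.
split => /=.
- by rewrite preimage_set0; exact: measurable0.
- by move=> B mB; rewrite setTD preimage_setC; exact: measurableC.
- by move=> F mF; rewrite preimage_bigcup; exact: bigcupT_measurable.
Qed.

(** Separating the pieces of the graph on which a given coordinate of the
value has a given value prescribes that coordinate in a measurable way. *)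
Lemma souslin_function (G : X -> X -> Prop) :
  (forall x y y', G x y -> G x y' -> y = y') ->
  (forall n (P : nat -> Prop), souslin c [set x | exists2 y, G x y & P (c y n)]) ->
  exists2 g : X -> X, measurable_fun setT g & forall x y, G x y -> g x = y.
Proof.
move=> Gf GS.
have /choice[B HB] : forall nk : nat * nat, exists M : set X, measurable M /\
    (forall x y, G x y -> (M x <-> c y nk.1 = nk.2)).
  move=> [n k] /=.
  have [|M mM [AM MA]] := souslin_separation cX (GS n (fun j => j = k)) (GS n (fun j => j <> k)).
    by rewrite -subset0 => x [[y xy yk] [y' xy']]; rewrite -(Gf _ _ _ xy xy').
  exists M; split=> // x y xy; split=> [Mx|yk].
    apply: contrapT => yk; have : (M `&` [set x | exists2 y, G x y & c y n <> k]) x.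
      by split=> //; exists y.
    by rewrite MA.
  by apply: AM; exists y.
pose V x y := forall n k, B (n, k) x <-> c y n = k.
have /choice[g Hg] : forall x, exists z, (exists y, V x y) /\ V x z \/ ~ (exists y, V x y) /\ z = x.
  move=> x; have [[y Vy]|nV] := pselect (exists y, V x y).
    by exists y; left; split=> //; exists y.
  by exists x; right.
have VP x : (exists y, V x y) <-> (forall N, exists u : seq nat,
    (exists y, mkseq (c y) N = u) /\
    forall n k, (n < N)%N -> (B (n, k) x <-> nth 0%N u n = k)).
  split=> [[y Vy] N|H].
    by exists (mkseq (c y) N); split; [exists y|move=> n k nN; rewrite nth_mkseq].
  have /choice[a Ha] : forall n, exists k, forall j, B (n, j) x <-> k = j.
    move=> n; have [u [_ Hu]] := H n.+1; exists (nth 0%N u n) => j; exact: Hu.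
  have [N|y ya] := code_closed cX (a := a).
    have [u [[y yu] Hu]] := H N; exists y.
    apply/eq_mkseqP => k kN; apply/esym/Ha/Hu => //.
    by rewrite -yu nth_mkseq.
  by exists y => n k; rewrite ya.
have mD : mpred (fun x => exists y, V x y).
  have : mpred (fun x => forall N, exists u : seq nat,
    (exists y, mkseq (c y) N = u) /\
    forall n k, (n < N)%N -> (B (n, k) x <-> nth 0%N u n = k)).
    apply: mpred_forall => N; apply: mpred_exists => u.
    apply: mpred_and; first exact: mpred_cst.
    apply: mpred_forall => n; apply: mpred_forall => k.
    apply: mpred_imp; first exact: mpred_cst.
    have mB : mpred (B (n, k)) by have [] := HB (n, k).
    by apply: mpred_and; apply: mpred_imp => //; exact: mpred_cst.
  by apply: mpred_ext => x; split=> /VP.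
exists g.
  apply: measurable_code_fun => n k.
  apply: (@mpred_ext _ _ (fun x => ((exists y, V x y) /\ B (n, k) x) \/
     (~ (exists y, V x y) /\ c x n = k))).
    move=> x; have [[[y Vy] Vg]|[nV ->]] := Hg x; split.
    - by case=> [[_ /Vg]//|[]]; case; exists y.
    - by move=> /Vg Bx; left; split=> //; exists y.
    - by case=> [[]|[]].
    - by right.
  have mB : mpred (B (n, k)) by have [] := HB (n, k).
  apply: mpred_or; first exact: mpred_and.
  apply: mpred_and; [exact: mpred_not|exact: code_measurable].
move=> x y xy; apply: (code_inj cX) => n.
have Vy : V x y by move=> m k; have [_ /(_ _ _ xy)] := HB (m, k).
have [[_ Vg]|[]] := Hg x; last by case; exists y.
by apply/Vg/Vy.
Qed.

Definition pair_coding (p : X * X) n := pair_code (c p.1 n) (c p.2 n).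

Lemma souslin_rel (E : set (X * X)) : measurable E -> souslin pair_coding E.
Proof.
apply: souslin_gen => A.
have fstS B : souslin c B -> souslin pair_coding (fst @^-1` B).
  move=> [T HT]; exists (fun u => T (map code_fst u)) => -[x y] /=; rewrite HT.
  have mapE n : map code_fst (mkseq (pair_coding (x, y)) n) = mkseq (c x) n.
    by rewrite /mkseq -map_comp; apply: eq_map => k /=; rewrite code_fstK.
  by split=> -[a Ha]; exists a => n; have := Ha n; rewrite mapE.
have sndS B : souslin c B -> souslin pair_coding (snd @^-1` B).
  move=> [T HT]; exists (fun u => T (map code_snd u)) => -[x y] /=; rewrite HT.
  have mapE n : map code_snd (mkseq (pair_coding (x, y)) n) = mkseq (c y) n.
    by rewrite /mkseq -map_comp; apply: eq_map => k /=; rewrite code_sndK.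
  by split=> -[a Ha]; exists a => n; have := Ha n; rewrite mapE.
move=> [|] [B mB <-]; rewrite setTI preimage_setC; split.
all: by [apply: fstS; apply: (measurable_souslin cX) => //; exact: measurableC
        |apply: sndS; apply: (measurable_souslin cX) => //; exact: measurableC].
Qed.

(** The tree of a relation: branches over x are pairs of a code of some y with
E (x, y) and a witness. *)
Lemma measurable_rel_tree (E : set (X * X)) : measurable E ->
  exists T : seq nat -> seq nat -> Prop,
    (forall x y, E (x, y) -> exists2 a, forall n, T (mkseq (c x) n) (mkseq a n) &
       forall n, code_fst (a n) = c y n) /\
    (forall x a, (forall n, T (mkseq (c x) n) (mkseq a n)) ->
       exists2 y, E (x, y) & forall n, code_fst (a n) = c y n).
Proof.
move=> /souslin_rel[T HT].
exists (fun u w => T (mkseq (fun k => pair_code (nth 0%N u k) (code_fst (nth 0%N w k))) (size u))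
                     (mkseq (fun k => code_snd (nth 0%N w k)) (size w)) /\
         exists y, mkseq (c y) (size w) = mkseq (fun k => code_fst (nth 0%N w k)) (size w)).
split=> [x y /HT[a Ha]|x a H].
  exists (fun n => pair_code (c y n) (a n)) => n; last by rewrite code_fstK.
  rewrite !size_mkseq; split; last first.
    by exists y; apply/eq_mkseqP => k kn; rewrite nth_mkseq// code_fstK.
  have := Ha n; congr T; apply/eq_mkseqP => k kn; rewrite !nth_mkseq//.
    by rewrite code_fstK.
  by rewrite code_sndK.
have [n|y ya] := code_closed cX (a := fun n => code_fst (a n)).
  have [_ [y]] := H n; rewrite !size_mkseq => cy; exists y; rewrite cy.
  by apply/eq_mkseqP => k kn; rewrite nth_mkseq.
exists y => //; apply/HT; exists (fun n => code_snd (a n)) => n.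
have [+ _] := H n; rewrite !size_mkseq; congr T; apply/eq_mkseqP => k kn.
  by rewrite !nth_mkseq// /pair_coding /= ya.
by rewrite nth_mkseq.
Qed.

Section configurations.
Variable T : seq nat -> seq nat -> Prop.

Let active i j := (i <= j < i.*2)%N.

Definition branches (i : nat) (u : seq nat) (w : nat -> seq nat) (x : X)
    (a : nat -> nat -> nat) :=
  mkseq (c x) (size u) = u /\
  forall j, active i j -> mkseq (a j) (size (w j)) = w j /\
    forall n, T (mkseq (c x) n) (mkseq (a j) n).

(** A family of nodes of the tree is resolved when countably many measurable
functions suffice for the following: whenever branches over one and the same x run
through all the nodes, at least one of them ends at a value of these functions. *)
Definition resolved i u w := exists2 h : nat -> X -> X,
  forall m, measurable_fun setT (h m) &
  forall x a, branches i u w x a -> exists j m, active i j /\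
    forall n, code_fst (a j n) = c (h m x) n.

Definition split_node (w : nat -> seq nat) i p q j :=
  if j == i.*2 then w i ++ p else if j == i.*2.+1 then w i ++ q else w j.

Hypothesis Tend : forall x a, (forall n, T (mkseq (c x) n) (mkseq a n)) ->
  exists y, forall n, code_fst (a n) = c y n.

Lemma resolved_graph_souslin i u w (h : nat -> X -> X) n (P : nat -> Prop) :
  (forall m, measurable_fun setT (h m)) ->
  souslin c [set x | exists a, [/\ branches i u w x a,
     forall j m, active i j -> exists k, code_fst (a j k) <> c (h m x) k &
     P (code_fst (a i n))]].
Proof.
move=> mh.
(* The witness codes the branches and, for all j and m, a place at which branch j
   differs from the code of h m x. *)
pose br (g : nat -> nat) j k := g (pair_code 0 (pair_code j k)).
pose wi (g : nat -> nat) j m := g (pair_code 1 (pair_code j m)).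
pose Q (t : nat * nat * nat) (g : nat -> nat) : set X := [set x |
  mkseq (c x) (size u) = u /\
  (active i t.1.1 -> mkseq (br g t.1.1) (size (w t.1.1)) = w t.1.1 /\
     T (mkseq (c x) t.1.2) (mkseq (br g t.1.1) t.1.2)) /\
  (active i t.1.1 -> wi g t.1.1 t.1.2 = t.2 -> code_fst (br g t.1.1 t.2) <> c (h t.1.2 x) t.2) /\
  P (code_fst (br g i n))].
have /choice[K HK] : forall t : nat * nat * nat, exists N, forall g g', mkseq g N = mkseq g' N ->
    Q t g `<=` Q t g'.
  move=> [[j m] k].
  have [N1 H1] := bound_below (fun l => pair_code 0 (pair_code j l))
    (maxn (size (w j)) (maxn m k.+1)).
  pose N2 := pair_code 1 (pair_code j m).
  pose N3 := pair_code 0 (pair_code i n).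
  exists (maxn N1 (maxn N2 N3).+1) => g g' /eq_mkseqP gg'.
  have brE l : (l < maxn (size (w j)) (maxn m k.+1))%N -> br g j l = br g' j l.
    by move=> /H1 lN; apply: gg'; rewrite leq_max lN.
  have wiE : wi g j m = wi g' j m by apply: gg'; rewrite !leq_max !ltnS !leq_max leqnn orbT.
  have iE : br g i n = br g' i n by apply: gg'; rewrite !leq_max !ltnS !leq_max leqnn !orbT.
  have e1 : mkseq (br g j) (size (w j)) = mkseq (br g' j) (size (w j)).
    by apply/eq_mkseqP => l lN; apply: brE; rewrite leq_max lN.
  have e2 : mkseq (br g j) m = mkseq (br g' j) m.
    by apply/eq_mkseqP => l lN; apply: brE; rewrite !leq_max lN orbT.
  have e3 : br g j k = br g' j k by apply: brE; rewrite !leq_max ltnSn !orbT.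
  by move=> x; rewrite /Q /= e1 e2 e3 wiE iE.
have mQ t g : measurable (Q t g).
  apply: mpred_and; first exact: (code_prefix_measurable cX).
  apply: mpred_and.
    apply: mpred_imp; first exact: mpred_cst.
    apply: mpred_and; first exact: mpred_cst.
    exact: (code_pred_measurable cX (fun s => T s _)).
  apply: mpred_and; last exact: mpred_cst.
  apply: mpred_imp; first exact: mpred_cst.
  apply: mpred_imp; first exact: mpred_cst.
  exact: (mpred_code _ (fun v => code_fst (br g t.1.1 t.2) <> v) (mh _)).
have := souslin_local cX HK mQ; congr souslin; apply/seteqP; split=> x /=.
  move=> [g Hg]; exists (br g); split.
  - split; first by have [] := Hg (0, 0, 0)%N.
    move=> j ij; split=> [|m].
      by have [_ [/(_ ij)[]]] := Hg (j, 0, 0)%N.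
    by have [_ [/(_ ij)[]]] := Hg (j, m, 0)%N.
  - move=> j m ij; exists (wi g j m).
    by have [_ [_ [/(_ ij erefl)]]] := Hg (j, m, wi g j m).
  - by have [_ [_ []]] := Hg (0, 0, 0)%N.
move=> [a [[cu ba] ne Pa]].
have /choice[b Hb] : forall jm : nat * nat, exists k, active i jm.1 ->
    code_fst (a jm.1 k) <> c (h jm.2 x) k.
  move=> [j m]; have [ij|] := boolP (active i j); last by exists 0%N.
  by have [k Hk] := ne j m ij; exists k.
pose g v := if code_fst v == 0%N then a (code_fst (code_snd v)) (code_snd (code_snd v))
            else b (code_fst (code_snd v), code_snd (code_snd v)).
have brE j k : br g j k = a j k by rewrite /br /g !(code_fstK, code_sndK).
have wiE j m : wi g j m = b (j, m) by rewrite /wi /g !(code_fstK, code_sndK).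
have brE' j : br g j = a j by apply/funext => k.
exists g => -[[j m] k]; rewrite /Q /= !brE' wiE; split=> //; split.
  by move=> ij; have [? Ta] := ba j ij.
by split=> // ij <-; exact: Hb (j, m) ij.
Qed.

(** If all ways to split a node into two nodes with distinct end points are
resolved, then off the functions involved the end point at this node is unique, hence
a measurable function of x. *)
Lemma unresolved_split i u w : (0 < i)%N -> ~ resolved i u w ->
  exists l p q, [/\ size p = size q, map code_fst p <> map code_fst q &
    ~ resolved i.+1 (rcons u l) (split_node w i p q)].
Proof.
move=> i0 nres; apply: contrapT => nex; apply: nres.
have ii : active i i by rewrite /active leqnn -addnn -{1}(addn0 i) ltn_add2l.
have /choice[h Hh] : forall t : nat * seq nat * seq nat, exists h : nat -> X -> X,
    (forall m, measurable_fun setT (h m)) /\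
    (size t.1.2 = size t.2 -> map code_fst t.1.2 <> map code_fst t.2 ->
     forall x a, branches i.+1 (rcons u t.1.1) (split_node w i t.1.2 t.2) x a ->
     exists j m, active i.+1 j /\ forall n, code_fst (a j n) = c (h m x) n).
  move=> [[l p] q] /=.
  have [[spq npq]|nspq] := pselect (size p = size q /\ map code_fst p <> map code_fst q).
    have [h mh Hh] : resolved i.+1 (rcons u l) (split_node w i p q).
      by apply: contrapT => nr; apply: nex; exists l, p, q.
    by exists h; split.
  exists (fun=> id); split=> [_|spq npq]; first exact: measurable_id.
  by case: nspq.
pose H m : X -> X := if unpickle m is Some (t, m') then h t m' else id.
have mH m : measurable_fun setT (H m).
  rewrite /H; case: (unpickle m) => [[t m']|]; last exact: measurable_id.
  by have [] := Hh t.
pose G x y := exists a, [/\ branches i u w x a,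
   forall j m, active i j -> exists k, code_fst (a j k) <> c (H m x) k &
   forall n, code_fst (a i n) = c y n].
have GS n (P : nat -> Prop) : souslin c [set x | exists2 y, G x y & P (c y n)].
  have := resolved_graph_souslin i u w n P mH.
  congr souslin; apply/seteqP; split=> x /=.
    move=> [a [ba ne Pa]]; have [_ Ta] := ba.2 i ii.
    have [y ya] := Tend Ta; exists y; last by rewrite -ya.
    by exists a; split.
  by move=> [y [a [ba ne ay]] Py]; exists a; split=> //; rewrite ay.
have Gf x y y' : G x y -> G x y' -> y = y'.
  move=> [a [[cu ba] ne ay]] [a' [[_ ba'] ne' ay']].
  apply: (code_inj cX) => n; apply: contrapT => yy'.
  (* Two end points that differ at n would give a legitimate split of node i by
     the initial segments p and q of the two branches. *)
  pose N := (size (w i) + n.+1)%N.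
  pose p := drop (size (w i)) (mkseq (a i) N).
  pose q := drop (size (w i)) (mkseq (a' i) N).
  have takeE b : mkseq b (size (w i)) = w i -> w i ++ drop (size (w i)) (mkseq b N) = mkseq b N.
    move=> bw; rewrite -{1}bw -[RHS](cat_take_drop (size (w i))); congr cat.
    apply: (@eq_from_nth _ 0%N).
      by rewrite size_mkseq size_take size_mkseq /N -{2}(addn0 (size _)) ltn_add2l.
    move=> k; rewrite size_mkseq => kw; rewrite nth_take// !nth_mkseq//.
    exact: leq_trans kw (leq_addr _ _).
  have wp : w i ++ p = mkseq (a i) N by apply: takeE; have [] := ba i ii.
  have wq : w i ++ q = mkseq (a' i) N by apply: takeE; have [] := ba' i ii.
  have spq : size p = size q by rewrite !size_drop !size_mkseq.
  have npq : map code_fst p <> map code_fst q.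
    move=> pq; apply: yy'; rewrite -ay -ay'.
    have : map code_fst (w i ++ p) = map code_fst (w i ++ q) by rewrite !map_cat pq.
    have nN : (n < N)%N by rewrite /N addnS ltnS leq_addl.
    rewrite wp wq => /(congr1 (nth (code_fst 0%N) ^~ n)) /=.
    by rewrite !(nth_map 0%N (code_fst 0%N) code_fst) ?size_mkseq// !nth_mkseq.
  pose b j := if j == i.*2 then a i else if j == i.*2.+1 then a' i else a j.
  pose t := (c x (size u), p, q).
  have [|j [m [+ bh]]] := (Hh t).2 spq npq x b.
    split; first by rewrite size_rcons mkseqS cu.
    move=> j; rewrite /active doubleS /split_node /b => /andP[ij ji].
    have [_|ji2] := eqVneq j i.*2.
      by rewrite wp size_mkseq; split => //; have [] := ba i ii.
    have [_|ji3] := eqVneq j i.*2.+1.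
      by rewrite wq size_mkseq; split => //; have [] := ba' i ii.
    by apply: ba; rewrite /active (ltnW ij) /=; lia.
  pose M := pickle (t, m).
  have HM : H M x = h t m x by rewrite /H /M pickleK.
  rewrite /active doubleS => /andP[ij ji].
  move: bh; rewrite /b; case: eqVneq => [_|ji2].
    by have [k Hk] := ne i M ii; move=> /(_ k); rewrite -HM.
  case: eqVneq => [_|ji3].
    by have [k Hk] := ne' i M ii; move=> /(_ k); rewrite -HM.
  have ja : active i j by rewrite /active (ltnW ij) /=; lia.
  by have [k Hk] := ne j M ja; move=> /(_ k); rewrite -HM.
have [g mg Hg] := souslin_function Gf GS.
exists (fun m => if m is m'.+1 then H m' else g) => [[|m]//|x a ba].
have [[j [m [ij ajm]]]|nex2] := pselect (exists j m, active i j /\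
  forall n, code_fst (a j n) = c (H m x) n).
  by exists j, m.+1.
have [_ Ta] := ba.2 i ii; have [y ya] := Tend Ta.
exists i, 0%N; split=> // n; rewrite ya; congr (c _ n); apply/esym/Hg.
exists a; split=> // j m ij; apply: contrapT => /forallNP H'; apply: nex2.
by exists j, m; split=> // k; apply: contrapT; exact: H'.
Qed.

(** Splitting unresolved nodes for ever, node i into nodes 2i and 2i+1, produces
a binary tree of nodes over a single limit point x, whose branches end at
uncountably many points. *)
Lemma unresolved_cantor : ~ resolved 1 [::] (fun=> [::]) ->
  exists x, exists y : (nat -> bool) -> X, injective y /\
    forall b, exists2 a, forall n, T (mkseq (c x) n) (mkseq a n) &
      forall n, code_fst (a n) = c (y b) n.
Proof.
move=> nres.
have /choice[f Hf] : forall t : nat * (seq nat * (nat -> seq nat)),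
    exists k : nat * seq nat * seq nat, (0 < t.1)%N -> ~ resolved t.1 t.2.1 t.2.2 ->
    [/\ size k.1.2 = size k.2, map code_fst k.1.2 <> map code_fst k.2 &
    ~ resolved t.1.+1 (rcons t.2.1 k.1.1) (split_node t.2.2 t.1 k.1.2 k.2)].
  move=> [i [u w]] /=; have [[i0 nr]|no] := pselect ((0 < i)%N /\ ~ resolved i u w).
    by have [l [p [q H]]] := unresolved_split i0 nr; exists (l, p, q).
  by exists (0%N, [::], [::]) => i0 nr; case: no.
pose next t : nat * (seq nat * (nat -> seq nat)) :=
  (t.1.+1, (rcons t.2.1 (f t).1.1, split_node t.2.2 t.1 (f t).1.2 (f t).2)).
pose st n := iter n next (1%N, ([::], fun=> [::])).
have st1 n : (st n).1 = n.+1 by elim: n => // n IH; rewrite /st iterS -/(st n) /= IH.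
have bad n : ~ resolved n.+1 (st n).2.1 (st n).2.2.
  elim: n => // n IH; have := Hf (st n); rewrite st1 => /(_ isT IH)[_ _].
  by rewrite /st iterS -/(st n) /next /= st1.
pose p n := (f (st n)).1.2; pose q n := (f (st n)).2.
have spq n : size (p n) = size (q n).
  by have := Hf (st n); rewrite st1 => /(_ isT (bad n))[].
have npq n : map code_fst (p n) <> map code_fst (q n).
  by have := Hf (st n); rewrite st1 => /(_ isT (bad n))[].
have p0 n : (0 < size (p n))%N.
  rewrite lt0n; apply/eqP => pn0; apply: (npq n).
  by rewrite (size0nil pn0) (size0nil (etrans (esym (spq n)) pn0)).
pose a n := (f (st n)).1.1.
have stu n : (st n).2.1 = mkseq a n.
  by elim: n => // n IH; rewrite mkseqS /st iterS -/(st n) /= IH.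
have stw n j : (st n.+1).2.2 j = split_node (st n).2.2 n.+1 (p n) (q n) j.
  by rewrite /st iterS -/(st n) /= st1.
have stable n k j : (j < n.+1.*2)%N -> (st (n + k)%N).2.2 j = (st n).2.2 j.
  move=> jn; elim: k => [|k IH]; first by rewrite addn0.
  rewrite addnS stw /split_node -IH; move: jn; rewrite -!muln2.
  by case: eqVneq => [->|_]; [lia|case: eqVneq => [->|_]; [lia|]].
(* Node j is assigned before stage j and is not touched afterwards. *)
pose W j := (st j).2.2 j.
have WE n j : (n <= j < n.+1.*2)%N -> (st n).2.2 j = W j.
  by move=> /andP[nj jn]; rewrite /W -(stable n (j - n)%N j jn) subnKC.
have W0 n : W n.+1.*2 = W n.+1 ++ p n.
  rewrite -(WE n.+1) ?stw /split_node ?eqxx ?WE//; rewrite -!muln2; lia.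
have W1 n : W n.+1.*2.+1 = W n.+1 ++ q n.
  rewrite -(WE n.+1) ?stw /split_node ?eqxx ?WE//; last by rewrite -!muln2; lia.
    by case: eqVneq => [|_]; [rewrite -!muln2; lia|].
  rewrite -!muln2; lia.
pose fix node (b : nat -> bool) n := if n is m.+1 then (b m + (node b m).*2)%N else 1%N.
have node_gt b n : (n < node b n)%N.
  elim: n => // n IH /=; rewrite -addnn; lia.
have nodeP b n : exists r, W (node b n.+1) = W (node b n) ++ r /\ (0 < size r)%N.
  have := node_gt b n; rewrite /=; case: (node b n) => // m _.
  case: (b n); last by exists (p m); rewrite add0n W0.
  by exists (q m); rewrite add1n W1 -spq.
have node_size b n : (n <= size (W (node b n)))%N.
  elim: n => // n IH; have [r [-> r0]] := nodeP b n; rewrite size_cat; lia.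
pose al b k := nth 0%N (W (node b k.+1)) k.
have nodeW b n : forall k, (k < size (W (node b n)))%N ->
    nth 0%N (W (node b n)) k = al b k.
  move=> k kn.
  have mono m1 m2 : (m1 <= m2)%N -> forall k, (k < size (W (node b m1)))%N ->
      (k < size (W (node b m2)))%N /\ nth 0%N (W (node b m1)) k = nth 0%N (W (node b m2)) k.
    move=> /subnKC <-; elim: (m2 - m1)%N => [|m IH] l lm; first by rewrite addn0.
    have [l1 ->] := IH l lm; rewrite addnS; have [r [-> _]] := nodeP b (m1 + m)%N.
    by rewrite size_cat nth_cat l1; split=> //; exact: leq_trans l1 (leq_addr _ _).
  rewrite /al; case: (leqP n k.+1) => nk; first by have [] := mono _ _ nk k kn.
  by have [_ ->] := mono _ _ (ltnW nk) k (node_size b k.+1).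
have ex n : exists x, exists g, branches n.+1 (mkseq a n) (st n).2.2 x g.
  apply: contrapT => /forallNP H; apply: (bad n); exists (fun=> id) => [_|x g bg].
    exact: measurable_id.
  by have /forallNP/(_ g) := H x; rewrite -stu in bg *; case.
have [x xa] : exists x, forall n, c x n = a n.
  apply: (code_closed cX) => n; have [x [g [+ _]]] := ex n.
  by rewrite size_mkseq; exists x.
have br b n : T (mkseq (c x) n) (mkseq (al b) n).
  have := node_gt b n; case nE : (node b n) => [//|m] nm.
  have am : active m.+1 m.+1 by rewrite /active -muln2; lia.
  have [x' [g [cx' /(_ m.+1 am)]]] := ex m.
  rewrite WE; last by rewrite -!muln2; lia.
  rewrite -nE => -[gW /(_ n)]; rewrite size_mkseq in cx'.
  have -> : mkseq (c x') n = mkseq (c x) n.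
    have -> : mkseq (c x') n = mkseq a n by exact: eq_mkseq_le cx'.
    by apply/eq_mkseqP => k _; rewrite xa.
  suff -> : mkseq (g (node b n)) n = mkseq (al b) n by [].
  apply/eq_mkseqP => k kn.
  have kW : (k < size (W (node b n)))%N by exact: leq_trans kn (node_size b n).
  by rewrite -(nodeW b n k kW) -gW nth_mkseq.
have /choice[y Hy] : forall b, exists y, forall n, code_fst (al b n) = c y n.
  by move=> b; exact: Tend (br b).
exists x, y; split; last by move=> b; exists (al b).
move=> b b' yy'.
have eqal n : code_fst (al b n) = code_fst (al b' n) by rewrite !Hy yy'.
suff nodeE n : (node b n = node b' n) * (forall k, (k < n)%N -> b k = b' k).
  by apply/funext => n; apply: (nodeE n.+1).2.
elim: n => [|n [nn IH]]; first by split.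
have key : W (node b n.+1) = W (node b n) ++ (if b n then q else p) (node b n).-1.
  have := node_gt b n; rewrite /=; case: (node b n) => // m _ /=.
  by case: (b n); rewrite ?add1n ?add0n ?W0 ?W1.
have key' : W (node b' n.+1) = W (node b n) ++ (if b' n then q else p) (node b n).-1.
  rewrite nn; have := node_gt b' n; rewrite /=; case: (node b' n) => // m _ /=.
  by case: (b' n); rewrite ?add1n ?add0n ?W0 ?W1.
have sW : size (W (node b n.+1)) = size (W (node b' n.+1)).
  by rewrite key key' !size_cat; case: (b n); case: (b' n); rewrite ?spq.
have mapW : map code_fst (W (node b n.+1)) = map code_fst (W (node b' n.+1)).
  apply: (@eq_from_nth _ (code_fst 0%N)); rewrite !size_map// => k kn.
  by rewrite !(nth_map 0%N (code_fst 0%N) code_fst) -?sW// !nodeW -?sW.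
have bn : b n = b' n.
  move: mapW; rewrite key key' !map_cat => /eqP.
  rewrite eqseq_cat// eqxx /= => /eqP.
  case: (b n); case: (b' n) => // H; first by case: (npq (node b n).-1).
  by case: (npq (node b n).-1).
split; first by rewrite /= nn bn.
by move=> k; rewrite ltnS leq_eqVlt => /predU1P[->//|/IH].
Qed.

End configurations.

(** The relation is resolved by countably many functions, since its sections hold no
Cantor set; where a function leaves the relation, the identity replaces it. *)
Theorem lusin_novikov (E : set (X * X)) :
  measurable E -> (forall x, E (x, x)) -> (forall x, countable [set y | E (x, y)]) ->
  exists2 f : nat -> X -> X, forall n, measurable_fun setT (f n) &
    forall x y, E (x, y) <-> exists n, f n x = y.
Proof.
move=> mE Exx Ec; have [T [ET TE]] := measurable_rel_tree mE.
have Tend x a : (forall n, T (mkseq (c x) n) (mkseq a n)) ->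
    exists y, forall n, code_fst (a n) = c y n.
  by move=> /TE[y _ ay]; exists y.
have [[h mh Hh]|/(unresolved_cantor Tend)[x [y [yinj Hy]]]] :=
  pselect (resolved T 1 [::] (fun=> [::])); last first.
  have /countable_injP[k kinj] := Ec x.
  have Exy b : E (x, y b).
    have [a /TE[z xz az] ay] := Hy b.
    by have -> // : y b = z; apply: (code_inj cX) => n; rewrite -az ay.
  pose k' b := k (y b).
  have k'inj : injective k'.
    by move=> b b' /kinj; rewrite !inE => /(_ (Exy _) (Exy _))/yinj.
  (* Cantor's diagonal argument. *)
  pose diag n := `[< exists2 b, k' b = n & ~~ b n >].
  have [dn|ndn] := boolP (diag (k' diag)).
    move: (dn) => /asboolP[b /k'inj bd]; rewrite bd.
    by rewrite dn.
  by move: (ndn) => /asboolP; case; exists diag.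
exists (fun n x => if `[< E (x, h n x) >] then h n x else x).
  move=> n; apply: measurable_code_fun => m k.
  have mEh : mpred (fun x => E (x, h n x)).
    apply: (@mpred_comp _ _ _ _ (fun p => E p) (fun x => (x, h n x))) => //.
    by apply: measurable_fun_pair => //; exact: measurable_id.
  apply: (@mpred_ext _ _ (fun x => (E (x, h n x) /\ c (h n x) m = k) \/
     (~ E (x, h n x) /\ c x m = k))).
    by move=> x; case: asboolP => Exh; split; [case=> -[]|left|case=> -[]|right].
  apply: mpred_or; apply: mpred_and => //; first exact: (mpred_code _ (fun v => v = k)).
    exact: mpred_not.
  exact: code_measurable.
move=> x y; split=> [Exy|[n <-]]; last by case: asboolP.
have [a Ta ay] := ET x y Exy.
have [|j [m [j1 am]]] := Hh x (fun=> a); first by split.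
exists m; have -> : h m x = y by apply: (code_inj cX) => n; rewrite -am ay.
by case: asboolP.
Qed.

End lusin_novikov.

(** * Trees and half-spaces *)

Section trees.
Context (X : choiceType).
Implicit Types (T G : graph X) (x y z a b c : X) (Y : set X).

Lemma adjP T x y : reflect (edges T (x, y)) (adj T x y).
Proof. by apply: (iffP idP); rewrite /adj inE. Qed.

Lemma adj_sym T : symmetric (adj T).
Proof. by move=> x y; apply/idP/idP => /adjP xy; apply/adjP; exact: edges_sym. Qed.

Lemma edges_neq T x y : edges T (x, y) -> x <> y.
Proof. by move=> xy e; move: xy; rewrite e; exact: edges_irr. Qed.

(** For an edge (a, b) of a tree, the half-space of the points that are
separated from b by a. *)
Definition side T a b : set X :=
  [set z | exists s, [/\ path (adj T) a s, b \notin a :: s & last a s = z]].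

Lemma side_refl T a b : a <> b -> side T a b a.
Proof. by move=> ab; exists [::]; rewrite /= inE eq_sym; split=> //; apply/eqP. Qed.

Lemma side_neq T a b z : side T a b z -> z <> b.
Proof. by move=> [s [_ bs <-]] sb; move: bs; rewrite -sb mem_last. Qed.

Lemma side_neq0 T a b z : side T a b z -> a <> b.
Proof. by move=> [s [_ + _]]; rewrite inE => /norP[/eqP/nesym]. Qed.

Lemma side_step T a b z z' : side T a b z -> edges T (z, z') -> z' <> b ->
  side T a b z'.
Proof.
move=> [s [ps bs <-]] zz' z'b; exists (rcons s z'); split.
- by rewrite rcons_path ps; apply/adjP.
- rewrite -rcons_cons mem_rcons inE negb_or bs andbT eq_sym; exact/eqP.
- by rewrite last_rcons.
Qed.

Lemma side_ind T a b (P : X -> Prop) : P a ->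
  (forall z z', side T a b z -> P z -> edges T (z, z') -> z' <> b -> P z') ->
  forall z, side T a b z -> P z.
Proof.
move=> Pa IH z [s]; elim/last_ind: s z => [|s y IHs] z [].
  by move=> _ _ <-.
rewrite rcons_path -rcons_cons mem_rcons inE negb_or last_rcons.
move=> /andP[ps /adjP sy] /andP[/eqP yb bs] <-.
by apply: (IH _ _ _ _ sy); [exists s|exact: IHs|exact: (nesym yb)].
Qed.

Lemma linked_refl T x : linked T x x.
Proof. by exists [::]. Qed.

Lemma linked_sym T x y : linked T x y -> linked T y x.
Proof.
move=> [s ps <-]; exists (rev (belast x s)); last first.
  by case: s ps => // z s _; rewrite /= rev_cons last_rcons.
have := rev_path (adj T) x s.
rewrite (eq_path (e' := adj T)); last by move=> u v; rewrite adj_sym.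
by move=> ->.
Qed.

Lemma linked_trans T x y z : linked T x y -> linked T y z -> linked T x z.
Proof.
move=> [s ps <-] [t pt <-]; exists (s ++ t); last by rewrite last_cat.
by rewrite cat_path ps.
Qed.

Lemma linked_edge T x y : edges T (x, y) -> linked T x y.
Proof. by move=> /adjP xy; exists [:: y] => //=; rewrite xy. Qed.

Lemma linked_ind T x (P : X -> Prop) : P x ->
  (forall z z', linked T x z -> P z -> edges T (z, z') -> P z') ->
  forall z, linked T x z -> P z.
Proof.
move=> Px IH z [s]; elim/last_ind: s z => [|s y IHs] z.
  by move=> _ <-.
rewrite rcons_path last_rcons => /andP[ps /adjP sy] <-.
by apply: (IH _ _ _ _ sy); [exists s|exact: IHs].
Qed.

Lemma side_linked T a b z : side T a b z -> linked T a z.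
Proof. by move=> [s [ps _ sz]]; exists s. Qed.

Lemma side_trans T a b z w : side T a b z -> side T z b w -> side T a b w.
Proof.
move=> az; move: w; apply: side_ind => // w w' _ aw ww' w'b.
exact: (side_step aw ww' w'b).
Qed.

Lemma side_sym T a b z : side T a b z -> side T z b a.
Proof.
move=> abz; have ab := side_neq0 abz; move: z abz.
apply: side_ind => [|z z' _ za zz' z'b]; first exact: side_refl.
have zb := side_neq0 za.
apply: (side_trans _ za); apply: (side_step _ (edges_sym zz') zb).
exact: side_refl.
Qed.

Lemma side_cover T a b z : edges T (a, b) -> linked T a z ->
  side T a b z \/ side T b a z.
Proof.
move=> ab; have nab := edges_neq ab.
move: z; apply: linked_ind => [|z z' _ IH zz']; first by left; exact: side_refl.
have [->|/eqP z'a] := eqVneq z' a; first by left; exact: side_refl.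
have [->|/eqP z'b] := eqVneq z' b; first by right; apply: side_refl => /esym.
by case: IH => IH; [left|right]; exact: (side_step IH zz' _).
Qed.

(** The first step on a simple path from b. *)
Lemma side_first T b a z : side T b a z -> z <> b ->
  exists c, [/\ edges T (b, c), c <> a & side T c b z].
Proof.
move=> [s [ps bs sz]] zb; move: sz.
case/shortenP: ps => s' ps' us' ss' sz.
case: s' ps' us' ss' sz => [_ _ _ /= /esym//|c s' /= /andP[bc pc] /andP[bcs' _] ss' sz].
exists c; split; [exact/adjP| |by exists s'].
by move=> ca; move: bs; rewrite inE -ca ss' ?mem_head ?orbT.
Qed.

Definition ramified T x := exists y1 y2 y3,
  [/\ edges T (x, y1), edges T (x, y2) & edges T (x, y3)] /\
  [/\ y1 <> y2, y1 <> y3 & y2 <> y3].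

Section acyclic.
Variable T : graph X.
Hypothesis Tac : acyclic T.

(** Two neighbours of b on the same side of b close up a cycle through b. *)
Lemma side_inj b a a' : edges T (b, a) -> edges T (b, a') -> side T a b a' -> a = a'.
Proof.
move=> ba ba' [s [ps bs sa']]; apply: contrapT => naa'; move: sa' naa'.
case/shortenP: ps => s' ps' us' ss' sa' naa'.
case: (Tac (s := b :: a :: s')).
  by case: s' sa' {ps' us' ss'} => //= /esym; rewrite sa' in naa'.
apply/andP; split.
  rewrite /= rcons_path ps' sa' /=; apply/andP; split; apply/adjP => //.
  exact: edges_sym.
rewrite cons_uniq us' andbT; apply: contra bs; rewrite !inE => /orP[->//|/ss' ->].
by rewrite orbT.
Qed.

Lemma side_disj a b z : edges T (a, b) -> side T a b z -> ~ side T b a z.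
Proof.
move=> ab az bz.
have [c [bc ca cz]] := side_first bz (side_neq az).
apply: ca; apply/esym; apply: (side_inj (edges_sym ab) bc).
exact: (side_trans az (side_sym cz)).
Qed.

Lemma side_exit a b z : edges T (a, b) -> side T a b z -> edges T (z, b) -> z = a.
Proof.
by move=> ab az zb; apply/esym; apply: (side_inj (edges_sym ab) (edges_sym zb) az).
Qed.

Lemma side_stepE a b z z' : edges T (a, b) -> side T a b z -> edges T (z, z') ->
  side T a b z' \/ (z = a /\ z' = b).
Proof.
move=> ab az zz'; have [z'b|/eqP z'b] := eqVneq z' b.
  by right; split=> //; apply: (side_exit ab az _); rewrite -z'b.
by left; exact: (side_step az zz' z'b).
Qed.

(** A path that starts at b and stays behind c cannot return through a. *)
Lemma side_nest b a c : edges T (b, a) -> edges T (b, c) -> a <> c ->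
  side T c b `<=` side T b a.
Proof.
move=> ba bc ac z; move: z; apply: side_ind => [|z z' cz bz zz' z'b].
  by apply: (side_step _ bc); [apply: side_refl; exact: (edges_neq ba)|exact: (nesym ac)].
apply: (side_step bz zz') => z'a; apply: ac; apply/esym.
by apply: (side_inj bc ba _); rewrite -z'a; exact: (side_step cz zz' z'b).
Qed.

(** A walk that leaves a half-space uses its boundary edge. *)
Lemma side_cross a b x s : edges T (a, b) -> path (adj T) x s -> side T a b x ->
  ~ side T a b (last x s) -> a \in x :: s /\ b \in x :: s.
Proof.
move=> ab; elim: s x => [//|y s IH] x /= /andP[/adjP xy ps] ax nas.
have [/IH|[-> ->]] := side_stepE ab ax xy; last by rewrite !inE !eqxx !orbT.
by move=> /(_ ps nas)[ays bys]; rewrite !(in_cons x) ays bys !orbT.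
Qed.

(** The walk can be taken inside any half-space that contains its end points. *)
Lemma side_cross_side a b c e x y : edges T (a, b) ->
  side T c e x -> side T c e y -> side T a b x -> ~ side T a b y ->
  side T c e a /\ side T c e b.
Proof.
move=> ab cx cy ax nay.
have := side_trans (side_sym cx) cy; move: ax.
suff H : forall z, side T x e z -> side T a b x -> ~ side T a b z ->
    side T c e a /\ side T c e b by move=> ax xy; exact: (H _ xy ax nay).
move=> z [s [ps es sz]] ax naz.
have [|ain bin] := side_cross ab ps ax; first by rewrite sz.
have H w : w \in x :: s -> side T c e w.
  move=> ws; apply: (side_trans cx).
  case/splitPl: ws ps es => s1 s2 lw; rewrite cat_path => /andP[p1 _] es.
  exists s1; split=> //; apply: contra es; rewrite !inE mem_cat.
  by case/orP => ->; rewrite ?orbT.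
by split; exact: H.
Qed.

(** The unique boundary edge of a half-space determines it. *)
Lemma half_spaceP (U : set X) :
  half_space T U <-> exists a b, edges T (a, b) /\ U = side T a b.
Proof.
split.
  move=> [UV Uc [[a b] [[/= ab Ua nUb] Uu]]]; exists a, b; split=> //.
  apply/seteqP; split=> z.
    move=> Uz; have [s ps sz] := Uc a z Ua Uz.
    have sub : subrel (adj (induced_graph T U)) (adj T).
      by move=> x y /adjP[xy _]; exact/adjP.
    exists s; split=> //; first exact: sub_path ps.
    apply/negP => bs; apply: nUb; move: bs; rewrite inE => /predU1P[->//|bs].
    have allU x t : U x -> path (adj (induced_graph T U)) x t -> forall y, y \in t -> U y.
      elim: t x => //= v t IH x Ux /andP[/adjP[_ [_ /= Uv]] pt] y.
      by rewrite inE => /predU1P[->//|]; exact: (IH v Uv pt y).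
    exact: (allU a s Ua ps b bs).
  move: z; apply: side_ind => // z z' az Uz zz' z'b.
  apply: contrapT => nUz'; apply: z'b.
  have e : (a, b) = (z, z') by apply: Uu.
  by rewrite -[z']/((z, z').2) -e.
move=> [a [b [ab ->]]]; have nab := edges_neq ab; split.
- move=> z [s [ps _ <-]]; case/lastP: s ps => [_|s y].
    by have [] := edges_sub ab.
  by rewrite rcons_path last_rcons => /andP[_ /adjP/edges_sub[]].
- have H z : side T a b z -> linked (induced_graph T (side T a b)) a z.
    move: z; apply: side_ind => [|z z' az lz zz' z'b]; first exact: linked_refl.
    apply: (linked_trans lz (linked_edge _)); split=> //; split=> //=.
    exact: (side_step az zz' z'b).
  move=> x y ax ay; apply: (linked_trans _ (H y ay)); apply: linked_sym; exact: H.
- exists (a, b); split.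
    by split=> //=; [exact: side_refl|move/side_neq].
  move=> [z z'] /= [zz' az naz'].
  by have [//|[-> ->]] := side_stepE ab az zz'.
Qed.

(** Convexity as a condition on single edges, which is easy to transfer between a graph
and its induced subgraphs. *)
Definition edge_convex G Y := forall a b, edges G (a, b) ->
  (exists2 y, Y y & side G a b y) -> (exists2 y, Y y & side G b a y) -> Y a.

Lemma edge_convex_path G Y x s : edge_convex G Y -> path (adj G) x s -> uniq (x :: s) ->
  Y x -> Y (last x s) -> forall z, z \in s -> Y z.
Proof.
move=> Yc ps us Yx Ys z zs; case/splitPr: zs ps us Ys => s1 s2.
rewrite cat_path last_cat /= => /and3P[p1 /adjP wz p2] us Ys.
have {us} us : uniq ((x :: s1) ++ z :: s2) by [].
move: us; rewrite cat_uniq => /and3P[_ /hasPn us u2].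
apply: (Yc _ (last x s1) (edges_sym wz)).
  exists (last z s2) => //; exists s2; split=> //.
  by apply/negP => /us /=; rewrite mem_last.
exists x => //; apply: side_sym; exists s1; split=> //.
by apply: us; rewrite mem_head.
Qed.

(** A shortest path between points on both sides of an edge crosses it; conversely
each edge of a geodesic separates the end points. *)
Lemma graph_convexP Y : graph_convex T Y <-> edge_convex T Y.
Proof.
split.
  move=> Yc a b ab [y Yy ay] [y' Yy' by'].
  have yy' : linked T y y'.
    apply: (linked_trans (linked_sym (side_linked ay))).
    by apply: (linked_trans (linked_edge ab)); exact: (side_linked by').
  have ex : exists n, `[< exists s, [/\ path (adj T) y s, last y s = y' & size s = n] >].
    by have [s ps sy'] := yy'; exists (size s); apply/asboolP; exists s.
  case: (ex_minnP ex) => n.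
  move=> /asboolP[t [pt ty' tn]] tmin.
  have [|ain _] := side_cross ab pt ay.
    by rewrite ty' => /(side_disj ab); exact.
  move: ain; rewrite inE => /predU1P[->//|ain]; apply: (Yc _ _ Yy _ _ a ain).
    by rewrite ty'.
  split=> // s' ps' s'y'; rewrite tn; apply: tmin; apply/asboolP.
  by exists s'; rewrite s'y'.
move=> Yc x s Yx Ys [ps smin]; apply: (edge_convex_path Yc ps _ Yx Ys).
have [y ey] : exists y, last x s = y by exists (last x s).
rewrite ey in smin; move: ey; case/shortenP: (ps) => s' ps' us' ss' ls'.
apply: (leq_size_uniq us'); last by rewrite /= ltnS smin.
by move=> z; rewrite !inE => /orP[->//|/ss' ->]; rewrite orbT.
Qed.

(** Simple paths between points of a convex set stay in the set. *)
Lemma side_induced Y a b : edge_convex T Y -> Y a -> Y b -> edges T (a, b) ->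
  side (induced_graph T Y) a b = side T a b `&` Y.
Proof.
move=> Yc Ya Yb ab; have nab := edges_neq ab; apply/seteqP; split=> z.
  move: z; apply: side_ind => [|z z' _ [az Yz] [zz' [_ /= Yz']] z'b].
    by split=> //; exact: side_refl.
  by split=> //; exact: (side_step az zz' z'b).
move=> [[s [ps bs sz]] Yz]; move: sz.
case/shortenP: ps => s' ps' us' ss' sz; rewrite -sz in Yz *.
have Ys' := edge_convex_path Yc ps' us' Ya Yz.
have {}bs : b \notin a :: s'.
  by apply: contra bs; rewrite !inE => /orP[->//|/ss' ->]; rewrite orbT.
exists s'; split=> //; move: Ya Ys' ps' {us' ss' sz Yz nab ab bs}.
elim: s' a => //= z' s' IH x Yx Ys'.
move=> /andP[/adjP xz ps']; have Yz : Y z' by apply: Ys'; rewrite mem_head.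
apply/andP; split; first by apply/adjP.
by apply: IH => // w ws; apply: Ys'; rewrite inE ws orbT.
Qed.

(** A walk that never turns back moves away from each vertex that it leaves. *)
Lemma nonbacktracking_side (r : nat -> X) : (forall n, edges T (r n, r n.+1)) ->
  (forall n, r n.+2 <> r n) -> forall n k, side T (r n.+1) (r n) (r (n.+1 + k)%N).
Proof.
move=> re rb n k; elim: k n => [|k IH] n.
  by rewrite addn0; apply: side_refl; apply/nesym; exact: (edges_neq (re n)).
rewrite addnS -addSn; apply: (side_nest _ (re n.+1) _ (IH n.+1)).
  exact: (edges_sym (re n)).
exact: (nesym (rb n)).
Qed.

Lemma nonbacktracking_ray (r : nat -> X) : (forall n, edges T (r n, r n.+1)) ->
  (forall n, r n.+2 <> r n) -> ray T r.
Proof.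
move=> re rb; split=> // m n.
wlog mn : m n / (m <= n)%N.
  by move=> H rmn; case: (leqP m n) => [/H|/ltnW/H] ->.
move=> rmn; move: mn; rewrite leq_eqVlt => /predU1P[//|/subnKC nE].
have := nonbacktracking_side re rb m (n - m.+1).
by rewrite nE => /side_neq; rewrite rmn.
Qed.

Lemma ray_nonbacktracking (r : nat -> X) n : ray T r -> r n.+2 <> r n.
Proof. by move=> [rinj _] /rinj; lia. Qed.

Lemma ray_side (r : nat -> X) n k : ray T r -> side T (r n.+1) (r n) (r (n.+1 + k)%N).
Proof.
move=> rr; apply: nonbacktracking_side; first by case: rr.
by move=> m; exact: ray_nonbacktracking.
Qed.

(** The two rays stay on disjoint sides of their common origin. *)
Lemma rays_not_cotail (r r' : nat -> X) : ray T r -> ray T r' -> r 0%N = r' 0%N ->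
  r 1%N <> r' 1%N -> ~ cotail r r'.
Proof.
move=> rr rr' r0 r1 [m [n mn]]; apply: r1.
have e := mn 1%N; rewrite !addn1 in e.
have s1 := ray_side 0 m rr; have s2 := ray_side 0 n rr'.
rewrite -r0 in s2; rewrite !add1n in s1 s2; rewrite -e in s2.
have [_ re] := rr; have [_ re'] := rr'.
apply: (side_inj (re 0%N)); first by rewrite r0; exact: re'.
exact: (side_trans s1 (side_sym s2)).
Qed.

(** Without dead ends every edge can be prolonged to a ray. *)
Lemma prolong_ray x y : edges T (x, y) ->
  (forall z, linked T x z -> ~ leaf T z) ->
  exists r, [/\ ray T r, r 0%N = x & r 1%N = y].
Proof.
move=> xy nl.
have /choice[f Hf] : forall p : X * X, exists z, linked T x p.2 -> edges T (p.1, p.2) ->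
    edges T (p.2, z) /\ z <> p.1.
  move=> [a b] /=; have [[lb ab]|no] := pselect (linked T x b /\ edges T (a, b)); last first.
    by exists a => lb ab; case: no.
  apply: contrapT => /forallNP H; apply: (nl b lb); exists a; split; first exact: edges_sym.
  by move=> z bz; apply: contrapT => az; apply: (H z) => _ _; split=> // e; apply: az; rewrite e.
pose p n := iter n (fun p => (p.2, f p)) (x, y).
have pS n : p n.+1 = ((p n).2, f (p n)) by [].
have pe n : linked T x (p n).2 /\ edges T (p n).
  elim: n => [|n [IH1 IH2]]; first by split=> //; exact: linked_edge.
  rewrite pS /=; have [] := Hf (p n) IH1; first by rewrite -surjective_pairing.
  by move=> e _; split=> //; apply: (linked_trans IH1 (linked_edge e)).
exists (fun n => (p n).1); split=> //; apply: nonbacktracking_ray => n.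
  by rewrite pS /= -surjective_pairing; case: (pe n).
rewrite !pS /=; have [l e] := pe n; have [] := Hf (p n) l => //.
by rewrite -surjective_pairing.
Qed.

End acyclic.

Lemma acyclic_sub T T' : edges T' `<=` edges T -> acyclic T -> acyclic T'.
Proof.
move=> sub Tac s s2 /andP[cs us]; apply: (Tac s s2); apply/andP; split=> //.
by apply: sub_cycle cs => x y /adjP/sub/adjP.
Qed.

Lemma linked_sub T T' x y : edges T' `<=` edges T -> linked T' x y -> linked T x y.
Proof.
move=> sub [s ps sy]; exists s => //; apply: sub_path ps => u v /adjP uv; apply/adjP; exact: sub.
Qed.

Lemma side_sub T T' a b : edges T' `<=` edges T -> side T' a b `<=` side T a b.
Proof.
move=> sub z [s [ps bs sz]]; exists s; split=> //.
by apply: sub_path ps => u v /adjP uv; apply/adjP; exact: sub.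
Qed.

Lemma cotail_sym (r r' : nat -> X) : cotail r r' -> cotail r' r.
Proof. by move=> [m [n H]]; exists n, m => k. Qed.

Lemma cotail_trans (r1 r2 r3 : nat -> X) : cotail r1 r2 -> cotail r2 r3 -> cotail r1 r3.
Proof.
move=> [m [n H]] [m' [n' H']]; exists (m + m')%N, (n' + n)%N => k.
by rewrite -addnA H -addnA -H'; congr r2; lia.
Qed.

Lemma end_of_eq T r r' : cotail r r' -> end_of T r = end_of T r'.
Proof.
move=> rr'; apply/seteqP; split=> s [sr c]; split=> //.
  exact: (cotail_trans (cotail_sym rr') c).
exact: (cotail_trans rr' c).
Qed.

Lemma end_of_cotail T r r' : ray T r' -> end_of T r = end_of T r' -> cotail r r'.
Proof.
move=> rr' e; have [] : end_of T r r' => //.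
by rewrite e; split=> //; exists 0%N, 0%N.
Qed.

End trees.

(** * Countable Borel equivalence relations with a cocycle *)

Lemma bigcup_countType_negligible (R : realType) d (X : measurableType d)
    (mu : {measure set X -> \bar R}) (I : countType) (F : I -> set X) :
  (forall i, mu.-negligible (F i)) -> mu.-negligible (\bigcup_i F i).
Proof.
move=> Fn; pose H n := if unpickle n is Some i then F i else set0.
have /negligible_bigcup : forall n, mu.-negligible (H n).
  by move=> n; rewrite /H; case: (unpickle n) => [i|]; [exact: Fn|exact: negligible_set0].
apply: negligibleS => x [i _ Fx]; exists (pickle i) => //.
by rewrite /H pickleK.
Qed.

Section esum_facts.
Context (R : realType) (I : choiceType).
Implicit Types (A B : set I) (a : I -> \bar R).
Local Open Scope ereal_scope.

Lemma esum_subset A B a : A `<=` B -> \esum_(i in A) a i <= \esum_(i in B) a i.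
Proof.
move=> AB; apply: ereal_sup_le => _ [F [Ff FA] <-].
by exists F => //; split=> //; exact: subset_trans AB.
Qed.

Lemma esumZr_le A a (k : R) : (forall i, 0 <= a i) -> (0 <= k)%R ->
  \esum_(i in A) (a i * k%:E) <= (\esum_(i in A) a i) * k%:E.
Proof.
move=> a0 k0; apply: ge_ereal_sup => _ [F [Ff FA] <-].
rewrite -ge0_mule_fsuml//; apply: lee_wpmul2r; rewrite ?lee_fin//.
by apply: ereal_sup_ubound; exists F.
Qed.

Lemma esum_setU_lty A B a : (forall i, 0 <= a i) ->
  \esum_(i in A) a i < +oo -> \esum_(i in B) a i < +oo -> \esum_(i in A `|` B) a i < +oo.
Proof.
move=> a0 Aoo Boo; rewrite (esumID A)// lte_add_pinfty//.
  by apply: le_lt_trans Aoo; apply: esum_subset => i [].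
by apply: le_lt_trans Boo; apply: esum_subset => i [[]].
Qed.

Lemma esum_tail A a (e : R) : (forall i, 0 <= a i) -> \esum_(i in A) a i < +oo ->
  (0 < e)%R -> exists2 F, finite_set F & \esum_(i in A `\` F) a i <= e%:E.
Proof.
move=> a0 Aoo e0.
have fA : \esum_(i in A) a i \is a fin_num.
  by rewrite ge0_fin_numE// esum_ge0.
have [_ [F [Ff FA] <-] lF] := ub_ereal_sup_adherent e0 fA.
exists F => //; move: lF; rewrite -/(esum A a) (esumID F A a)// setIidr// -setDE.
rewrite -esum_fset//.
have finS B : B `<=` A -> \esum_(i in B) a i \is a fin_num.
  move=> BA; rewrite ge0_fin_numE ?esum_ge0//.
  by apply: le_lt_trans Aoo; exact: esum_subset.
rewrite -(fineK (finS F FA)) -(fineK (finS (A `\` F) (@subDsetl _ _ _))).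
move: (fine _) (fine _) => t s.
move=> lF; have {lF} : (s + t - e)%:E < s%:E := lF.
by rewrite lte_fin lee_fin; lra.
Qed.

Lemma esum_superlevel A a (e : R) : (forall i, 0 <= a i) -> \esum_(i in A) a i < +oo ->
  (0 < e)%R -> finite_set [set i | A i /\ e%:E <= a i].
Proof.
move=> a0 Aoo e0; have e2 : (0 < e / 2)%R by rewrite divr_gt0.
have [F Ff AF] := esum_tail a0 Aoo e2.
apply: sub_finite_set Ff => i [Ai ei]; apply: contrapT => nFi.
suff : e%:E <= (e / 2)%:E by rewrite lee_fin; lra.
apply: le_trans ei (le_trans _ AF).
rewrite -(@esum_set1 R _ i a)//; apply: esum_subset => j -> //.
Qed.

(** Restricting the series to first occurrences keeps a value that g takes repeatedly
from being counted more than once. *)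
Lemma esum_enum (g : nat -> I) A a : A `<=` range g -> (forall i, 0 <= a i) ->
  \esum_(i in A) a i = \sum_(0 <= n <oo)
    (if `[< A (g n) /\ forall m, (m < n)%N -> g m <> g n >] then a (g n) else 0).
Proof.
move=> Ag a0; pose N := [set n | A (g n) /\ forall m, (m < n)%N -> g m <> g n].
rewrite nneseries_esumT; last by move=> n; case: ifP.
rewrite (reindex_esum N A g); last first.
  split=> [n [] //|n m /set_mem[_ Nn] /set_mem[_ Nm] gnm|i Ai].
    by case: (ltngtP n m) => // [/Nm|/Nn]; [case|case].
  have [k _ ki] := Ag i Ai.
  have ex : exists n, g n == i by exists k; rewrite ki.
  case: (ex_minnP ex) => n /eqP gn nmin; exists n => //=; rewrite /N /= gn; split=> // m mn gm.
  by have := nmin m; rewrite gm eqxx leqNgt mn => /(_ isT).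
rewrite esum_mkcond; apply: eq_esum => n _.
by congr (if _ then _ else _); apply/idP/asboolP; rewrite inE.
Qed.

End esum_facts.

Lemma esum_single (R : realType) (I : choiceType) (A : set I) i (a : I -> \bar R) :
  A i -> (forall j, A j -> (0 <= a j)%E) -> (forall j, A j -> j <> i -> a j = 0%E) ->
  (\esum_(j in A) a j = a i)%E.
Proof.
move=> Ai a0 ai; rewrite (esumID [set i])// setIidr => [|_ ->//].
rewrite esum_set1 ?a0// [X in (_ + X)%E]esum1 ?adde0// => j [Aj ji].
exact: ai.
Qed.

(** A countable Borel equivalence relation on a standard Borel space, enumerated by
Borel functions, with a cocycle that satisfies the mass transport formula. *)
Record weighted_equivalence (R : realType) d (X : measurableType d)
    (c : X -> nat -> nat) (mu : probability X R) (E : set (X * X))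
    (f : nat -> X -> X) (rho : X * X -> R) : Prop := WeightedEquivalence {
  we_code : borel_code c;
  we_enum_measurable : forall n, measurable_fun setT (f n);
  we_enum : forall x y, E (x, y) <-> exists n, f n x = y;
  we_measurable : measurable E;
  we_refl : forall x, E (x, x);
  we_sym : forall x y, E (x, y) -> E (y, x);
  we_trans : forall x y z, E (x, y) -> E (y, z) -> E (x, z);
  we_null : forall N : set X, mu.-negligible N ->
    mu.-negligible [set x | exists2 y, N y & E (x, y)];
  we_weight_measurable : measurable_fun E rho;
  we_weight_gt0 : forall p, E p -> 0 < rho p;
  we_cocycle : forall x y z, E (x, y) -> E (y, z) -> rho (z, y) * rho (y, x) = rho (z, x);
  we_transport : forall h : X * X -> \bar R, measurable_fun E h ->
    (forall p, E p -> (0 <= h p)%E) ->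
    (\int[mu]_x (\esum_(y in [set y | E (x, y)]) h (x, y)) =
     \int[mu]_x (\esum_(y in [set y | E (x, y)]) (h (y, x) * (rho (y, x))%:E)))%E }.

Section weighted_equivalence_theory.
Context (R : realType) d (X : measurableType d) (c : X -> nat -> nat).
Variables (mu : probability X R) (E : set (X * X)) (f : nat -> X -> X) (rho : X * X -> R).
Hypothesis HE : weighted_equivalence c mu E f rho.

Let cX := we_code HE.
Let fm := we_enum_measurable HE.
Let fE := we_enum HE.
Let Em := we_measurable HE.
Let Exx := we_refl HE.
Let Esym := we_sym HE.
Let Etrans := we_trans HE.
Let Enull := we_null HE.
Let rhom := we_weight_measurable HE.
Let rho0 := we_weight_gt0 HE.
Let rhoM := we_cocycle HE.
Let transport := we_transport HE.

Section base.
Context d' (W : measurableType d').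
Implicit Types (g h : W -> X) (P : W -> X -> Prop).

Lemma mpred_eq g h : measurable_fun setT g -> measurable_fun setT h ->
  mpred (fun w => g w = h w).
Proof.
move=> mg mh; apply: (@mpred_ext _ _ (fun w => forall n, exists k, c (g w) n = k /\ c (h w) n = k)).
  move=> w; split=> [H|-> n]; last by exists (c (h w) n).
  by apply: (code_inj cX) => n; have [k [-> ->]] := H n.
apply: mpred_forall => n; apply: mpred_exists => k.
by apply: mpred_and; exact: (mpred_code cX n (fun v => v = k)).
Qed.

Lemma mpred_rel (A : set (X * X)) g h : measurable A -> measurable_fun setT g ->
  measurable_fun setT h -> mpred (fun w => A (g w, h w)).
Proof.
move=> mA mg mh.
apply: (@mpred_comp _ _ _ _ (fun p => A p) (fun w => (g w, h w))) => //.
exact: measurable_fun_pair.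
Qed.

Lemma measurable_fun_enum n g : measurable_fun setT g -> measurable_fun setT (fun w => f n (g w)).
Proof. by move=> mg; apply: measurableT_comp. Qed.

(** Quantification over a class is quantification over the enumerating functions, so
that first-order definitions over the points of a class are measurable. *)
Lemma mpred_exists_class g P : measurable_fun setT g ->
  (forall h, measurable_fun setT h -> mpred (fun w => P w (h w))) ->
  mpred (fun w => exists y, E (g w, y) /\ P w y).
Proof.
move=> mg mP; apply: (@mpred_ext _ _ (fun w => exists n, P w (f n (g w)))).
  move=> w; split=> [[n Pn]|[y [/fE[n <-] Py]]]; last by exists n.
  by exists (f n (g w)); split=> //; apply/fE; exists n.
by apply: mpred_exists => n; apply: mP; exact: measurable_fun_enum.
Qed.

Lemma mpred_forall_class g P : measurable_fun setT g ->
  (forall h, measurable_fun setT h -> mpred (fun w => P w (h w))) ->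
  mpred (fun w => forall y, E (g w, y) -> P w y).
Proof.
move=> mg mP; apply: (@mpred_ext _ _ (fun w => forall n, P w (f n (g w)))).
  move=> w; split=> [H y /fE[n <-]//|H n].
  by apply: H; apply/fE; exists n.
by apply: mpred_forall => n; apply: mP; exact: measurable_fun_enum.
Qed.

Lemma measurable_fun_if_mpred d2 (Z : measurableType d2) (Q : W -> Prop) (u v : W -> Z) :
  mpred Q -> measurable_fun setT u -> measurable_fun setT v ->
  measurable_fun setT (fun w => if `[< Q w >] then u w else v w).
Proof.
move=> mQ; apply: measurable_fun_ifT; apply: (measurable_fun_bool true).
rewrite setTI; move: mQ; congr measurable; apply/seteqP; split=> w /=; first by move/asboolP.
by move=> /asboolP.
Qed.

(** Sums over classes are series over first occurrences in the enumeration. *)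
Lemma measurable_fun_esum g (h : W -> X -> \bar R) : measurable_fun setT g ->
  (forall w y, (0 <= h w y)%E) ->
  (forall k, measurable_fun setT k -> measurable_fun setT (fun w => h w (k w))) ->
  measurable_fun setT (fun w => \esum_(y in [set y | E (g w, y)]) h w y)%E.
Proof.
move=> mg h0 mh.
have -> : (fun w => \esum_(y in [set y | E (g w, y)]) h w y)%E =
    (fun w => \sum_(0 <= n <oo)
       (if `[< E (g w, f n (g w)) /\ forall m, (m < n)%N -> f m (g w) <> f n (g w) >]
        then h w (f n (g w)) else 0))%E.
  apply/funext => w; apply: (@esum_enum _ _ (fun n => f n (g w))) => //.
  by move=> y /fE[n <-]; exists n.
apply: (@ge0_emeasurable_sum _ _ _ setT _ xpredT) => n; first by move=> w _ _; case: ifP.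
move=> _; apply: measurable_fun_if_mpred.
- apply: mpred_and; first by apply: mpred_rel => //; exact: measurable_fun_enum.
  apply: mpred_forall => m; apply: mpred_imp; first exact: mpred_cst.
  by apply: mpred_not; apply: mpred_eq; exact: measurable_fun_enum.
- by apply: mh; exact: measurable_fun_enum.
- exact: measurable_cst.
Qed.

Definition weight (y x : X) : \bar R := if `[< E (x, y) >] then (rho (y, x))%:E else 0%E.

Lemma measurable_weight g h : measurable_fun setT g -> measurable_fun setT h ->
  measurable_fun setT (fun w => weight (g w) (h w)).
Proof.
move=> mg mh.
have mr : measurable_fun setT ((EFin \o rho) \_ E : X * X -> \bar R).
  apply: (measurable_restrictT (EFin \o rho) Em).1; exact/measurable_EFinP.
have -> : (fun w => weight (g w) (h w)) = (fun w => ((EFin \o rho) \_ E) (g w, h w)).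
  apply/funext => w; rewrite /weight patchE; case: asboolP => Ehg.
    by rewrite mem_set//; exact: Esym.
  by rewrite memNset// => /Esym.
by apply: measurableT_comp => //; exact: measurable_fun_pair.
Qed.

End base.

Lemma weight_ge0 y x : (0 <= weight y x)%E.
Proof. by rewrite /weight; case: asboolP => // /Esym/rho0/ltW; rewrite lee_fin. Qed.

Lemma rho_refl x : rho (x, x) = 1.
Proof.
have := rhoM (Exx x) (Exx x); have := rho0 (Exx x) => r0.
by move/(canRL (mulfK (lt0r_neq0 r0))); rewrite divff// lt0r_neq0.
Qed.

Definition finite_weight (A : set X) x := (\esum_(y in A) weight y x < +oo)%E.

Lemma weightE (A : set X) x : A `<=` [set y | E (x, y)] ->
  (\esum_(y in A) weight y x = \esum_(y in A) (rho (y, x))%:E)%E.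
Proof. by move=> AE; apply: eq_esum => y /AE Exy; rewrite /weight; case: asboolP. Qed.

Lemma weight_base x x' y : E (x, x') -> weight y x = (weight y x' * (rho (x', x))%:E)%E.
Proof.
move=> xx'; rewrite /weight; case: asboolP => xy.
  case: asboolP => x'y; last by case: x'y; apply: Etrans xy; exact: Esym.
  by rewrite -EFinM rhoM.
by case: asboolP => [x'y|]; rewrite ?mul0e//; case: xy; exact: Etrans x'y.
Qed.

(** A change of base point multiplies all weights by one positive number. *)
Lemma finite_weight_base (A : set X) x x' : E (x, x') ->
  finite_weight A x' -> finite_weight A x.
Proof.
move=> xx'; rewrite /finite_weight => Aoo; have r0 := rho0 (Esym xx').
under eq_esum do rewrite (weight_base _ xx').
apply: le_lt_trans.
  by apply: esumZr_le (ltW r0) => y; exact: weight_ge0.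
have := Aoo; rewrite -ge0_fin_numE; last by apply: esum_ge0 => y _; exact: (weight_ge0 y x').
by move=> /fineK <-; rewrite -EFinM ltry.
Qed.

Lemma finite_weight_sub (A B : set X) x : A `<=` B -> finite_weight B x -> finite_weight A x.
Proof. by move=> AB; apply: le_lt_trans; exact: esum_subset. Qed.

Lemma finite_weightU (A B : set X) x : finite_weight A x -> finite_weight B x ->
  finite_weight (A `|` B) x.
Proof. by apply: esum_setU_lty => y; exact: weight_ge0. Qed.

Lemma weight_sum_class (A : set X) x :
  (\esum_(y in A) weight y x =
   \esum_(y in [set y | E (x, y)]) (if `[< A y >] then weight y x else 0))%E.
Proof.
rewrite esum_mkcond [RHS]esum_mkcond; apply: eq_esum => y _.
have [Exy|nExy] := pselect (E (x, y)).
  rewrite (@mem_set _ [set y | E (x, y)] y Exy).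
  by case: asboolP => Ay; [rewrite mem_set|rewrite memNset].
rewrite (@memNset _ [set y | E (x, y)] y nExy) /weight.
by case: (asboolP (E (x, y))) => // _; case: ifP.
Qed.

Lemma measurable_weight_sum d' (W : measurableType d') (A : W -> set X) (g : W -> X) :
  measurable_fun setT g ->
  (forall h, measurable_fun setT h -> mpred (fun w => A w (h w))) ->
  measurable_fun setT (fun w => \esum_(y in A w) weight y (g w))%E.
Proof.
move=> mg mA; under eq_fun => w do rewrite weight_sum_class.
apply: (measurable_fun_esum (h := fun w y => if `[< A w y >] then weight y (g w) else 0%E)) => //.
  by move=> w y; case: ifP => // _; exact: weight_ge0.
move=> k mk; apply: measurable_fun_if_mpred; [exact: mA|exact: measurable_weight|].
exact: measurable_cst.
Qed.

Lemma mpred_lte d' (W : measurableType d') (u : W -> \bar R) (e : \bar R) :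
  measurable_fun setT u -> mpred (fun w => (u w < e)%E).
Proof.
by move=> um; have := emeasurable_fun_infty_o measurableT um e; rewrite setTI.
Qed.

Lemma mpred_lee d' (W : measurableType d') (u : W -> \bar R) (e : \bar R) :
  measurable_fun setT u -> mpred (fun w => (u w <= e)%E).
Proof.
move=> um; have := mpred_not (P := fun w => (e < u w)%E).
have := emeasurable_fun_o_infty measurableT um e; rewrite setTI => m1 /(_ m1).
by apply: mpred_ext => w; rewrite leNgt; split=> /negP.
Qed.

(** Saturations of null sets are null, so null sets may be taken invariant. *)
Definition null_invariant (N : set X) :=
  [/\ measurable N, mu N = 0%E & forall x y, E (x, y) -> N x -> N y].

Lemma negligible_invariant (A : set X) : mu.-negligible A ->
  exists2 N, null_invariant N & A `<=` N.
Proof.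
move=> [B [mB muB AB]].
have mN : measurable [set x | exists y, E (x, y) /\ B y].
  apply: (@mpred_exists_class _ X id (fun _ y => B y)); first exact: measurable_id.
  by move=> h mh; exact: (mpred_comp mh mB).
exists [set x | exists y, E (x, y) /\ B y]; last by move=> x /AB Bx; exists x.
split=> //; last by move=> x y xy [z [xz Bz]]; exists z; split=> //; exact: Etrans (Esym xy) xz.
apply/negligibleP => //.
have /Enull : mu.-negligible B by apply/negligibleP.
by apply: negligibleS => x [y [xy By]]; exists y.
Qed.

Lemma null_invariantU N1 N2 : null_invariant N1 -> null_invariant N2 ->
  null_invariant (N1 `|` N2).
Proof.
move=> [m1 z1 i1] [m2 z2 i2]; split; first exact: measurableU.
  by rewrite measureU0.
by move=> x y xy [/(i1 _ _ xy)|/(i2 _ _ xy)]; [left|right].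
Qed.

Lemma null_invariant_out N x y : null_invariant N -> E (x, y) -> ~ N x -> ~ N y.
Proof. by move=> [_ _ Ni] xy nNx /(Ni _ _ (Esym xy)). Qed.

Lemma negligible_out N (A : set X) : null_invariant N -> (forall x, ~ N x -> ~ A x) ->
  mu.-negligible A.
Proof.
move=> [mN N0 _] H; exists N; split=> // x Ax.
by apply: contrapT => /H.
Qed.

Let one_on (Q : set (X * X)) (p : X * X) : \bar R := if `[< Q p >] then 1%E else 0%E.

Lemma transport_rel (Q : set (X * X)) : measurable Q -> Q `<=` E ->
  (\int[mu]_x (\esum_(y in [set y | E (x, y)]) one_on Q (x, y)) =
   \int[mu]_x (\esum_(y in [set y | Q (y, x)]) weight y x))%E.
Proof.
move=> mQ QE; rewrite (transport (h := one_on Q)); last 2 first.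
- apply: measurable_funS (@measurableT _ _) (@subsetT _ _) _.
  exact: (measurable_fun_if_mpred (u := fun=> 1%E) (v := fun=> 0%E)).
- by move=> p _; rewrite /one_on; case: ifP.
apply: eq_integral => x _; rewrite [RHS]weight_sum_class; apply: eq_esum => y xy.
rewrite /one_on /weight /=; case: asboolP => Qyx; last by rewrite mul0e.
by case: asboolP => //; rewrite mul1e.
Qed.

Lemma measurable_in_weight (Q : set (X * X)) : measurable Q ->
  measurable_fun setT (fun x => \esum_(y in [set y | Q (y, x)]) weight y x)%E.
Proof.
move=> mQ; apply: (measurable_weight_sum (A := fun x => [set y | Q (y, x)])).
  exact: measurable_id.
by move=> h mh; apply: mpred_rel => //; exact: measurable_id.
Qed.

(** Mass transport: everyone sends its mass to at most one point, so almost every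
point receives a finite mass. *)
Lemma functional_fibre_finite (Q : set (X * X)) : measurable Q -> Q `<=` E ->
  (forall z y y', Q (z, y) -> Q (z, y') -> y = y') ->
  exists2 N, null_invariant N & forall y, ~ N y -> finite_weight [set z | Q (z, y)] y.
Proof.
move=> mQ QE Qf.
pose u x := (\esum_(y in [set y | Q (y, x)]) weight y x)%E.
have mu_ : measurable_fun setT u by exact: measurable_in_weight.
have u0 x : (0 <= u x)%E by apply: esum_ge0 => y _; exact: weight_ge0.
have : (\int[mu]_x u x <= 1)%E.
  rewrite -transport_rel//; apply: (@le_trans _ _ (\int[mu]_x (cst 1 x))%E).
    apply: ge0_le_integral => //.
    - by move=> x _; apply: esum_ge0 => y _; rewrite /one_on; case: ifP.
    - apply: (measurable_fun_esum (g := id) (h := fun x y => one_on Q (x, y))) => //.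
        by move=> x y; rewrite /one_on; case: ifP.
      move=> k mk; apply: (measurable_fun_if_mpred (u := fun=> 1%E) (v := fun=> 0%E)) => //.
      by apply: mpred_rel => //; exact: measurable_id.
    - move=> x _; have [[y Qxy]|/forallNP nQ] := pselect (exists y, Q (x, y)); last first.
        by rewrite esum1// => y _; rewrite /one_on; case: asboolP => // /nQ.
      rewrite (esumID [set y])/=; last by move=> z _; rewrite /one_on; case: ifP.
      rewrite [X in (_ + X)%E]esum1 ?adde0; last first.
        move=> z [_ /= zy]; rewrite /one_on; case: asboolP => // /Qf/(_ Qxy).
        by move=> e; case: zy.
      apply: le_trans (esum_subset (B := [set y]) _ _) _; first exact: subIsetr.
      by rewrite esum_set1 /one_on; case: ifP.
  by rewrite integral_cst// mul1e; exact: probability_le1.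
move=> iu.
have /integrable_ae : mu.-integrable setT u.
  apply/integrableP; split=> //.
  under eq_integral do rewrite gee0_abs//.
  by apply: le_lt_trans iu _; rewrite ltry.
move=> /(_ measurableT) ae.
have [N NN AN] := negligible_invariant ae.
exists N => // y nNy; rewrite /finite_weight -/(u y).
have : u y \is a fin_num by apply: contrapT => h; apply/nNy/AN => /(_ Logic.I).
by rewrite ge0_fin_numE.
Qed.

(** The number of senders is at most the mass sent, which equals the mass received. *)
Lemma senders_measure (Q : set (X * X)) (e : R) : 0 <= e -> measurable Q -> Q `<=` E ->
  (forall x, (\esum_(z in [set z | Q (z, x)]) weight z x <= e%:E)%E) ->
  (mu [set z | exists x, E (z, x) /\ Q (z, x)] <= e%:E)%E.
Proof.
move=> e0 mQ QE Qe; set B := [set z | _].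
have mB : measurable B.
  apply: (@mpred_exists_class _ X id (fun z x => Q (z, x))); first exact: measurable_id.
  by move=> h mh; apply: mpred_rel => //; exact: measurable_id.
have mone : measurable_fun setT (fun x => \esum_(y in [set y | E (x, y)]) one_on Q (x, y))%E.
  apply: (measurable_fun_esum (g := id) (h := fun x y => one_on Q (x, y))) => //.
    by move=> x y; rewrite /one_on; case: ifP.
  move=> k mk; apply: (measurable_fun_if_mpred (u := fun=> 1%E) (v := fun=> 0%E)) => //.
  by apply: mpred_rel => //; exact: measurable_id.
rewrite -(setIT B) -integral_indic//.
apply: (@le_trans _ _ (\int[mu]_x (\esum_(y in [set y | E (x, y)]) one_on Q (x, y)))%E).
  apply: ge0_le_integral => //.
  - by apply/measurable_EFinP; exact: measurable_indic.
  - move=> z _; rewrite indicE; have [[x [zx Qzx]]|nB] := pselect (B z); last first.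
      by rewrite memNset//; apply: esum_ge0 => y _; rewrite /one_on; case: ifP.
    rewrite mem_set; last by exists x.
    apply: le_trans (esum_subset (A := [set x]) _ _); last by move=> _ ->.
    by rewrite esum_set1 /one_on; case: asboolP.
rewrite transport_rel//.
apply: (@le_trans _ _ (\int[mu]_x (cst e%:E x))%E).
  apply: ge0_le_integral => //; last exact: measurable_in_weight.
  by move=> x _; apply: esum_ge0 => y _; exact: weight_ge0.
rewrite integral_cst// -[leRHS]mule1; apply: lee_wpmul2l; first by rewrite lee_fin.
exact: probability_le1.
Qed.

End weighted_equivalence_theory.

Section side_meet.
Context (X : choiceType) (T : graph X).
Hypothesis Tac : acyclic T.

(** Two half-spaces with a common point, neither of which contains the outer end
point of the other, coincide. *)
Lemma side_meet a b a' b' z : edges T (a, b) -> edges T (a', b') ->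
  side T a b z -> side T a' b' z -> ~ side T a b b' -> ~ side T a' b' b ->
  a = a' /\ b = b'.
Proof.
move=> ab ab' az a'z nab' na'b.
have a'a : side T a' b' a.
  suff H w : side T z b w -> side T a' b' w by apply: H; exact: side_sym.
  move: w; apply: side_ind => // w w' zw a'w ww' w'b.
  apply: (side_step a'w ww') => w'b'; apply: nab'; rewrite -w'b'.
  exact: (side_trans az (side_step zw ww' w'b)).
by have [] := side_stepE Tac ab' a'a ab.
Qed.

End side_meet.

Fixpoint steps (X : Type) (S : X -> X -> Prop) n x y : Prop :=
  if n is m.+1 then exists2 z, steps S m x z & S z y else x = y.

Lemma steps_add (X : Type) (S : X -> X -> Prop) m n x y z :
  steps S m x y -> steps S n y z -> steps S (m + n) x z.
Proof.
move=> xy; elim: n z => [|n IH] z /=; first by move=> <-; rewrite addn0.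
by move=> [w yw wz]; rewrite addnS; exists w => //; exact: IH.
Qed.

Lemma stepsSr (X : Type) (S : X -> X -> Prop) n x y :
  steps S n.+1 x y <-> exists2 z, S x z & steps S n z y.
Proof.
elim: n y => [|n IH] y; first by split=> /= -[z]; [move=> <-; exists y|exists x => //; congruence].
split=> [[w /IH[z xz zw] wy]|[z xz [w zw wy]]].
  by exists z => //; exists w.
by exists w => //; apply/IH; exists z.
Qed.

Lemma linked_steps (X : choiceType) (T : graph X) x y :
  linked T x y <-> exists n, steps (fun u v => edges T (u, v)) n x y.
Proof.
split=> [|[n]].
  move: y; apply: linked_ind => [|z z' _ [n xz] zz']; first by exists 0%N.
  by exists n.+1, z.
elim: n y => [y <-|n IH y [z /IH xz zy]]; first exact: linked_refl.
exact: (linked_trans xz (linked_edge zy)).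
Qed.

Lemma side_steps (X : choiceType) (T : graph X) a b z :
  side T a b z <-> a <> b /\ exists n, steps (fun u v => edges T (u, v) /\ v <> b) n a z.
Proof.
split=> [az|[ab [n]]].
  split; first exact: (side_neq0 az).
  move: z az; apply: side_ind => [|z z' _ [n azn] zz' z'b]; first by exists 0%N.
  by exists n.+1, z.
elim: n z => [z <-|n IH z [w /IH aw [wz zb]]]; first exact: side_refl.
exact: (side_step aw wz zb).
Qed.

(** * The core and the pieces that hang from convex sets *)

Section graph_weights.
Context (R : realType) d (X : measurableType d) (c : X -> nat -> nat).
Variables (mu : probability X R) (E : set (X * X)) (f : nat -> X -> X) (rho : X * X -> R).
Hypothesis HE : weighted_equivalence c mu E f rho.

Let Exx := we_refl HE.
Let Esym := we_sym HE.
Let Etrans := we_trans HE.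

Local Notation finw := (finite_weight E rho).
Local Notation wt := (weight E rho).

Lemma mpred_steps d' (W : measurableType d') (S : W -> X -> X -> Prop) (g h : W -> X) n :
  (forall w x y, S w x y -> E (x, y)) ->
  (forall u v : W -> X, measurable_fun setT u -> measurable_fun setT v ->
     mpred (fun w => S w (u w) (v w))) ->
  measurable_fun setT g -> measurable_fun setT h ->
  mpred (fun w => steps (S w) n (g w) (h w)).
Proof.
move=> SE mS; elim: n g h => [|n IH] g h mg mh /=; first exact: (mpred_eq HE).
apply: (@mpred_ext _ _ (fun w => exists z, E (h w, z) /\ (steps (S w) n (g w) z /\ S w z (h w)))).
  move=> w; split=> [[z [_ [gz zh]]]|[z gz zh]]; first by exists z.
  by exists z; split=> //; apply: Esym; exact: (SE w _ _ zh).
apply: (mpred_exists_class HE mh (P := fun w z => steps (S w) n (g w) z /\ S w z (h w))).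
by move=> k mk; apply: mpred_and; [exact: IH|exact: mS].
Qed.

Section one_graph.
Variable G : graph X.
Hypothesis Gac : acyclic G.
Hypothesis GE : edges G `<=` E.
Hypothesis mG : measurable (edges G).
Hypothesis mV : measurable (vertices G).

Lemma linked_class x y : linked G x y -> E (x, y).
Proof.
move: y; apply: linked_ind => // z z' _ xz /GE; exact: Etrans.
Qed.

Lemma side_class a b : side G a b `<=` [set z | E (a, z)].
Proof. by move=> z /side_linked/linked_class. Qed.

Lemma mpred_edges d' (W : measurableType d') (g h : W -> X) : measurable_fun setT g ->
  measurable_fun setT h -> mpred (fun w => edges G (g w, h w)).
Proof. exact: mpred_rel. Qed.

Lemma mpred_linked d' (W : measurableType d') (g h : W -> X) : measurable_fun setT g ->
  measurable_fun setT h -> mpred (fun w => linked G (g w) (h w)).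
Proof.
move=> mg mh.
apply: (@mpred_ext _ _ (fun w => exists n, steps (fun u v => edges G (u, v)) n (g w) (h w))).
  by move=> w; rewrite linked_steps.
apply: mpred_exists => n; apply: (mpred_steps (S := fun _ u v => edges G (u, v))) => //.
  by move=> _ u v /GE.
exact: mpred_edges.
Qed.

Lemma mpred_side d' (W : measurableType d') (g1 g2 g3 : W -> X) : measurable_fun setT g1 ->
  measurable_fun setT g2 -> measurable_fun setT g3 ->
  mpred (fun w => side G (g1 w) (g2 w) (g3 w)).
Proof.
move=> m1 m2 m3.
apply: (@mpred_ext _ _ (fun w => g1 w <> g2 w /\ exists n,
    steps (fun u v => edges G (u, v) /\ v <> g2 w) n (g1 w) (g3 w))).
  by move=> w; rewrite side_steps.
apply: mpred_and; first by apply: mpred_not; exact: (mpred_eq HE).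
apply: mpred_exists => n.
apply: (mpred_steps (S := fun w u v => edges G (u, v) /\ v <> g2 w)) => //.
  by move=> w u v [/GE].
move=> u v mu_ mv; apply: mpred_and; first exact: mpred_edges.
by apply: mpred_not; exact: (mpred_eq HE).
Qed.

Definition finite_side a b := finw (side G a b) a.

Lemma mpred_finite_side d' (W : measurableType d') (g h : W -> X) : measurable_fun setT g ->
  measurable_fun setT h -> mpred (fun w => finite_side (g w) (h w)).
Proof.
move=> mg mh; apply: mpred_lte.
apply: (measurable_weight_sum HE (A := fun w => side G (g w) (h w))) => // k mk.
exact: mpred_side.
Qed.

Definition core_of : set X := [set x | vertices G x /\
  forall a b, edges G (a, b) -> side G a b x -> ~ finite_side a b].

(** In a forest the half-spaces are the sides of the edges, and finiteness of a side does
not depend on the base point. *)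
Lemma vertex_coreE : vertex_core G rho = core_of.
Proof.
have sumE a b x : side G a b x -> (\esum_(y in side G a b) (rho (y, x))%:E = +oo)%E <->
    ~ finite_side a b.
  move=> ax; have Eax := side_class ax.
  have sub : side G a b `<=` [set y | E (x, y)].
    by move=> y /side_class; exact: (Etrans (Esym Eax)).
  rewrite -(weightE rho sub); split=> [xoo fab|nf].
    have : (\esum_(y in side G a b) wt y x < +oo)%E := finite_weight_base HE (Esym Eax) fab.
    by rewrite xoo.
  apply/eqP; rewrite -leye_eq leNgt; apply/negP => fx; apply: nf.
  exact: (finite_weight_base HE Eax).
apply/seteqP; split=> x [Vx H]; split=> //.
  move=> a b ab ax; apply/(sumE _ _ _ ax)/H => //.
  by apply/(half_spaceP Gac); exists a, b.
move=> U /(half_spaceP Gac)[a [b [ab ->]]] ax; apply/(sumE _ _ _ ax).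
exact: H.
Qed.

Lemma mpred_core d' (W : measurableType d') (g : W -> X) : measurable_fun setT g ->
  mpred (fun w => core_of (g w)).
Proof.
move=> mg; apply: mpred_and; first exact: (mpred_comp mg mV).
apply: (@mpred_ext _ _ (fun w => forall a, E (g w, a) -> forall b, E (g w, b) ->
    edges G (a, b) -> side G a b (g w) -> ~ finite_side a b)).
  move=> w; split=> [H a b ab ax|H a _ b _]; last exact: H.
  have Ega : E (g w, a) by apply: Esym; exact: (side_class ax).
  by apply: H => //; exact: (Etrans Ega (GE ab)).
apply: (mpred_forall_class HE mg) => h mh; apply: (mpred_forall_class HE mg) => k mk.
apply: mpred_imp; first exact: mpred_edges.
apply: mpred_imp; first exact: mpred_side.
by apply: mpred_not; exact: mpred_finite_side.
Qed.

Lemma core_measurable : measurable core_of.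
Proof. by apply: (mpred_core (g := id)); exact: measurable_id. Qed.

(** A finite half-space around an end point of an edge cannot contain two points of
the core on both sides of the edge; both would lie in its complement, and then so would
the edge. *)
Lemma core_convex : edge_convex G core_of.
Proof.
move=> a b ab [x [Vx cx] ax] [x' [Vx' cx'] bx'].
split; first by have [] := edges_sub ab.
move=> e e' ee' ea fe.
have out y : linked G a y -> (side G e e' y -> ~ finite_side e e') -> side G e' e y.
  move=> ay ny; have ey := linked_trans (side_linked ea) ay.
  by case: (side_cover ee' ey) => // /ny.
have ex : side G e' e x by apply: (out _ (side_linked ax)); exact: cx.
have ex' : side G e' e x'.
  apply: (out _ (linked_trans (linked_edge ab) (side_linked bx'))); exact: cx'.
have nax' : ~ side G a b x' by move/(side_disj Gac ab).
have [e'a _] := side_cross_side Gac ab ex ex' ax nax'.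
exact: (side_disj Gac ee' ea e'a).
Qed.

(** ** Hanging pieces of a convex set *)

(** The path from z to its projection y enters Y through an edge (x, y). *)
Definition nearest Y (z y : X) := [/\ E (z, y), Y y &
  z = y \/ exists x, [/\ edges G (x, y), ~ Y x & side G x y z]].

Lemma outside_side Y x y : edge_convex G Y -> edges G (x, y) -> ~ Y x -> Y y ->
  forall z, side G x y z -> ~ Y z.
Proof.
move=> Yc xy nYx Yy z xz Yz; apply: nYx; apply: (Yc _ _ xy); first by exists z.
by exists y => //; apply: side_refl; apply/nesym; exact: (edges_neq xy).
Qed.

(** Distinct pieces that hang from a convex set are disjoint. *)
Lemma nearest_functional Y : edge_convex G Y ->
  forall z y y', nearest Y z y -> nearest Y z y' -> y = y'.
Proof.
move=> Yc z y y' [_ Yy [->|[x [xy nYx xz]]]] [_ Yy' [zy'|[x' [xy' nYx' xz']]]] => //.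
- by case: (outside_side Yc xy' nYx' Yy' xz').
- by case: (outside_side Yc xy nYx Yy xz); rewrite zy'.
- have [] := side_meet Gac xy xy' xz xz' => // s.
  + exact: (outside_side Yc xy nYx Yy s Yy').
  + exact: (outside_side Yc xy' nYx' Yy' s Yy).
Qed.

Lemma nearest_exists Y x y0 : Y y0 -> linked G y0 x -> exists y, nearest Y x y.
Proof.
move=> Yy0; move: x; apply: linked_ind; first by exists y0; split=> //; left.
move=> z z' y0z [y [zy Yy H]] zz'.
have [Yz'|nYz'] := pselect (Y z'); first by exists z'; split=> //; left.
have z'y : E (z', y) by apply: (Etrans _ zy); apply: GE; exact: edges_sym.
exists y; split=> //; right; case: H => [<-|[x [xy nYx xz]]].
  exists z'; split=> //; first exact: edges_sym.
  by apply: side_refl; apply/nesym; exact: (edges_neq zz').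
by exists x; split=> //; apply: (side_step xz zz') => e; apply: nYz'; rewrite e.
Qed.

Lemma nearest_fibre_finite Y : edge_convex G Y -> measurable Y ->
  exists2 N, null_invariant mu E N & forall y, ~ N y ->
    finw [set z | nearest Y z y] y.
Proof.
move=> Yc mY.
pose Q : set (X * X) := [set p | nearest Y p.1 p.2].
have mQ : measurable Q.
  have m1 : measurable_fun setT (@fst X X) by [].
  have m2 : measurable_fun setT (@snd X X) by [].
  apply: (@mpred_ext _ _ (fun p : X * X => E (p.1, p.2) /\ Y p.2 /\
    (p.1 = p.2 \/ exists x, E (p.2, x) /\ (edges G (x, p.2) /\ ~ Y x /\ side G x p.2 p.1)))).
    move=> [z y] /=; split=> [[zy [Yy H]]|[zy Yy H]]; split=> //.
      by case: H => [->|[x [_ [xy [nYx xz]]]]]; [left|right; exists x].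
    split=> //; case: H => [->|[x [xy nYx xz]]]; [by left|right; exists x].
    by split=> //; apply: GE; exact: edges_sym.
  apply: mpred_and; first exact: (mpred_rel (we_measurable HE)).
  apply: mpred_and; first exact: (mpred_comp m2 mY).
  apply: mpred_or; first exact: (mpred_eq HE).
  apply: (mpred_exists_class HE m2 (P := fun p x => edges G (x, p.2) /\ ~ Y x /\ side G x p.2 p.1)).
  move=> h mh; apply: mpred_and; first exact: mpred_edges.
  apply: mpred_and; first by apply: mpred_not; exact: (mpred_comp mh mY).
  exact: mpred_side.
have QE : Q `<=` E by move=> [z y] [].
have Qf z y y' : Q (z, y) -> Q (z, y') -> y = y' by exact: nearest_functional.
exact: (functional_fibre_finite HE mQ QE Qf).
Qed.

(** A point of the core outside of Y would lie in a hanging piece of Y, and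
almost all of these are finite. *)
Lemma core_sub_convex Y : edge_convex G Y -> measurable Y ->
  exists2 N, null_invariant mu E N & forall x y, ~ N x -> core_of x -> Y y ->
    linked G y x -> Y x.
Proof.
move=> Yc mY; have [N NN HN] := nearest_fibre_finite Yc mY.
exists N => // x y0 nNx [Vx cx] Yy0 y0x.
have [y [xy Yy [->//|[x' [x'y nYx' x'x]]]]] := nearest_exists Yy0 y0x.
have nNy := null_invariant_out HE NN xy nNx.
case: (cx _ _ x'y x'x); rewrite /finite_side.
apply: (finite_weight_base HE (GE x'y)); apply: (finite_weight_sub _ (HN y nNy)).
move=> z x'z; split=> //; last by right; exists x'.
exact: (Etrans (Esym (side_class x'z)) (GE x'y)).
Qed.

(** Otherwise the half-space behind a leaf of the core would be a hanging piece. *)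
Lemma core_two_neighbours : exists2 N, null_invariant mu E N &
  forall x x', ~ N x -> core_of x -> edges G (x, x') ->
    exists y, [/\ edges G (x, y), y <> x' & core_of y].
Proof.
have [N NN HN] := nearest_fibre_finite core_convex core_measurable.
exists N => // x x' nNx [Vx cx] xx'; apply: contrapT => nex.
have nxx' := edges_neq xx'.
case: (cx _ _ xx' (side_refl _ nxx')); apply: (finite_weight_sub _ (HN x nNx)).
move=> z xz; split=> //; first exact: (Esym (side_class xz)).
have [<-|/eqP zx] := eqVneq z x; [by left|right].
have [y [xy yx' yz]] := side_first xz zx.
exists y; split=> //; first exact: edges_sym.
by move=> cy; apply: nex; exists y.
Qed.

(** ** Isolated ends *)

Definition unbranched Y a b :=
  forall w, side G a b w -> Y w -> ~ ramified (induced_graph G Y) w.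

Lemma mpred_ramified d' (W : measurableType d') (g : W -> X) Y : measurable Y ->
  measurable_fun setT g -> mpred (fun w => ramified (induced_graph G Y) (g w)).
Proof.
move=> mY mg; pose GY := induced_graph G Y.
apply: (@mpred_ext _ _ (fun w => exists y1, E (g w, y1) /\ exists y2, E (g w, y2) /\
  exists y3, E (g w, y3) /\
  ((edges GY (g w, y1) /\ edges GY (g w, y2) /\ edges GY (g w, y3)) /\
   (y1 <> y2 /\ y1 <> y3 /\ y2 <> y3)))).
  move=> w; split.
    by move=> [y1 [_ [y2 [_ [y3 [_ [[? [? ?]] [? [? ?]]]]]]]]]; exists y1, y2, y3.
  move=> [y1 [y2 [y3 [[e1 e2 e3] [n1 n2 n3]]]]].
  have [g1 _] := e1; have [g2 _] := e2; have [g3 _] := e3.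
  exists y1; split; first exact: GE.
  exists y2; split; first exact: GE.
  by exists y3; split; first exact: GE.
have mYh h : measurable_fun setT h -> mpred (fun w : W => Y (h w)).
  by move=> mh; exact: (mpred_comp mh mY).
have mGY h : measurable_fun setT h -> mpred (fun w => edges GY (g w, h w)).
  move=> mh; apply: mpred_and; first exact: mpred_edges.
  by apply: mpred_and; exact: mYh.
apply: (mpred_exists_class HE mg (P := fun w y1 => exists y2, E (g w, y2) /\
  exists y3, E (g w, y3) /\ _)) => h1 m1.
apply: (mpred_exists_class HE mg (P := fun w y2 => exists y3, E (g w, y3) /\ _)) => h2 m2.
apply: (mpred_exists_class HE mg) => h3 m3.
have mneq (h k : W -> X) : measurable_fun setT h -> measurable_fun setT k ->
    mpred (fun w : W => h w <> k w).
  by move=> mh mk; apply: mpred_not; exact: (mpred_eq HE).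
apply: mpred_and.
  by apply: mpred_and; [exact: mGY|apply: mpred_and; exact: mGY].
by apply: mpred_and; [exact: mneq|apply: mpred_and; exact: mneq].
Qed.

(** An unbranched half-space of the core that starts next to a ramification point is
infinite, but can be collapsed to its starting point. *)
Lemma core_no_isolated_branch : exists2 N, null_invariant mu E N &
  forall a b, ~ N a -> core_of a -> edges G (a, b) -> core_of b ->
    ramified (induced_graph G core_of) b ->
    ~ unbranched core_of a b.
Proof.
pose Q : set (X * X) := [set p | E (p.1, p.2) /\ exists b, [/\ edges G (p.2, b), core_of b,
  ramified (induced_graph G core_of) b, unbranched core_of p.2 b & side G p.2 b p.1]].
have mQ : measurable Q.
  have m1 : measurable_fun setT (@fst X X) by [].
  have m2 : measurable_fun setT (@snd X X) by [].
  apply: (@mpred_ext _ _ (fun p : X * X => E (p.1, p.2) /\ exists b, E (p.2, b) /\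
    (edges G (p.2, b) /\ core_of b /\ ramified (induced_graph G core_of) b /\
    (forall w, E (p.2, w) ->
       (side G p.2 b w -> core_of w -> ~ ramified (induced_graph G core_of) w)) /\
    side G p.2 b p.1))).
    move=> [z a] /=; split.
      move=> [za [b [_ [ab [cb [bb [u az]]]]]]]; split=> //; exists b; split=> // w aw.
      by apply: u => //; exact: (side_class aw).
    move=> [za [b [ab cb bb u az]]]; split=> //; exists b; split; first exact: GE.
    by do ![split=> //] => w _; exact: u.
  apply: mpred_and; first exact: (mpred_rel (we_measurable HE)).
  apply: (mpred_exists_class HE m2) => h mh.
  apply: mpred_and; first exact: mpred_edges.
  apply: mpred_and; first exact: mpred_core.
  apply: mpred_and; first exact: (mpred_ramified core_measurable).
  apply: mpred_and; last exact: mpred_side.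
  apply: (mpred_forall_class HE m2) => k mk.
  apply: mpred_imp; first exact: mpred_side.
  apply: mpred_imp; first exact: mpred_core.
  by apply: mpred_not; exact: (mpred_ramified core_measurable).
have QE : Q `<=` E by move=> [z y] [].
have Qf z a a' : Q (z, a) -> Q (z, a') -> a = a'.
  move=> [_ [b [/= ab cb bb u az]]] [_ [b' [/= ab' cb' bb' u' az']]].
  have [] := side_meet Gac ab ab' az az' => // s; [exact: (u _ s cb' bb')|exact: (u' _ s cb bb)].
have [N NN HN] := functional_fibre_finite HE mQ QE Qf.
exists N => // a b nNa [Va ca] ab cb bb u.
case: (ca _ _ ab (side_refl _ (edges_neq ab))); apply: (finite_weight_sub _ (HN a nNa)).
move=> z az; split=> /=; first exact: (Esym (side_class az)).
by exists b.
Qed.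

End one_graph.
End graph_weights.

(** * Components that miss the core *)

Section coreless.
Context (R : realType) d (X : measurableType d) (c : X -> nat -> nat).
Variables (mu : probability X R) (E : set (X * X)) (f : nat -> X -> X) (rho : X * X -> R).
Hypothesis HE : weighted_equivalence c mu E f rho.

Let Exx := we_refl HE.
Let Esym := we_sym HE.
Let Etrans := we_trans HE.
Let rho0 := we_weight_gt0 HE.
Let rhoM := we_cocycle HE.
Let cX := we_code HE.

Local Notation finw := (finite_weight E rho).
Local Notation wt := (weight E rho).

Variable G : graph X.
Hypothesis Gac : acyclic G.
Hypothesis GE : edges G `<=` E.
Hypothesis mG : measurable (edges G).
Hypothesis mV : measurable (vertices G).

Local Notation core := (core_of E rho G).
Local Notation fside := (finite_side E rho G).

Definition coreless x := vertices G x /\ forall y, linked G x y -> ~ core y.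
Definition finite_component x := finw [set y | linked G x y] x.

Let linkE x y : linked G x y -> E (x, y) := @linked_class _ _ _ _ _ _ _ _ HE _ GE x y.

Lemma coreless_edge x y : coreless x -> edges G (x, y) -> coreless y.
Proof.
move=> [Vx cx] xy; split; first by have [] := edges_sub xy.
by move=> z yz; apply: cx; exact: (linked_trans (linked_edge xy) yz).
Qed.

Lemma coreless_linked x y : coreless x -> linked G x y -> coreless y.
Proof.
move=> cx; move: y; apply: linked_ind => // z z' _ cz zz'; exact: (coreless_edge cz zz').
Qed.

Lemma finite_component_linked x y : finite_component x -> linked G x y -> finite_component y.
Proof.
move=> fx xy; apply: (finite_weight_base HE (Esym (linkE xy))).
apply: (finite_weight_sub _ fx) => z /= yz; exact: (linked_trans xy yz).
Qed.

Lemma mpred_coreless d' (W : measurableType d') (g : W -> X) : measurable_fun setT g ->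
  mpred (fun w => coreless (g w)).
Proof.
move=> mg; apply: mpred_and; first exact: (mpred_comp mg mV).
apply: (@mpred_ext _ _ (fun w => forall y, E (g w, y) -> (linked G (g w) y -> ~ core y))).
  by move=> w; split=> H y; [move=> gy; apply: H (gy); exact: linkE|move=> _; exact: H].
apply: (mpred_forall_class HE mg) => h mh; apply: mpred_imp.
  exact: (mpred_linked HE GE mG).
by apply: mpred_not; exact: (mpred_core HE GE mG mV).
Qed.

Lemma mpred_finite_component d' (W : measurableType d') (g : W -> X) : measurable_fun setT g ->
  mpred (fun w => finite_component (g w)).
Proof.
move=> mg; apply: mpred_lte.
apply: (measurable_weight_sum HE (A := fun w => [set y | linked G (g w) y])) => // k mk.
exact: (mpred_linked HE GE mG).
Qed.

(** ** Finite components *)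

Definition code_lt x y := exists n, (forall m, (m < n)%N -> c x m = c y m) /\ (c x n < c y n)%N.

Lemma code_lt_trans x y z : code_lt x y -> code_lt y z -> code_lt x z.
Proof.
move=> [n [xy xyn]] [m [yz yzm]]; exists (minn n m); split=> [k|].
  by rewrite leq_min => /andP[/xy -> /yz].
case: (ltngtP n m) => [nm|mn|nm].
- by rewrite -yz.
- by rewrite xy.
- by subst m; exact: (ltn_trans xyn yzm).
Qed.

Lemma code_lt_irr x : ~ code_lt x x.
Proof. by move=> [n [_]]; rewrite ltnn. Qed.

Lemma code_lt_total x y : x <> y -> code_lt x y \/ code_lt y x.
Proof.
move=> xy; have ex : exists n, c x n != c y n.
  apply: contrapT => /forallNP H; apply: xy; apply: (code_inj cX) => n.
  by apply/eqP; apply: contrapT => /negP; exact: H.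
case: (ex_minnP ex) => n nxy nmin.
have eqm m : (m < n)%N -> c x m = c y m.
  by move=> mn; apply/eqP; apply: contraTT mn => /nmin; rewrite -leqNgt.
case: (ltngtP (c x n) (c y n)) nxy => // xyn _; [left|right]; exists n => //.
by split=> // m /eqm.
Qed.

(** A strict total order on each class, by decreasing weight; the code breaks ties. *)
Definition prefer y z := (wt z y < 1)%E \/ (wt z y <= 1)%E /\ code_lt y z.

Lemma preferE y z : E (y, z) -> prefer y z <-> rho (z, y) < 1 \/ rho (z, y) <= 1 /\ code_lt y z.
Proof. by move=> yz; rewrite /prefer /weight; case: asboolP; rewrite ?lte_fin ?lee_fin. Qed.

Lemma prefer_trans x y z : E (x, y) -> E (y, z) -> prefer x y -> prefer y z -> prefer x z.
Proof.
move=> xy yz /(preferE xy) pxy /(preferE yz) pyz; apply/(preferE (Etrans xy yz)).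
rewrite -(rhoM xy yz); have r1 := rho0 (Esym xy); have r2 := rho0 (Esym yz).
case: pxy => [pxy|[pxy lxy]]; case: pyz => [pyz|[pyz lyz]].
- by left; rewrite mulr_ilt1// ltW.
- by left; nra.
- by left; nra.
- by right; split; [nra|exact: (code_lt_trans lxy lyz)].
Qed.

Lemma prefer_total x y : E (x, y) -> x <> y -> prefer x y \/ prefer y x.
Proof.
move=> xy nxy; rewrite (preferE xy) (preferE (Esym xy)).
have := rhoM xy (Esym xy); rewrite (rho_refl HE) => r1.
have r2 := rho0 (Esym xy); have r3 := rho0 xy.
have [r4|r4|r4] := ltgtP (rho (y, x)) 1; [by left; left| |].
  by right; left; nra.
have r5 : rho (x, y) = 1 by rewrite r4 mulr1 in r1.
by have [l|l] := code_lt_total nxy; [left|right]; right; rewrite ?r4 ?r5.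
Qed.

Lemma prefer_irr x : ~ prefer x x.
Proof.
by move=> /(preferE (Exx x)); rewrite (rho_refl HE) ltxx => -[//|[_ /code_lt_irr]].
Qed.

Lemma mpred_code_lt d' (W : measurableType d') (g h : W -> X) : measurable_fun setT g ->
  measurable_fun setT h -> mpred (fun w => code_lt (g w) (h w)).
Proof.
move=> mg mh; apply: mpred_exists => n; apply: mpred_and.
  apply: mpred_forall => m; apply: mpred_imp; first exact: mpred_cst.
  apply: (@mpred_ext _ _ (fun w => exists k, c (g w) m = k /\ c (h w) m = k)).
    by move=> w; split=> [[k [-> ->]]|->]; last by exists (c (h w) m).
  by apply: mpred_exists => k; apply: mpred_and; exact: (mpred_code cX m (fun v => v = k)).
apply: (@mpred_ext _ _ (fun w => exists k, c (g w) n = k /\ (k < c (h w) n)%N)).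
  by move=> w; split=> [[k [<-]]|]; last by exists (c (g w) n).
apply: mpred_exists => k; apply: mpred_and; first exact: (mpred_code cX n (fun v => v = k)).
exact: (mpred_code cX n (fun v => (k < v)%N)).
Qed.

Definition preferred y := [/\ coreless y, finite_component y &
  forall z, linked G y z -> z = y \/ prefer y z].

Lemma preferred_measurable : measurable preferred.
Proof.
have mid : measurable_fun setT (@id X) by exact: measurable_id.
apply: (@mpred_ext _ _ (fun y => coreless y /\ finite_component y /\
    forall z, E (y, z) -> (linked G y z -> z = y \/ prefer y z))).
  move=> y; split=> [[? [? H]]|[? ? H]]; last by do ![split=> //] => z _; exact: H.
  by split=> // z yz; apply: H (yz); exact: linkE.
apply: mpred_and; first exact: (mpred_coreless (g := id)).
apply: mpred_and; first exact: (mpred_finite_component (g := id)).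
apply: (mpred_forall_class HE mid (P := fun y z => linked G y z -> z = y \/ prefer y z)) => h mh.
apply: mpred_imp; first exact: (mpred_linked HE GE mG).
apply: mpred_or; first exact: (mpred_eq HE).
have mw : measurable_fun setT (fun w => wt (h w) w) by exact: (measurable_weight HE).
apply: mpred_or; first exact: mpred_lte.
by apply: mpred_and; [exact: mpred_lee|exact: mpred_code_lt].
Qed.

Lemma preferred_unique y y' : preferred y -> preferred y' -> linked G y y' -> y = y'.
Proof.
move=> [_ _ py] [_ _ py'] yy'; apply: contrapT => nyy'.
have [e|p1] := py y' yy'; first exact: nyy'.
have [//|p2] := py' y (linked_sym yy').
have Eyy' := linkE yy'.
exact: (@prefer_irr y (prefer_trans Eyy' (Esym Eyy') p1 p2)).
Qed.

(** In a finite component only finitely many points are at least as heavy as a given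
one, and the order on the class has a least element among these. *)
Lemma preferred_exists x : coreless x -> finite_component x ->
  exists2 y, preferred y & linked G x y.
Proof.
move=> cx fx.
have := esum_superlevel (fun y => weight_ge0 HE y x) fx (ltr01 : 0 < 1 :> R).
move=> /finite_seqP[s sE].
have inF z : z \in s <-> linked G x z /\ (1 <= wt z x)%E.
  have : [set` s] z <-> [set i | linked G x i /\ (1 <= wt i x)%E] z by rewrite -sE.
  by rewrite /=.
have xs : x \in s.
  apply/inF; split; first exact: linked_refl.
  by rewrite /weight; case: asboolP => // _; rewrite (rho_refl HE).
have [y ys yb] : exists2 y, y \in s & forall z, z \in s -> z = y \/ prefer y z.
  have sx z : z \in s -> linked G x z by move=> /inF[].
  have s0 : s != [::] by case: (s) xs.
  move: s0 sx; elim: (s) => // a t IH _ sx.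
  have sa : linked G x a by apply: sx; exact: mem_head.
  have [->|t0] := eqVneq t [::].
    by exists a; rewrite ?mem_head// => z; rewrite inE => /eqP; left.
  have sxt z : z \in t -> linked G x z by move=> zt; apply: sx; rewrite inE zt orbT.
  have [y yt yb] := IH t0 sxt.
  have Eya : E (y, a) := Etrans (Esym (linkE (sxt y yt))) (linkE sa).
  have [ay|nay] := pselect (a = y).
    exists y; first by rewrite inE yt orbT.
    by move=> z; rewrite inE => /predU1P[->|/yb//]; left.
  have [pya|pay] := prefer_total Eya (nesym nay).
    exists y; first by rewrite inE yt orbT.
    by move=> z; rewrite inE => /predU1P[->|/yb//]; right.
  exists a; first by rewrite mem_head.
  move=> z; rewrite inE => /predU1P[->|zt]; [by left|right].
  have [->//|pyz] := yb z zt.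
  apply: (prefer_trans (Esym Eya) _ pay pyz).
  exact: (Etrans (Esym (linkE (sxt y yt))) (linkE (sxt z zt))).
have /inF[xy y1] := ys; exists y => //; split.
- exact: (coreless_linked cx xy).
- exact: (finite_component_linked fx xy).
- move=> z yz; have xz := linked_trans xy yz.
  have [/yb//|/negP nzs] := boolP (z \in s); right; left.
  have zx : (wt z x < 1)%E by rewrite ltNge; apply/negP => z1; apply: nzs; apply/inF.
  move: y1 zx; have Exy := linkE xy; have Exz := linkE xz; have Eyz := linkE yz.
  rewrite /weight; case: asboolP => // _; case: asboolP => // _; case: asboolP => // _.
  rewrite lee_fin !lte_fin -(rhoM Exy Eyz) => y1 zx.
  have r1 := rho0 (Esym Eyz); nra.
Qed.

(** ** Infinite components *)

Definition wandering x := coreless x /\ ~ finite_component x.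

Lemma wandering_linked x y : wandering x -> linked G x y -> wandering y.
Proof.
move=> [cx fx] xy; split; first exact: (coreless_linked cx xy).
by move=> fy; apply: fx; exact: (finite_component_linked fy (linked_sym xy)).
Qed.

(** The half-space behind w, in the direction of b, shrinks as w moves away from b. *)
Lemma side_toward a b w : edges G (a, b) -> side G a b w ->
  exists2 y, edges G (w, y) & side G w y `<=` side G a b.
Proof.
move=> ab aw; have [wa|/eqP wa] := eqVneq w a; first by exists b; rewrite wa.
have [y [wy yb ya]] := side_first (side_sym aw) (nesym wa).
exists y => //.
have yb' : side G y w b by apply: (side_step ya ab); apply/nesym; exact: (side_neq aw).
apply: side_ind => // z z' wz az zz' z'y; apply: (side_step az zz') => z'b.
apply: (side_disj Gac (edges_sym wy) yb').
by rewrite -z'b; exact: (side_step wz zz' z'y).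
Qed.

(** In a wandering component each x has exactly one neighbour in the direction of
which the half-space behind is finite. *)
Definition fwd x y := [/\ edges G (x, y), wandering x & fside x y].

Lemma fwd_edge x y : fwd x y -> edges G (x, y). Proof. by case. Qed.

Lemma fwdE x y : fwd x y -> E (x, y). Proof. by case=> /GE. Qed.

Lemma fwd_exists x : wandering x -> exists y, fwd x y.
Proof.
move=> wx; have [[Vx cx] _] := wx.
have : ~ core x by apply: cx; exact: linked_refl.
move=> /not_andP[//|/existsNP[a /existsNP[b /not_implyP[ab /not_implyP[ax /contrapT fab]]]]].
have [y xy sub] := side_toward ab ax; exists y; split=> //.
apply: (finite_weight_sub sub).
by apply: (finite_weight_base HE) fab; apply: Esym; exact: (side_class HE GE ax).
Qed.

Lemma finite_sides_component x (A B : set X) : finw A x -> finw B x ->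
  (forall z, linked G x z -> A z \/ B z) -> finite_component x.
Proof. by move=> fA fB AB; exact: (finite_weight_sub AB (finite_weightU HE fA fB)). Qed.

(** Two finite half-spaces in different directions would cover the component. *)
Lemma fwd_functional x y y' : fwd x y -> fwd x y' -> y = y'.
Proof.
move=> [xy [_ nf] fy] [xy' _ fy']; apply: contrapT => yy'; apply: nf.
apply: (finite_sides_component fy fy') => z xz.
have [?|yz] := side_cover xy xz; [by left|right].
by apply: (side_nest Gac xy' xy) yz; exact: nesym.
Qed.

Lemma fwd_asym x y : fwd x y -> ~ fwd y x.
Proof.
move=> [xy [_ nf] fx] [_ _ fy]; apply: nf.
apply: (finite_sides_component fx (finite_weight_base HE (GE xy) fy)) => z xz.
exact: side_cover.
Qed.

Lemma fwd_total x y : wandering x -> edges G (x, y) -> fwd x y \/ fwd y x.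
Proof.
move=> wx xy; have [y0 xy0] := fwd_exists wx.
have [->|/eqP yy0] := eqVneq y y0; [by left|right; split].
- exact: edges_sym.
- exact: (wandering_linked wx (linked_edge xy)).
- have [e0 _ f0] := xy0; apply: (finite_weight_base HE (Esym (GE xy))).
  by apply: (finite_weight_sub _ f0); apply: (side_nest Gac e0 xy); exact: nesym.
Qed.

Lemma steps_functional n x y y' : steps fwd n x y -> steps fwd n x y' -> y = y'.
Proof.
elim: n y y' => [y y' <-//|n IH y y' [z xz zy] [z' xz' zy']].
by apply: (fwd_functional zy); rewrite (IH _ _ xz xz').
Qed.

Lemma steps_side n x y w : fwd x y -> steps fwd n y w -> side G y x w.
Proof.
move=> xy; have exy := fwd_edge xy.
elim: n w => [w <-|n IH w [z /IH yz zw]].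
  by apply: side_refl; apply/nesym; exact: (edges_neq exy).
apply: (side_step yz (fwd_edge zw)) => wx.
have zx : edges G (z, x) by rewrite -wx; exact: fwd_edge.
have zy := side_exit Gac (edges_sym exy) yz zx.
by apply: (fwd_asym xy); rewrite -{1}zy -wx.
Qed.

Lemma steps_irr n x : ~ steps fwd n.+1 x x.
Proof. by move=> /stepsSr[y xy yx]; exact: (side_neq (steps_side xy yx)). Qed.

Lemma steps_split m n x y z : (m <= n)%N -> steps fwd m x y -> steps fwd n x z ->
  steps fwd (n - m) y z.
Proof.
move=> mn xy; rewrite -{1}(subnKC mn); elim: (n - m)%N z => [|k IH] z.
  by rewrite addn0 => /(steps_functional xy).
by rewrite addnS => -[w /IH yw wz]; exists w.
Qed.

Lemma steps_inj m n x y : steps fwd m x y -> steps fwd n x y -> m = n.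
Proof.
move=> xm xn; case: (ltngtP m n) => // h; exfalso.
- by have := steps_split (ltnW h) xm xn; rewrite -(subnSK h) => /steps_irr.
- by have := steps_split (ltnW h) xn xm; rewrite -(subnSK h) => /steps_irr.
Qed.

Definition past k x : set X := [set z | exists2 j, (k <= j)%N & steps fwd j z x].

Lemma past_side k x y : fwd x y -> past k x `<=` side G x y.
Proof.
move=> xy z [j _]; elim: j z => [z ->|j IH z /stepsSr[z' zz' z'x]].
  by apply: side_refl; exact: (edges_neq (fwd_edge xy)).
apply: (side_step (IH z' z'x) (edges_sym (fwd_edge zz'))) => zy.
apply: (@steps_irr j.+1 x); apply/stepsSr; exists y => //; apply/stepsSr.
by exists z' => //; rewrite -zy.
Qed.

Lemma past_finite k x : wandering x -> finw (past k x) x.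
Proof.
move=> /fwd_exists[y xy]; have [_ _ fx] := xy.
exact: (finite_weight_sub (past_side xy) fx).
Qed.

Lemma past_le k k' x : (k <= k')%N -> past k' x `<=` past k x.
Proof. by move=> kk' z [j kj zx]; exists j => //; exact: (leq_trans kk' kj). Qed.

Lemma past_vanishes x (e : R) : wandering x -> 0 < e ->
  exists k, (\esum_(z in past k x) wt z x <= e%:E)%E.
Proof.
move=> wx e0.
have [F /finite_seqP[s ->] Fe] := esum_tail (fun z => weight_ge0 HE z x) (past_finite 0 wx) e0.
have /choice[dep Hdep] : forall z, exists n, forall j, steps fwd j z x -> j = n.
  move=> z; have [[n zx]|/forallNP no] := pselect (exists n, steps fwd n z x).
    by exists n => j /steps_inj; exact.
  by exists 0%N => j /no.
exists (\max_(z <- s) dep z).+1; apply: (le_trans _ Fe); apply: esum_subset.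
move=> z zx; split; first exact: (past_le (leq0n _) zx).
move=> /= zs; have [j kj /Hdep jz] := zx; move: kj; rewrite jz.
by rewrite ltnNge leq_bigmax_seq.
Qed.

(** Late points bring little mass to x, while the points that are not late arrive at x
at bounded ages only. *)
Definition late (e : R) : set (X * X) := [set p | E p /\
  exists2 k, steps fwd k p.1 p.2 & (\esum_(z in past k p.2) wt z p.2 <= e%:E)%E].

Lemma mpred_wandering d' (W : measurableType d') (g : W -> X) : measurable_fun setT g ->
  mpred (fun w => wandering (g w)).
Proof.
move=> mg; apply: mpred_and; first exact: mpred_coreless.
by apply: mpred_not; exact: mpred_finite_component.
Qed.

Lemma mpred_fwd d' (W : measurableType d') (g h : W -> X) : measurable_fun setT g ->
  measurable_fun setT h -> mpred (fun w => fwd (g w) (h w)).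
Proof.
move=> mg mh; apply: (@mpred_ext _ _ (fun w => edges G (g w, h w) /\ wandering (g w) /\
    fside (g w) (h w))).
  by move=> w; split=> [[? [? ?]]|[]].
apply: mpred_and; first exact: (mpred_edges mG).
apply: mpred_and; first exact: mpred_wandering.
exact: (mpred_finite_side HE GE mG).
Qed.

Lemma mpred_fwd_steps n d' (W : measurableType d') (g h : W -> X) : measurable_fun setT g ->
  measurable_fun setT h -> mpred (fun w => steps fwd n (g w) (h w)).
Proof.
apply: (mpred_steps HE (S := fun _ => fwd)) => [_ x y|u v]; [exact: fwdE|exact: mpred_fwd].
Qed.

Lemma mpred_late e d' (W : measurableType d') (g h : W -> X) : measurable_fun setT g ->
  measurable_fun setT h -> mpred (fun w => late e (g w, h w)).
Proof.
move=> mg mh; apply: (@mpred_ext _ _ (fun w => E (g w, h w) /\ exists k,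
    steps fwd k (g w) (h w) /\ (\esum_(z in past k (h w)) wt z (h w) <= e%:E)%E)).
  by move=> w; split=> -[? [k]]; [move=> [? ?]|move=> ? ?]; split=> //; exists k.
apply: mpred_and; first exact: (mpred_rel (we_measurable HE)).
apply: mpred_exists => k; apply: mpred_and; first exact: mpred_fwd_steps.
apply: mpred_lee; apply: (measurable_weight_sum HE (A := fun w => past k (h w))) => // u mu_.
apply: (@mpred_ext _ _ (fun w => exists j, (k <= j)%N /\ steps fwd j (u w) (h w))).
  by move=> w; split=> -[j]; [move=> [? ?]|move=> ? ?]; exists j.
apply: mpred_exists => j; apply: mpred_and; first exact: mpred_cst.
exact: mpred_fwd_steps.
Qed.

(** A point x receives at most e: if k is least with the past of age at least k
smaller than e, then only this past sends mass to x. *)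
Lemma late_measure e : 0 <= e -> (mu [set z | exists x, E (z, x) /\ late e (z, x)] <= e%:E)%E.
Proof.
move=> e0; apply: (senders_measure HE) => //.
- have := mpred_late e (g := @fst X X) (h := @snd X X) _ _.
  by move=> /(_ measurable_fst measurable_snd); apply: mpred_ext => -[].
- by move=> p [].
move=> x; have [ex|no] := pselect (exists k, (\esum_(z in past k x) wt z x <= e%:E)%E).
  have ex' : exists k, `[< (\esum_(z in past k x) wt z x <= e%:E)%E >].
    by case: ex => k ke; exists k; exact/asboolP.
  case: (ex_minnP ex') => k /asboolP ke kmin; apply: (le_trans _ ke).
  apply: esum_subset => z [_ [j /= zx je]]; exists j => //.
  by apply: kmin; exact/asboolP.
rewrite (_ : [set z | _] = set0) ?esum_set0 ?lee_fin// -subset0 => z [_ [k _ ke]].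
by apply: no; exists k.
Qed.

Definition early n z := wandering z /\ forall x, E (z, x) -> ~ late (n.+1%:R^-1) (z, x).

Lemma almost_all_early : exists2 N, null_invariant mu E N &
  forall z, ~ N z -> wandering z -> exists n, early n z.
Proof.
pose B n : set X := [set z | exists x, E (z, x) /\ late (n.+1%:R^-1) (z, x)].
have mB n : measurable (B n).
  apply: (mpred_exists_class HE (g := id) (P := fun z x => late (n.+1%:R^-1) (z, x))).
    exact: measurable_id.
  by move=> h mh; apply: mpred_late => //; exact: measurable_id.
have B0 : mu.-negligible (\bigcap_n B n).
  apply/negligibleP; first exact: bigcapT_measurable.
  apply/eqP; rewrite eq_le measure_ge0 andbT; apply/lee_addgt0Pr => e e0.
  rewrite add0e.
  have [n ne] : exists n, n.+1%:R^-1 <= e.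
    exists (Num.truncn e^-1); rewrite -[leRHS]invrK lef_pV2 ?posrE ?invr_gt0//.
    exact/ltW/truncnS_gt.
  apply: (@le_trans _ _ (mu (B n))).
    by apply: le_measure; rewrite ?inE//; [exact: bigcapT_measurable|exact: bigcap_inf].
  apply: (@le_trans _ _ (n.+1%:R^-1)%:E); last by rewrite lee_fin.
  by apply: late_measure; rewrite invr_ge0.
have [N NN BN] := negligible_invariant HE B0.
exists N => // z nNz wz; apply: contrapT => /forallNP ne; apply/nNz/BN => n _.
have /not_andP[//|/existsNP[x /not_implyP[zx /contrapT lzx]]] := ne n.
by exists x.
Qed.

(** With the least level n, the choice of n depends on the component only. *)
Definition trunk y := wandering y /\ exists n,
  (forall m, (m < n)%N -> forall z, linked G y z -> ~ early m z) /\
  exists z, [/\ linked G y z, early n z & exists k, steps fwd k z y].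

Lemma trunk_fwd y y' : trunk y -> fwd y y' -> trunk y'.
Proof.
move=> [wy [n [nm [z [yz ez [k zy]]]]]] yy'.
have l := linked_edge (fwd_edge yy').
split; first exact: (wandering_linked wy l).
exists n; split; first by move=> m mn w y'w; apply: (nm m mn); exact: (linked_trans l y'w).
exists z; split=> //; first exact: (linked_trans (linked_sym l) yz).
by exists k.+1, y.
Qed.

Lemma trunk_exists x n : wandering x -> early n x -> exists2 y, trunk y & linked G x y.
Proof.
move=> wx ex.
have ex' : exists n, `[< exists2 z, linked G x z & early n z >].
  by exists n; apply/asboolP; exists x => //; exact: linked_refl.
case: (ex_minnP ex') => {ex}n /asboolP[z xz ez] nmin; exists z => //; split; first by case: ez.
exists n; split.
  move=> m mn w zw ew; move: mn; rewrite ltnNge => /negP; apply; apply: nmin.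
  by apply/asboolP; exists w => //; exact: (linked_trans xz zw).
by exists z; split=> //; [exact: linked_refl|exists 0%N].
Qed.

(** Along a backward ray the early points would reach its origin at arbitrarily
high ages, at which the past of the origin is too small. *)
Lemma trunk_no_backward (r : nat -> X) : (forall i, trunk (r i)) ->
  ~ forall i, fwd (r i.+1) (r i).
Proof.
move=> tr br.
have lr i : linked G (r 0%N) (r i).
  elim: i => [|i IH]; first exact: linked_refl.
  by apply: (linked_trans IH); apply: linked_edge; apply: edges_sym; exact: fwd_edge.
have st i : steps fwd i (r i) (r 0%N).
  by elim: i => // i IH; apply/stepsSr; exists (r i).
have [w0 [n [nmin [z0 [rz0 ez0 _]]]]] := tr 0%N.
have e0 : 0 < n.+1%:R^-1 :> R by rewrite invr_gt0.
have [k ke] := past_vanishes w0 e0.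
have [_ [n' [n'min [z [rz ez [j zr]]]]]] := tr k.
have nn' : n' = n.
  case: (ltngtP n' n) => // h; exfalso.
    by apply: (nmin _ h z) ez; exact: (linked_trans (lr k) rz).
  by apply: (n'min _ h z0) ez0; exact: (linked_trans (linked_sym (lr k)) rz0).
rewrite nn' in ez; have [_ /(_ (r 0%N))] := ez; apply.
  by apply: Esym; apply: linkE; exact: (linked_trans (lr k) rz).
split; first by apply: Esym; apply: linkE; exact: (linked_trans (lr k) rz).
exists (j + k)%N; first exact: (steps_add zr (st k)).
apply: (le_trans _ ke); apply: esum_subset; apply: past_le; exact: leq_addl.
Qed.

Lemma trunk_measurable : measurable trunk.
Proof.
have mid : measurable_fun setT (@id X) by exact: measurable_id.
have mearly n d' (W : measurableType d') (g : W -> X) : measurable_fun setT g ->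
    mpred (fun w => early n (g w)).
  move=> mg; apply: mpred_and; first exact: mpred_wandering.
  apply: (mpred_forall_class HE mg (P := fun w x => ~ late (n.+1%:R^-1) (g w, x))) => h mh.
  by apply: mpred_not; exact: mpred_late.
apply: (@mpred_ext _ _ (fun y => wandering y /\ exists n,
  (forall m, (m < n)%N -> forall z, E (y, z) -> (linked G y z -> ~ early m z)) /\
  exists z, E (y, z) /\ (linked G y z /\ early n z /\ exists k, steps fwd k z y))).
  move=> y; split.
    move=> [wy [n [nm [z [_ [yz [ez zy]]]]]]]; split=> //; exists n; split; last by exists z.
    by move=> m mn z' yz'; apply: (nm m mn) (yz'); exact: linkE.
  move=> [wy [n [nm [z [yz ez zy]]]]]; split=> //; exists n; split.
    by move=> m mn z' _; exact: nm.
  by exists z; split; first exact: linkE.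
apply: mpred_and; first exact: (mpred_wandering mid).
apply: mpred_exists => n; apply: mpred_and.
  apply: mpred_forall => m; apply: mpred_imp; first exact: mpred_cst.
  apply: (mpred_forall_class HE mid (P := fun y z => linked G y z -> ~ early m z)) => h mh.
  apply: mpred_imp; first exact: (mpred_linked HE GE mG).
  by apply: mpred_not; exact: mearly.
apply: (mpred_exists_class HE mid
  (P := fun y z => linked G y z /\ early n z /\ exists k, steps fwd k z y)) => h mh.
apply: mpred_and; first exact: (mpred_linked HE GE mG).
apply: mpred_and; first exact: mearly.
by apply: mpred_exists => k; exact: mpred_fwd_steps.
Qed.

(** A ray that goes backward once goes backward for ever. *)
Lemma fwd_ray (r : nat -> X) : ray G r -> (forall i, trunk (r i)) ->
  forall i, fwd (r i) (r i.+1).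
Proof.
move=> rr tr i; have [_ re] := rr.
have wr j : wandering (r j) by have [] := tr j.
have [//|b] := fwd_total (wr i) (re i); exfalso.
have br k : fwd (r (i + k).+1) (r (i + k)%N).
  elim: k => [|k IH]; first by rewrite addn0.
  rewrite addnS; have [h|//] := fwd_total (wr (i + k).+1) (re (i + k).+1).
  by case: (ray_nonbacktracking (n := i + k) rr); exact: (fwd_functional h IH).
by apply: (trunk_no_backward (r := fun k => r (i + k)%N)) => k //; rewrite addnS.
Qed.

Lemma steps_merge x y : wandering x -> linked G x y ->
  exists i j w, steps fwd i x w /\ steps fwd j y w.
Proof.
move=> wx; move: y; apply: linked_ind => [|y y' xy [i [j [w [xw yw]]]] yy'].
  by exists 0%N, 0%N, x.
have [h|h] := fwd_total (wandering_linked wx xy) yy'; last first.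
  by exists i, j.+1, w; split=> //; apply/stepsSr; exists y.
case: j yw => [yw|j /stepsSr[z yz zw]].
  by exists i.+1, 0%N, y'; split=> //; exists y => //; rewrite yw.
by exists i, j, w; split=> //; rewrite (fwd_functional h yz).
Qed.

Lemma trunk_rays_cotail (r r' : nat -> X) : ray G r -> ray G r' ->
  (forall i, trunk (r i)) -> (forall i, trunk (r' i)) -> linked G (r 0%N) (r' 0%N) ->
  cotail r r'.
Proof.
move=> rr rr' tr tr' l.
have st s : ray G s -> (forall i, trunk (s i)) -> forall i, steps fwd i (s 0%N) (s i).
  by move=> rs ts; elim=> // i IH; exists (s i) => //; exact: fwd_ray.
have [w0 _] := tr 0%N; have [i [j [w [iw jw]]]] := steps_merge w0 l.
exists i, j => k; elim: k => [|k IH].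
  rewrite !addn0 -(steps_functional iw (st _ rr tr i)).
  exact: steps_functional jw (st _ rr' tr' j).
rewrite !addnS; apply: (fwd_functional (fwd_ray rr tr (i + k)%N)).
by rewrite IH; exact: fwd_ray.
Qed.

Lemma trunk_cross n a b y m : edges G (a, b) -> trunk y -> side G a b y ->
  steps fwd n y m -> ~ side G a b m -> trunk a /\ trunk b.
Proof.
move=> ab; elim: n y => [y _ ay <- //|n IH y ty ay /stepsSr[z yz zm] nam].
have tz := trunk_fwd ty yz.
have [az|[<- <-]//] := side_stepE Gac ab ay (fwd_edge yz).
exact: IH tz az zm nam.
Qed.

Lemma trunk_convex a b y y' : edges G (a, b) -> trunk y -> trunk y' ->
  side G a b y -> side G b a y' -> trunk a.
Proof.
move=> ab ty ty' ay by'; have [wy _] := ty.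
have yy' : linked G y y'.
  apply: (linked_trans (linked_sym (side_linked ay))).
  exact: (linked_trans (linked_edge ab) (side_linked by')).
have [i [j [m [ym y'm]]]] := steps_merge wy yy'.
have [am|nam] := pselect (side G a b m); last by have [] := trunk_cross ab ty ay ym nam.
by have [] := trunk_cross (edges_sym ab) ty' by' y'm (side_disj Gac ab am).
Qed.

(** Where the core is empty, a point can be chosen in each finite component, and in
each infinite component the trunk has one end. *)
Theorem coreless_section : exists2 N, null_invariant mu E N & exists Y : set X,
  [/\ measurable Y, Y `<=` vertices G, edge_convex G Y,
      forall r r', ray G r -> ray G r' -> (forall n, Y (r n)) -> (forall n, Y (r' n)) ->
        linked G (r 0%N) (r' 0%N) -> cotail r r' &
      forall x, ~ N x -> coreless x -> exists2 y, Y y & linked G x y].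
Proof.
have [N NN HN] := almost_all_early; exists N => //.
exists (preferred `|` trunk); split.
- by apply: measurableU; [exact: preferred_measurable|exact: trunk_measurable].
- by move=> x [[[]]|[[[]]]].
- move=> a b ab [y Yy ay] [y' Yy' by'].
  have yy' : linked G y y'.
    apply: (linked_trans (linked_sym (side_linked ay))).
    exact: (linked_trans (linked_edge ab) (side_linked by')).
  case: Yy => [py|ty]; case: Yy' => [py'|ty'].
  + by case: (side_disj Gac ab ay); rewrite (preferred_unique py py' yy').
  + have [_ fy _] := py; have [[_ nf] _] := ty'.
    by case: nf; exact: (finite_component_linked fy).
  + have [_ fy _] := py'; have [[_ nf] _] := ty.
    by case: nf; exact: (finite_component_linked fy (linked_sym yy')).
  + by right; exact: (trunk_convex ab ty ty' ay by').
- have H s : ray G s -> (forall n, (preferred `|` trunk) (s n)) -> forall n, trunk (s n).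
    move=> [sinj se] Ys n; case: (Ys n) => // ps; have l := linked_edge (se n).
    case: (Ys n.+1) => [ps'|ts'].
      by have /sinj := preferred_unique ps ps' l; lia.
    have [_ fy _] := ps; have [[_ nf] _] := ts'.
    by case: nf; exact: (finite_component_linked fy l).
  by move=> r r' rr rr' Yr Yr'; apply: trunk_rays_cotail => //; exact: H.
- move=> x nNx cx; have [fx|nfx] := pselect (finite_component x).
    by have [y py xy] := preferred_exists cx fx; exists y => //; left.
  have wx : wandering x by split.
  have [n ex] := HN x nNx wx; have [y ty xy] := trunk_exists wx ex.
  by exists y => //; right.
Qed.

End coreless.

(** * Ends of trees *)

Section ends.
Context (X : choiceType) (T : graph X).
Hypothesis Tac : acyclic T.

Lemma edge_vertexr x y : edges T (x, y) -> vertices T y.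
Proof. by move=> /edges_sub[]. Qed.

Lemma component_linked x y : vertices T x -> linked T x y -> component T x y.
Proof.
move=> Vx xy; split=> //=; move: y xy; apply: linked_ind => // z z' _ _.
exact: edge_vertexr.
Qed.

Lemma ray_linked (r : nat -> X) n : ray T r -> linked T (r 0%N) (r n).
Proof.
move=> [_ re]; elim: n => [|n IH]; first exact: linked_refl.
exact: (linked_trans IH (linked_edge (re n))).
Qed.

(** Neighbourhoods are given by finitely many half-spaces, the subbase. *)
Lemma end_nbhs (xi : end_space T) (V : set (end_space T)) : nbhs xi V ->
  exists s : seq (set X), [/\ forall U, U \in s -> half_space T U,
    forall U, U \in s -> ends_in T U xi &
    forall eta, (forall U, U \in s -> ends_in T U eta) -> V eta].
Proof.
rewrite nbhsE => -[B [Bo Bxi] BV].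
have [D Dsub BE] := Bo.
move: Bxi; rewrite -BE => -[F DF Fxi].
have [A AT AF] := Dsub _ DF.
exists (finmap.enum_fset A); split.
- by move=> U /AT/set_mem.
- move=> U UA; have : F xi := Fxi; rewrite -AF => h; exact: h.
- move=> eta H; have Feta : F eta by rewrite -AF => U UA; exact: H.
  by apply: BV; rewrite -BE; exact: (ex_intro2 _ _ F DF Feta).
Qed.

Lemma ray_side_nest (r : nat -> X) m n : ray T r -> (m <= n)%N ->
  side T (r n.+1) (r n) `<=` side T (r m.+1) (r m).
Proof.
move=> rr /subnKC <-; have [_ re] := rr; elim: (n - m)%N => [|k IH]; first by rewrite addn0.
rewrite addnS; apply: (subset_trans _ IH).
apply: (side_nest Tac (edges_sym (re _)) (re _)); apply/nesym.
exact: (@ray_nonbacktracking _ _ r (m + k)%N rr).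
Qed.

(** The half-spaces cut off by the edges of a ray leave every point behind. *)
Lemma ray_escapes (r : nat -> X) z : ray T r -> linked T (r 0%N) z ->
  exists n, forall m, (n <= m)%N -> ~ side T (r m.+1) (r m) z.
Proof.
move=> rr /linked_steps[n rz]; exists n; have [_ re] := rr.
suff H : ~ side T (r n.+1) (r n) z.
  by move=> m nm /(ray_side_nest rr nm).
elim: n z rz => [z <- /side_neq//|n IH z [w /IH rw wz] rz].
have [/(ray_side_nest rr (leqnSn n))//|[_ wr]] :=
  side_stepE Tac (edges_sym (re n.+1)) rz (edges_sym wz).
apply: rw; rewrite wr; apply: side_refl; apply/nesym; exact: (edges_neq (re n)).
Qed.

(** Near an isolated end the tree does not ramify: a side branch could be
prolonged to a ray towards another end. *)
Lemma isolated_unramified x xi : vertices T x ->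
  (forall y, linked T x y -> ~ leaf T y) ->
  isolated (ends_in T (component T x) : set (end_space T)) xi ->
  exists r n, [/\ ray T r, linked T x (r 0%N) &
    forall w, side T (r n.+1) (r n) w -> ~ ramified T w].
Proof.
move=> Vx nl [/set_mem[r [rr rC xiE]] [V Vxi VE]].
have [s [sT sxi sV]] := end_nbhs Vxi.
have lr n : linked T x (r n) by have [] := rC (r n) (ex_intro2 _ _ n Logic.I erefl).
have [_ re] := rr.
have [n Hn] : exists n, forall U, U \in s -> side T (r n.+1) (r n) `<=` U.
  have H U : U \in s -> exists n, forall m, (n <= m)%N -> side T (r m.+1) (r m) `<=` U.
    move=> Us; have /(half_spaceP Tac)[a [b [ab UE]]] := sT U Us.
    have [r' [rr' r'U r'xi]] := sxi U Us.
    have [m1 [m2 tl]] : cotail r r' by apply: (end_of_cotail rr'); rewrite -r'xi.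
    have rU k : (m1 <= k)%N -> U (r k) by move=> /subnKC <-; rewrite tl; apply: r'U; eexists.
    have lb : linked T (r 0%N) b.
      have := rU m1 (leqnn _); rewrite UE => /side_linked/linked_sym h.
      by apply: (linked_trans _ (linked_edge ab)); apply: (linked_trans _ h); exact: ray_linked.
    have [n2 esc] := ray_escapes rr lb.
    exists (maxn m1 n2) => m; rewrite geq_max => /andP[m1m n2m].
    have := rU m.+1 (leq_trans m1m (leqnSn m)); rewrite UE => am.
    apply: side_ind => // z z' mz az zz' z'm; apply: (side_step az zz') => z'b.
    by apply: (esc m n2m); rewrite -z'b; exact: (side_step mz zz' z'm).
  clear sT sxi sV; elim: (s) H => [_|U t IH H]; first by exists 0%N.
  have [|n1 Hn1] := IH; first by move=> U' U't; apply: H; rewrite inE U't orbT.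
  have [n2 Hn2] := H U (mem_head _ _).
  exists (maxn n1 n2) => U'; rewrite inE => /predU1P[->|/Hn1 sub].
    by apply: Hn2; rewrite leq_maxr.
  by apply: (subset_trans _ sub); apply: ray_side_nest => //; rewrite leq_maxl.
exists r, n; split=> // w nw [y1 [y2 [y3 [[e1 e2 e3] [n12 n13 n23]]]]].
have lw : linked T x w by apply: (linked_trans (lr n.+1)); exact: (side_linked nw).
have uniq y y' z : edges T (w, y) -> edges T (w, y') -> side T y w z -> side T y' w z -> y = y'.
  move=> wy wy' yz y'z; apply: (side_inj Tac wy wy').
  exact: (side_trans yz (side_sym y'z)).
(* Of the three neighbours of w, one leads back to r n and at most one other leads
   towards the end of r; a third one starts a ray that avoids both. *)
have [y [wy ny1 ny2]] : exists y, [/\ edges T (w, y), ~ side T y w (r n) &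
    ~ exists K, forall k, (K <= k)%N -> side T y w (r k)].
  pose A y := side T y w (r n).
  pose B y := exists K, forall k, (K <= k)%N -> side T y w (r k).
  have AU y y' : edges T (w, y) -> edges T (w, y') -> A y -> A y' -> y = y'.
    by move=> ? ?; exact: uniq.
  have BU y y' : edges T (w, y) -> edges T (w, y') -> B y -> B y' -> y = y'.
    move=> ? ? [K1 H1] [K2 H2]; apply: (uniq y y' (r (maxn K1 K2))) => //.
      by apply: H1; rewrite leq_maxl.
    by apply: H2; rewrite leq_maxr.
  have [A1|A1] := pselect (A y1); have [B1|B1] := pselect (B y1);
  have [A2|A2] := pselect (A y2); have [B2|B2] := pselect (B y2);
  have [A3|A3] := pselect (A y3); have [B3|B3] := pselect (B y3);
  first [by exists y1|by exists y2|by exists y3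
    |by case: n12; apply: AU|by case: n13; apply: AU|by case: n23; apply: AU
    |by case: n12; apply: BU|by case: n13; apply: BU|by case: n23; apply: BU].
have [r' [rr' r'0 r'1]] := prolong_ray Tac wy (fun z wz => nl z (linked_trans lw wz)).
have r'y k : side T y w (r' k.+1) by have := ray_side Tac 0 k rr'; rewrite r'0 r'1 add1n.
have r'n k : side T (r n.+1) (r n) (r' k).
  case: k => [|k]; first by rewrite r'0.
  have := r'y k; move: (r' k.+1); apply: side_ind => [|z z' yz nz zz' z'w].
    apply: (side_step nw wy) => e; apply: ny1; rewrite -e; apply: side_refl.
    by apply/nesym; exact: (edges_neq wy).
  by apply: (side_step nz zz') => e; apply: ny1; rewrite -e; exact: (side_step yz zz' z'w).
have : (V `&` ends_in T (component T x)) (end_of T r').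
  split.
    by apply: sV => U Us; exists r'; split=> // _ [k _ <-]; exact: (Hn U Us _ (r'n k)).
  exists r'; split=> // _ [k _ <-]; apply: component_linked => //.
  by apply: (linked_trans (lr n.+1)); exact: (side_linked (r'n k)).
rewrite VE xiE => /= e.
have [m1 [m2 tl]] : cotail r' r := end_of_cotail rr e.
apply: ny2; exists m2.+1 => k mk.
have -> : r k = r' (m1 + (k - m2))%N by rewrite tl subnKC// ltnW.
rewrite -(@prednK (m1 + (k - m2))%N); last by rewrite addn_gt0 subn_gt0 mk orbT.
exact: r'y.
Qed.

(** Walking from an unramified half-space towards a ramification point. *)
Lemma unramified_start a b v : edges T (a, b) ->
  (forall w, side T a b w -> ~ ramified T w) -> linked T b v -> ramified T v ->
  exists a' b', [/\ edges T (a', b'), linked T a a', ramified T b' &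
    forall w, side T a' b' w -> ~ ramified T w].
Proof.
move=> ab ua bv rv.
have [az|[s [ps as_ sv]]] := side_cover ab (linked_trans (linked_edge ab) bv).
  by case: (ua v).
move: sv; case/shortenP: ps => s' ps' us' ss' sv.
have {as_ ss'} as' : a \notin b :: s'.
  by apply: contra as_; rewrite !inE => /orP[->//|/ss' ->]; rewrite orbT.
rewrite -sv in rv => {sv s bv v}.
elim: s' a b ab ua ps' us' as' rv => [|b1 s IH] a b ab ua /= ps us as' rv.
  by exists a, b; split=> //; exact: linked_refl.
have [rb|nrb] := pselect (ramified T b).
  by exists a, b; split=> //; exact: linked_refl.
move: ps => /andP[/adjP bb1 ps]; move: us => /andP[bs us].
have ab1 : a <> b1 by move=> e; move: as'; rewrite e !inE eqxx orbT.
have ub w : side T b b1 w -> ~ ramified T w.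
  move=> bw; have [->//|/eqP wb] := eqVneq w b.
  have [e [be eb1 ew]] := side_first bw wb.
  suff ea : e = a by rewrite ea in ew; exact: ua.
  apply: contrapT => nea; apply: nrb; exists a, b1, e.
  by split; split=> //; [exact: edges_sym|exact: nesym|exact: nesym].
have [a' [b' [a'b' la rb' ua']]] := IH b b1 bb1 ub ps us bs rv.
by exists a', b'; split=> //; exact: (linked_trans (linked_edge ab) la).
Qed.

Lemma unramified_line x : vertices T x -> (exists y, edges T (x, y)) ->
  (forall y, linked T x y -> ~ leaf T y /\ ~ ramified T y) ->
  bi_infinite_line T (component T x).
Proof.
move=> Vx [y xy] H.
have nl z : linked T x z -> ~ leaf T z by move=> /H[].
have [y' xy' yy'] : exists2 y', edges T (x, y') & y <> y'.
  apply: contrapT => no; apply: (nl x (linked_refl _ _)); exists y; split=> // z xz.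
  by apply: contrapT => yz; apply: no; exists z.
have [r [rr r0 r1]] := prolong_ray Tac xy nl.
have [r' [rr' r'0 r'1]] := prolong_ray Tac xy' nl.
have [rinj re] := rr; have [r'inj re'] := rr'.
pose g (i : int) := match i with Posz n => r n | Negz n => r' n.+1 end.
have gS i : edges T (g i, g (i + 1)%R).
  case: i => [n|[|n]].
  - by rewrite (_ : (Posz n + 1)%R = Posz n.+1)//=; lia.
  - by rewrite (_ : (Negz 0 + 1)%R = Posz 0)//= r0 -r'0; apply: edges_sym; exact: re'.
  - by rewrite (_ : (Negz n.+1 + 1)%R = Negz n)/=; [apply: edges_sym; exact: re'|lia].
have mixed n m : r n <> r' m.+1.
  case: n => [|n] e; first by have := r'inj 0%N m.+1; rewrite -e r0 r'0 => /(_ erefl).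
  have s1 := ray_side Tac 0 n rr; have s2 := ray_side Tac 0 m rr'.
  rewrite r0 r1 add1n in s1; rewrite r'0 r'1 add1n -e in s2.
  by apply: yy'; apply: (side_inj Tac xy xy'); exact: (side_trans s1 (side_sym s2)).
have ginj : injective g.
  move=> [n|n] [m|m] /= e.
  - by rewrite (rinj _ _ e).
  - by case: (mixed n m).
  - by case: (mixed m n).
  - by case: (r'inj _ _ e) => ->.
have lg i : linked T x (g i).
  case: i => n /=; first by rewrite -{1}r0; exact: ray_linked.
  by rewrite -{1}r'0; exact: ray_linked.
have gN i z : edges T (g i, z) -> z = g (i + 1)%R \/ z = g (i - 1)%R.
  move=> gz; have [_] := H _ (lg i).
  apply: contra_notP => /not_orP[z1 z2]; exists z, (g (i + 1)%R), (g (i - 1)%R); split.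
    split=> //; apply: edges_sym; have := gS (i - 1)%R.
    by rewrite (_ : (i - 1 + 1)%R = i); last lia.
  by split=> // /ginj; lia.
exists g; split=> //.
  apply/seteqP; split=> z; first by move=> [i _ <-]; exact: component_linked.
  move=> [_ _ /=]; move: z; apply: linked_ind; first by exists (Posz 0).
  by move=> z z' _ [i _ <-] /gN[]->; eexists.
move=> i j; split.
  by move=> /gN[]/ginj->; lia.
move=> ij; have [->|->] : j = (i + 1)%R \/ j = (i - 1)%R by lia.
  exact: gS.
apply: edges_sym; have := gS (i - 1)%R.
by rewrite (_ : (i - 1 + 1)%R = i); last lia.
Qed.

End ends.

(** * Uniqueness of the cocycle *)

(** An edge that separates two points of Y lies in C, where Y is convex. *)
Lemma edge_convex_induced (X : choiceType) (T : graph X) (C Y : set X) : acyclic T ->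
  edge_convex T C -> Y `<=` C -> edge_convex (induced_graph T C) Y -> edge_convex T Y.
Proof.
move=> Tac Cc YC Yc a b ab [y Yy ay] [y' Yy' by'].
have Ca : C a by apply: (Cc _ _ ab); [exists y; [exact: YC|]|exists y'; [exact: YC|]].
have Cb : C b.
  by apply: (Cc _ _ (edges_sym ab)); [exists y'; [exact: YC|]|exists y; [exact: YC|]].
apply: (Yc a b); first by [].
  by exists y => //; rewrite side_induced//; split=> //; exact: YC.
by exists y' => //; rewrite side_induced//; [split=> //; exact: YC|exact: edges_sym].
Qed.

Lemma induced_edges_sub (X : choiceType) (T : graph X) (Y : set X) :
  edges (induced_graph T Y) `<=` edges T.
Proof. by move=> e []. Qed.

(** Where two cocycles differ, one exceeds the other across a rational gap; the mass
transport along an enumerating function rules this out on a non-null set. *)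
Lemma rn_cocycle_le (R : realType) d (X : measurableType d) (mu : probability X R)
    (G : graph X) (f : nat -> X -> X) (rho1 rho2 : X * X -> R) :
  (forall n, measurable_fun setT (f n)) ->
  (forall x y, conn_rel G (x, y) -> exists n, f n x = y) ->
  (forall (g h : X * X -> X), measurable_fun setT g -> measurable_fun setT h ->
     mpred (fun z => g z = h z)) ->
  measurable (conn_rel G) -> measurable (vertices G) ->
  rn_cocycle mu G rho1 -> rn_cocycle mu G rho2 ->
  mu.-negligible [set x | exists2 y, conn_rel G (x, y) & rho2 (y, x) < rho1 (y, x)].
Proof.
move=> fm fE meq mE mV [m1 p1 _ t1] [m2 p2 _ t2].
have Gsym x y : conn_rel G (x, y) -> conn_rel G (y, x).
  by move=> [Vx Vy xy]; split=> //; exact: linked_sym.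
pose B n (p q : rat) : set X := [set x | conn_rel G (x, f n x) /\
  (conn_rel G (f n x, x) /\ rho2 (f n x, x) <= ratr p) /\
  (conn_rel G (f n x, x) /\ ratr q <= rho1 (f n x, x))].
have mB n p q : measurable (B n p q).
  have mid : measurable_fun setT (@id X) by exact: measurable_id.
  apply: mpred_and.
    apply: (@mpred_comp _ _ _ _ (fun p => conn_rel G p) (fun x => (x, f n x))) => //.
    exact: measurable_fun_pair.
  apply: mpred_and.
    apply: (@mpred_comp _ _ _ _ (fun z => conn_rel G z /\ rho2 z <= ratr p) (fun x => (f n x, x))).
      exact: measurable_fun_pair.
    have := m2 mE `]-oo, (ratr p : R)]%classic (measurable_itv _).
    by apply: mpred_ext => z; split=> -[Ez]; rewrite /= in_itv.
  apply: (@mpred_comp _ _ _ _ (fun z => conn_rel G z /\ ratr q <= rho1 z) (fun x => (f n x, x))).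
    exact: measurable_fun_pair.
  have := m1 mE `[(ratr q : R), +oo[%classic (measurable_itv _).
  by apply: mpred_ext => z; split=> -[Ez]; rewrite /= in_itv /= andbT.
have BV n p q : B n p q `<=` vertices G by move=> x [[]].
have mrho rho n p q : measurable_fun (conn_rel G) rho ->
    measurable_fun (B n p q) (fun x => (rho (f n x, x))%:E).
  move=> mr; apply/measurable_EFinP.
  apply: (@measurable_comp _ _ _ _ _ _ (conn_rel G) rho (B n p q) (fun x => (f n x, x))) => //.
    by move=> _ [x [_ [[H _] _]] <-].
  apply: (measurable_funS measurableT (@subsetT _ _)); exact: measurable_fun_pair.
have B0 n p q : 0 <= (ratr p : R) -> (ratr p : R) < ratr q -> mu (B n p q) = 0%E.
  move=> p0 pq.
  (* Under h each x in B receives from f n x alone. *)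
  pose h (z : X * X) : \bar R := if `[< B n p q z.2 /\ f n z.2 = z.1 >] then 1%E else 0%E.
  have h0 z : (0 <= h z)%E by rewrite /h; case: ifP.
  have mh : measurable_fun (conn_rel G) h.
    apply: (measurable_funS (@measurableT _ _) (@subsetT _ _)).
    apply: (measurable_fun_if_mpred (u := fun=> 1%E) (v := fun=> 0%E)) => //.
    apply: mpred_and; first exact: (mpred_comp measurable_snd (mB n p q)).
    by apply: meq => //; apply: measurableT_comp => //; exact: measurable_snd.
  have intE rho : (forall z, conn_rel G z -> 0 < rho z) ->
      (\int[mu]_(x in vertices G) (\esum_(y in component G x) (h (y, x) * (rho (y, x))%:E)) =
       \int[mu]_(x in B n p q) (rho (f n x, x))%:E)%E.
    move=> r0; rewrite -[X in _ = (\int[mu]_(x in X) _)%E](setIidr (BV n p q)).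
    rewrite integral_mkcondr; apply: eq_integral => x _; rewrite patchE.
    have hr y : component G x y -> (0 <= h (y, x) * (rho (y, x))%:E)%E.
      by move=> /Gsym/r0/ltW ry; rewrite mule_ge0// lee_fin.
    have [Bx|nBx] := pselect (B n p q x); last first.
      rewrite memNset// esum1// => y _; rewrite /h; case: asboolP => [[]//|_].
      exact: mul0e.
    have xfx : component G x (f n x) by case: Bx.
    rewrite mem_set// (esum_single xfx hr) /h.
      by case: asboolP => [_|[]//]; rewrite mul1e.
    move=> y _ yf; case: asboolP => [[_ /= fy]|_]; last exact: mul0e.
    by case: yf.
  have I12 : (\int[mu]_(x in B n p q) (rho1 (f n x, x))%:E =
              \int[mu]_(x in B n p q) (rho2 (f n x, x))%:E)%E.
    by rewrite -intE// -intE// -(t1 h mh (fun z _ => h0 z)) -(t2 h mh (fun z _ => h0 z)).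
  have q1 : ((ratr q)%:E * mu (B n p q) <= \int[mu]_(x in B n p q) (rho1 (f n x, x))%:E)%E.
    rewrite -integral_cst//; apply: ge0_le_integral => //.
    - by move=> x _; rewrite lee_fin; exact: (le_trans p0 (ltW pq)).
    - exact: mrho.
    - by move=> x [_ [_ [_ qx]]]; rewrite lee_fin.
  have I2p : (\int[mu]_(x in B n p q) (rho2 (f n x, x))%:E <= (ratr p)%:E * mu (B n p q))%E.
    rewrite -integral_cst//; apply: ge0_le_integral => //.
    - by move=> x [_ [[Ex _] _]]; rewrite lee_fin; exact/ltW/p2.
    - exact: mrho.
    - by move=> x [_ [[_ px] _]]; rewrite lee_fin.
  have := le_trans q1 (le_trans _ I2p); rewrite I12 => /(_ (lexx _)).
  have fB : mu (B n p q) \is a fin_num by exact: fin_num_measure.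
  have r0 : 0 <= fine (mu (B n p q)) by apply: fine_ge0.
  rewrite -(fineK fB) -!EFinM !lee_fin => qr; congr (_%:E).
  apply/eqP; rewrite eq_le r0 andbT leNgt; apply/negP => r1.
  by move: qr; rewrite ler_pM2r// leNgt pq.
apply: (negligibleS _ (bigcup_countType_negligible (F := fun t : nat * rat * rat =>
    if `[< 0 <= (ratr t.1.2 : R) /\ (ratr t.1.2 : R) < ratr t.2 >]
    then B t.1.1 t.1.2 t.2 else set0) _)); last first.
  move=> [[n p] q] /=; case: asboolP => [[p0 pq]|_]; last exact: negligible_set0.
  by apply/negligibleP => //; exact: B0.
move=> x [y xy lt21]; have [n fy] := fE x y xy.
have r2 := p2 _ (Gsym _ _ xy).
have [p /andP[p1' p2']] := rat_in_itvoo lt21.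
have [q /andP[q1' q2']] := rat_in_itvoo p2'.
exists (n, p, q) => //=; case: asboolP => [_|[]]; last first.
  by split=> //; exact: (ltW (lt_trans r2 _)).
rewrite /B /= fy; split=> //; split; split=> //; try exact: Gsym; exact: ltW.
Qed.

(** * Properties of the core *)

Section main.
Context (R : realType) d (X : measurableType d) (c : X -> nat -> nat).
Variables (mu : probability X R) (T : graph X) (f : nat -> X -> X) (rho : X * X -> R).
Hypothesis HE : weighted_equivalence c mu (conn_rel T) f rho.
Hypothesis T_vert : vertices T = [set: X].
Hypothesis Tac : acyclic T.
Hypothesis mT : measurable (edges T).

Local Notation E := (conn_rel T).
Let Exx := we_refl HE.
Let Esym := we_sym HE.
Let Etrans := we_trans HE.

Lemma conn_linked x y : E (x, y) <-> linked T x y.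
Proof. by split=> [[]//|xy]; split=> //=; rewrite T_vert. Qed.

Lemma edges_conn : edges T `<=` E.
Proof. by move=> [x y] xy; apply/conn_linked; exact: linked_edge. Qed.

Let mV : measurable (vertices T). Proof. by rewrite T_vert. Qed.

Local Notation core := (core_of E rho T).
Local Notation Tinf := (induced_graph T core).
Local Notation core2 := (core_of E rho Tinf).

Let core_m : measurable core := core_measurable HE edges_conn mT mV.
Let core_cvx : edge_convex T core := core_convex Tac.

Lemma Tinf_acyclic : acyclic Tinf.
Proof. exact: (acyclic_sub (@induced_edges_sub _ _ _) Tac). Qed.

Lemma Tinf_edges : edges Tinf `<=` E.
Proof. by apply: (subset_trans (@induced_edges_sub _ _ _)); exact: edges_conn. Qed.

Lemma Tinf_edges_measurable : measurable (edges Tinf).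
Proof. by apply: measurableI => //; exact: measurableX. Qed.

Lemma Tinf_vertices : vertices Tinf = core.
Proof. by rewrite /= T_vert setTI. Qed.

Lemma Tinf_linked x y : linked Tinf x y -> linked T x y.
Proof. exact: linked_sub (@induced_edges_sub _ _ _). Qed.

Lemma Tinf_linked_core x y : core x -> linked Tinf x y -> core y.
Proof. by move=> cx; move: y; apply: linked_ind => // z z' _ _ [_ [_]]. Qed.

Lemma core2_sub : core2 `<=` core.
Proof. by move=> x []; rewrite Tinf_vertices. Qed.

Lemma Tinf_convex Y : Y `<=` core -> edge_convex Tinf Y -> edge_convex T Y.
Proof. exact: edge_convex_induced. Qed.

Definition no_dead_ends N := null_invariant mu E N /\
  (forall x x', ~ N x -> core x -> edges T (x, x') ->
    exists y, [/\ edges T (x, y), y <> x' & core y]).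

Lemma no_dead_ends_exists : exists N, no_dead_ends N.
Proof.
have [N NN HN] := core_two_neighbours HE Tac edges_conn mT mV.
by exists N.
Qed.

Lemma no_dead_ends_out N x y : no_dead_ends N -> linked T x y -> ~ N x -> ~ N y.
Proof. by move=> [NN _] /conn_linked xy; exact: (null_invariant_out HE NN xy). Qed.

Lemma no_dead_ends_leafless N x : no_dead_ends N -> ~ N x -> core x ->
  forall y, linked Tinf x y -> ~ leaf Tinf y.
Proof.
move=> NG nNx cx y xy [y' [[yy' [/= cy cy']] uniq]].
have [|z [yz zy' cz]] := (NG.2) y y' _ cy yy'.
  by apply: (no_dead_ends_out NG _ nNx); exact: Tinf_linked.
by apply: zy'; apply/esym; apply: uniq.
Qed.

(** The core continues in two directions at x, and each direction can be prolonged for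
want of leaves. *)
Lemma no_dead_ends_two_rays N x x' : no_dead_ends N -> ~ N x -> core x -> edges T (x, x') ->
  exists r r', [/\ ray Tinf r, ray Tinf r', r 0%N = x, r' 0%N = x & ~ cotail r r'].
Proof.
move=> NG nNx cx xx'.
have [y [xy yx' cy]] := NG.2 x x' nNx cx xx'.
have [z [xz zy cz]] := NG.2 x y nNx cx xy.
have nl := no_dead_ends_leafless NG nNx cx.
have xyi : edges Tinf (x, y) by [].
have xzi : edges Tinf (x, z) by [].
have [r [rr r0 r1]] := prolong_ray Tinf_acyclic xyi nl.
have [r' [rr' r'0 r'1]] := prolong_ray Tinf_acyclic xzi nl.
exists r, r'; split=> //; apply: (rays_not_cotail Tinf_acyclic rr rr').
  by rewrite r0 r'0.
by rewrite r1 r'1; exact: nesym.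
Qed.

Lemma core_sub_section (Y : set X) : measurable Y -> graph_convex T Y -> complete_section T Y ->
  mu.-negligible (core `\` Y).
Proof.
move=> mY /(graph_convexP Tac) Yc Ys.
have [N NN HN] := core_sub_convex HE Tac edges_conn mT Yc mY.
apply: (negligible_out NN) => x nNx [cx nYx]; apply: nYx.
have [|y Yy /conn_linked xy] := Ys x; first by rewrite T_vert.
exact: (HN x y nNx cx Yy (linked_sym xy)).
Qed.

(** A ray towards an isolated end of the core is eventually unramified; if the
component is not a line, following the ray backwards meets a first ramification point,
and this happens almost nowhere. *)
Lemma core_geometry : {ae mu, forall x, core x ->
   bi_infinite_line Tinf (component Tinf x) \/
   (forall y, component Tinf x y -> ~ leaf Tinf y) /\
   no_isolated_end Tinf (component Tinf x)}.
Proof.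
have [N1 NG] := no_dead_ends_exists.
have [N2 NN2 HN2] := core_no_isolated_branch HE Tac edges_conn mT mV.
apply: (negligible_out (null_invariantU NG.1 NN2)) => x /not_orP[nN1 nN2]; apply => cx.
have nl := no_dead_ends_leafless NG nN1 cx.
have Vx : vertices Tinf x by rewrite Tinf_vertices.
have [iso0|/set0P[xi iso]] := eqVneq
    (isolated (ends_in Tinf (component Tinf x) : set (end_space Tinf))) set0.
  by right; split=> // y [_ _]; exact: nl.
left; have [r [n [rr xr unr]]] := isolated_unramified Tinf_acyclic Vx nl iso.
have [_ re] := rr.
have xrn k : linked Tinf x (r k) := linked_trans xr (ray_linked k rr).
apply: (unramified_line Tinf_acyclic Vx).
  have [xr0|/eqP xr0] := eqVneq x (r 0%N); first by exists (r 1%N); rewrite xr0.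
  have [s] := xr; case: s => [_ /= e|y s /= /andP[/adjP xy _] _]; first by case: xr0.
  by exists y.
move=> v xv; split; first exact: nl.
move=> rv.
have [a [b [ab la rb una]]] := unramified_start (edges_sym (re n)) unr
  (linked_trans (linked_sym (xrn n)) xv) rv.
have xa : linked Tinf x a := linked_trans (xrn n.+1) la.
have [ab' [/= ca cb]] := ab.
apply: (HN2 a b _ ca ab' cb rb).
  by apply: (null_invariant_out HE NN2 _ nN2); apply/conn_linked; exact: Tinf_linked.
by move=> w aw cw; apply: una; rewrite side_induced.
Qed.

Lemma conn_Tinf_sub : conn_rel Tinf `<=` E.
Proof. by move=> [x y] [_ _ /= /Tinf_linked/conn_linked]. Qed.

Lemma conn_Tinf_measurable : measurable (conn_rel Tinf).
Proof.
have m1 : measurable_fun setT (@fst X X) by [].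
have m2 : measurable_fun setT (@snd X X) by [].
apply: (@mpred_ext _ _ (fun p : X * X => core p.1 /\ core p.2 /\ linked Tinf p.1 p.2)).
  move=> p; split=> [[c1 [c2 l]]|[+ + l]]; first by split=> //; rewrite Tinf_vertices.
  by rewrite Tinf_vertices.
apply: mpred_and; first exact: (mpred_comp m1 core_m).
apply: mpred_and; first exact: (mpred_comp m2 core_m).
exact: (mpred_linked HE Tinf_edges Tinf_edges_measurable).
Qed.

Lemma conn_Tinf_sym x y : conn_rel Tinf (x, y) -> conn_rel Tinf (y, x).
Proof. by move=> [Vx Vy xy]; split=> //; exact: linked_sym. Qed.

Lemma mcp_Tinf : mcp mu Tinf.
Proof.
split; first split.
- split; first exact: conn_Tinf_measurable.
    by move=> [x y] [].
  move=> x; apply: (@sub_countable _ _ _ [set y | exists n, f n x = y]).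
    apply: subset_card_le => y /conn_Tinf_sub xy; exact: ((we_enum HE _ _).1 xy).
  rewrite (_ : [set y | _] = range (fun n => f n x)); first exact: card_image_le.
  by apply/seteqP; split=> y [n]; [move=> <-; exists n|move=> _ <-; exists n].
- split.
  + by move=> x Vx; split=> //; exact: linked_refl.
  + exact: conn_Tinf_sym.
  + by move=> x y z [Vx Vy xy] [_ Vz yz]; split=> //; exact: (linked_trans xy yz).
- move=> N NV /(we_null HE); apply: negligibleS => x [y Ny xy].
  by exists y => //; exact: conn_Tinf_sub.
Qed.

(** Mass that is sent inside the core is mass transport in T that vanishes elsewhere. *)
Lemma rn_cocycle_Tinf : rn_cocycle mu Tinf rho.
Proof.
split.
- apply: (measurable_funS (we_measurable HE) conn_Tinf_sub).
  exact: (we_weight_measurable HE).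
- by move=> p /conn_Tinf_sub; exact: (we_weight_gt0 HE).
- by move=> x y z /conn_Tinf_sub xy /conn_Tinf_sub yz; exact: (we_cocycle HE).
move=> h mh h0.
have mh' : measurable_fun E (h \_ (conn_rel Tinf)).
  apply: (measurable_funS measurableT (@subsetT _ _)).
  by apply: (measurable_restrictT h conn_Tinf_measurable).1.
have h'0 p : E p -> (0 <= (h \_ (conn_rel Tinf)) p)%E.
  by move=> _; rewrite patchE; case: ifPn => // /set_mem; exact: h0.
have -> : vertices Tinf = setT `&` core by rewrite Tinf_vertices setTI.
have ccore x y : conn_rel Tinf (x, y) -> core x by move=> []; rewrite Tinf_vertices.
rewrite !integral_mkcondr; have := we_transport HE mh' h'0.
have aux (u : X -> X -> \bar R) x :
   ((fun x => \esum_(y in component Tinf x) u x y) \_ core)%E x =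
   (\esum_(y in [set y | E (x, y)]) (if `[< conn_rel Tinf (x, y) >] then u x y else 0))%E.
  rewrite patchE; case: ifPn => [_|/negP ncx].
    rewrite esum_mkcond [RHS]esum_mkcond; apply: eq_esum => y _.
    have [xy|nxy] := pselect (conn_rel Tinf (x, y)).
      by rewrite !mem_set//; [case: asboolP|exact: conn_Tinf_sub].
    by rewrite memNset//; case: asboolP => // _; case: ifP.
  rewrite esum1// => y _; case: asboolP => // /ccore cx.
  by case: ncx; exact/mem_set.
move=> tr; etransitivity; [|etransitivity; [exact: tr|]].
  apply: eq_integral => x _; rewrite (aux (fun x y => h (x, y))); apply: eq_esum => y _.
  rewrite patchE; case: asboolP => xy; first by rewrite mem_set.
  by rewrite memNset.
apply: eq_integral => x _; rewrite (aux (fun x y => (h (y, x) * (rho (y, x))%:E)%E)).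
apply: eq_esum => y _; rewrite patchE; case: asboolP => xy.
  by rewrite mem_set//; exact: conn_Tinf_sym.
by rewrite memNset ?mul0e// => /conn_Tinf_sym.
Qed.

Lemma cocycle_unique rho' : rn_cocycle mu Tinf rho' ->
  exists2 N, null_invariant mu E N & forall x y, ~ N x -> conn_rel Tinf (x, y) ->
    rho' (y, x) = rho (y, x).
Proof.
move=> rn'.
have fE x y : conn_rel Tinf (x, y) -> exists n, f n x = y.
  by move=> /conn_Tinf_sub xy; apply/(we_enum HE).
have meq (g h : X * X -> X) : measurable_fun setT g -> measurable_fun setT h ->
    mpred (fun z => g z = h z) by exact: (mpred_eq HE).
have mVi : measurable (vertices Tinf) by rewrite Tinf_vertices.
have gap rho1 rho2 (rn1 : rn_cocycle mu Tinf rho1) (rn2 : rn_cocycle mu Tinf rho2) :=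
  rn_cocycle_le (we_enum_measurable HE) fE meq conn_Tinf_measurable mVi rn1 rn2.
have [N1 NN1 H1] := negligible_invariant HE (gap _ _ rn' rn_cocycle_Tinf).
have [N2 NN2 H2] := negligible_invariant HE (gap _ _ rn_cocycle_Tinf rn').
exists (N1 `|` N2); first exact: null_invariantU.
move=> x y /not_orP[nN1 nN2] xy; apply/eqP; rewrite eq_le !leNgt.
apply/andP; split; apply/negP => lt; [apply: nN1; apply: H1|apply: nN2; apply: H2]; by exists y.
Qed.

(** Were the core of the core empty on many components that meet the core, a section
with at most one end would contain the core there, which has two ends or more. *)
Lemma core_idempotent : exists2 N, null_invariant mu E N & forall x, ~ N x -> core x -> core2 x.
Proof.
have [N1 NG] := no_dead_ends_exists.
have mVi : measurable (vertices Tinf) by rewrite Tinf_vertices.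
have [N2 NN2 [Y [mY YV Yc Yend Ysec]]] :=
  coreless_section HE Tinf_acyclic Tinf_edges Tinf_edges_measurable mVi.
have Ycore : Y `<=` core by rewrite -Tinf_vertices.
have [N3 NN3 HN3] := core_sub_convex HE Tac edges_conn mT (Tinf_convex Ycore Yc) mY.
have c2m : measurable core2 := core_measurable HE Tinf_edges Tinf_edges_measurable mVi.
have c2c := Tinf_convex core2_sub (core_convex (E := E) (rho := rho) Tinf_acyclic).
have [N4 NN4 HN4] := core_sub_convex HE Tac edges_conn mT c2c c2m.
exists (N1 `|` N2 `|` N3 `|` N4).
  by do 3!apply: null_invariantU => //; exact: NG.1.
move=> x /not_orP[/not_orP[/not_orP[nN1 nN2] nN3] nN4] cx.
apply: contrapT => nc2x.
have Vx : vertices Tinf x by rewrite Tinf_vertices.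
have cl : coreless E rho Tinf x.
  split=> // y xy c2y; apply: nc2x.
  exact: (HN4 x y nN4 cx c2y (linked_sym (Tinf_linked xy))).
have [y0 Yy0 xy0] := Ysec x nN2 cl.
have YC y : linked Tinf x y -> Y y.
  move=> xy; have xyT := Tinf_linked xy.
  apply: (HN3 y y0) => //.
  - by apply: (null_invariant_out HE NN3 _ nN3); apply/conn_linked.
  - exact: (Tinf_linked_core cx xy).
  - exact: (linked_trans (linked_sym (Tinf_linked xy0)) xyT).
have [x' xx'] : exists x', edges T (x, x').
  have /not_andP[//|/existsNP[a /existsNP[b /not_implyP[ab /not_implyP[ax _]]]]] := nc2x.
  by have [y [xy _] _] := side_toward Tinf_acyclic ab ax; exists y.
have [r [r' [rr rr' r0 r'0]]] := no_dead_ends_two_rays NG nN1 cx xx'.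
apply; apply: Yend => //.
- by move=> n; apply: YC; rewrite -r0; exact: ray_linked.
- by move=> n; apply: YC; rewrite -r'0; exact: ray_linked.
- by rewrite r0 r'0; exact: linked_refl.
Qed.

Lemma core_of_core rho' : rn_cocycle mu Tinf rho' ->
  exists2 N, invariant_null mu T N & vertex_core Tinf rho' `\` N = core `\` N.
Proof.
move=> /cocycle_unique[N1 NN1 HN1].
have [N2 NN2 HN2] := core_idempotent.
exists (N1 `|` N2); first exact: null_invariantU.
have H x : ~ N1 x -> vertex_core Tinf rho' x <-> core2 x.
  move=> nN1; rewrite -(vertex_coreE HE Tinf_acyclic Tinf_edges).
  have sumE U : half_space Tinf U -> U x ->
      (\esum_(y in U) (rho' (y, x))%:E = \esum_(y in U) (rho (y, x))%:E)%E.
    move=> [UV Uc _] Ux; apply: eq_esum => y Uy; rewrite HN1//.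
    split; [exact: UV|exact: UV|]; apply: (linked_sub (@induced_edges_sub _ _ _) (Uc x y Ux Uy)).
  split=> -[Vx H]; split=> // U hU Ux.
    by rewrite -(sumE U hU Ux); exact: H.
  by rewrite (sumE U hU Ux); exact: H.
apply/seteqP; split=> x [].
  by move=> + /not_orP[nN1 nN2] => /(H x nN1)/core2_sub cx; split=> // -[].
by move=> cx /not_orP[nN1 nN2]; split; [apply/(H x nN1); exact: HN2|case].
Qed.

Lemma linked_out N x y : null_invariant mu E N -> ~ N x -> linked T x y ->
  linked (induced_graph T (~` N)) x y.
Proof.
move=> NN nNx; move: y; apply: linked_ind => [|z z' xz IH zz']; first exact: linked_refl.
apply: (linked_trans IH); apply: linked_edge; split=> //; split=> /=.
  by apply: (null_invariant_out HE NN _ nNx); apply/conn_linked.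
apply: (null_invariant_out HE NN _ nNx); apply/conn_linked.
exact: (linked_trans xz (linked_edge zz')).
Qed.

(** Off an invariant null set no component meets the core. *)
Lemma null_core_ess_one_ended : mu.-negligible core -> ess_at_most_one_ended mu T.
Proof.
move=> /(negligible_invariant HE)[N1 NN1 HN1].
have [N2 NN2 [Y [mY YV Yc Yend Ysec]]] := coreless_section HE Tac edges_conn mT mV.
have NN := null_invariantU NN1 NN2.
exists (N1 `|` N2) => //=; set N := N1 `|` N2 in NN *.
pose T' := induced_graph T (~` N).
have T'ac : acyclic T' := acyclic_sub (@induced_edges_sub _ _ _) Tac.
exists (Y `&` ~` N); split.
- by apply: measurableI => //; apply: measurableC; case: NN.
- by move=> x [Yx nNx]; split=> //; rewrite T_vert.
- apply/(graph_convexP T'ac) => a b [ab [/= na nb]] [y [Yy _] ay] [y' [Yy' _] by'].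
  split=> //; apply: (Yc a b ab).
    by exists y => //; exact: (side_sub (@induced_edges_sub _ _ _) ay).
  by exists y' => //; exact: (side_sub (@induced_edges_sub _ _ _) by').
- move=> x [_ /= nNx].
  have [|y Yy xy] := Ysec x (fun h => nNx (or_intror h)).
    split; first by rewrite T_vert.
    move=> y /conn_linked xy /HN1 N1y.
    by apply: (null_invariant_out HE NN xy nNx); left.
  have nNy : ~ N y by apply: (null_invariant_out HE NN _ nNx); apply/conn_linked.
  exists y; first by split.
  by split=> /=; rewrite ?T_vert//; exact: (linked_out NN).
- move=> x _ xi eta [r [[rinj re] rC ->]] [r' [[r'inj re'] rC' ->]].
  have rT : ray T r by split=> // n; have [[]] := re n.
  have rT' : ray T r' by split=> // n; have [[]] := re' n.
  apply: end_of_eq; apply: Yend => //.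
  + by move=> n; have [_ [/= []]] := re n.
  + by move=> n; have [_ [/= []]] := re' n.
  + have [_ _ l] := rC _ (ex_intro2 _ _ 0%N Logic.I erefl).
    have [_ _ l'] := rC' _ (ex_intro2 _ _ 0%N Logic.I erefl).
    have sub : edges (induced_graph T' (Y `&` ~` N)) `<=` edges T by move=> e [[]].
    exact: (linked_sub sub (linked_trans (linked_sym l) l')).
Qed.

(** The section contains almost all of the core, but two rays of the core from one
point have different ends. *)
Lemma ess_one_ended_null_core : {ae mu, forall x, exists y, edges T (x, y)} ->
  ess_at_most_one_ended mu T -> mu.-negligible core.
Proof.
move=> /(negligible_invariant HE)[N0 NN0 HN0] [N NN [Y [mY YV Yc Ysec Yend]]].
pose T' := induced_graph T (~` N).
have T'ac : acyclic T' := acyclic_sub (@induced_edges_sub _ _ _) Tac.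
have nNN : null_invariant mu E N by [].
have Nc : edge_convex T (~` N).
  move=> a b ab [y nNy ay] _; apply: (null_invariant_out HE nNN _ nNy).
  by apply/conn_linked; apply: linked_sym; exact: (side_linked ay).
have YN : Y `<=` ~` N by move=> y /YV[].
have YcT := edge_convex_induced Tac Nc YN ((graph_convexP T'ac Y).1 Yc).
have [N1 NN1 HN1] := core_sub_convex HE Tac edges_conn mT YcT mY.
have [N2 NG] := no_dead_ends_exists.
apply: (negligible_out (null_invariantU (null_invariantU NN0 nNN) (null_invariantU NN1 NG.1))).
move=> x /not_orP[/not_orP[nN0 nNx] /not_orP[nN1 nN2]] cx.
have [x' xx'] : exists x', edges T (x, x') by apply: contrapT => h; exact/nN0/HN0.
have [|y0 Yy0 [_ _ xy0]] := Ysec x; first by split; rewrite ?T_vert.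
have {}xy0 : linked T x y0 := linked_sub (@induced_edges_sub _ _ _) xy0.
have [r [r' [rr rr' r0 r'0]]] := no_dead_ends_two_rays NG nN2 cx xx'.
have YC y : linked Tinf x y -> Y y.
  move=> xy; have xyT := Tinf_linked xy.
  apply: (HN1 y y0) => //.
  - by apply: (null_invariant_out HE NN1 _ nN1); apply/conn_linked.
  - exact: (Tinf_linked_core cx xy).
  - exact: (linked_trans (linked_sym xy0) xyT).
pose G := induced_graph T' Y.
have GV y : Y y -> vertices G y by move=> Yy; split=> //; exact: YV.
have Gray s : ray Tinf s -> s 0%N = x -> ray G s /\ range s `<=` component G x.
  move=> [sinj se] s0.
  have Ys n : Y (s n) by apply: YC; rewrite -s0; apply: ray_linked; split.
  have Gs : ray G s.
    split=> // n; have [e _] := se n.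
    split; last by split; exact: Ys.
    by split=> //; split; exact: (YN _ (Ys _)).
  have xs n : linked G x (s n) by rewrite -s0; exact: ray_linked.
  have Gx : vertices G x by rewrite -s0; exact: (GV _ (Ys 0%N)).
  by split=> // _ [n _ <-]; split; [exact: Gx|exact: (GV _ (Ys n))|exact: xs].
have [Gr rC] := Gray r rr r0; have [Gr' rC'] := Gray r' rr' r'0.
apply; apply: (end_of_cotail Gr').
apply: (Yend x _ (end_of G r) (end_of G r')).
- by apply: GV; apply: YC; exact: linked_refl.
- by exists r.
- by exists r'.
Qed.

End main.

Theorem theorem1p5 (R : realType) (d : measure_display) (X : measurableType d)
    (mu : probability X R) (T : graph X) (rho : X * X -> R)
    (X_std : standard_borel R X)
    (T_vert : vertices T = [set: X])
    (T_borel : measurable (edges T))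
    (T_lc : locally_countable T)
    (T_acyclic : acyclic T)
    (T_mcp : mcp mu T)
    (rho_rn : rn_cocycle mu T rho) :
  let core := vertex_core T rho in
  let Tinf := induced_graph T core in
  [/\ (* (a) *)
      forall Y : set X, measurable Y -> graph_convex T Y -> complete_section T Y ->
        mu.-negligible (core `\` Y),
      (* (b) *)
      {ae mu, forall x, core x ->
        bi_infinite_line Tinf (component Tinf x) \/
        (forall y, component Tinf x y -> ~ leaf Tinf y) /\
        no_isolated_end Tinf (component Tinf x)},
      (* (c) *)
      [/\ mcp mu Tinf,
          exists rho', rn_cocycle mu Tinf rho' &
          forall rho', rn_cocycle mu Tinf rho' ->
            exists2 N, invariant_null mu T N &
              vertex_core Tinf rho' `\` N = core `\` N] &
      (* (d) *)
      (mu.-negligible core -> ess_at_most_one_ended mu T) /\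
      ({ae mu, forall x, exists y, edges T (x, y)} ->
        ess_at_most_one_ended mu T -> mu.-negligible core)].
Proof.
have [c cX] := standard_borel_code X_std.
have [[[mE EV Ec] [Erefl Esym Etrans]] Enull] := T_mcp.
have VT x : vertices T x by rewrite T_vert.
have Exx x : conn_rel T (x, x) by exact: Erefl.
have [f fm fE] := lusin_novikov cX mE Exx Ec.
have HE : weighted_equivalence c mu (conn_rel T) f rho.
  have [rm r0 rM tr] := rho_rn; split=> //.
  - by move=> N; apply: Enull => x _.
  - by move=> h mh h0; have := tr h mh h0; rewrite T_vert.
rewrite /= (vertex_coreE HE T_acyclic (edges_conn T_vert)); split.
- exact: (core_sub_section HE).
- exact: (core_geometry HE).
- split; first exact: (mcp_Tinf HE).
    by exists rho; exact: (rn_cocycle_Tinf HE).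
  by move=> rho'; exact: (core_of_core HE).
- by split; [exact: (null_core_ess_one_ended HE)|exact: (ess_one_ended_null_core HE)].
Qed.
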